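(* Let $\pi_{\mathrm{PM}}$ and $\pi_{\mathrm{MAP}}$ be two priors on $\Theta$, let $\hat\theta_{\mathrm{PM}}$ be the posterior mean of $\theta$ based on $\pi_{\mathrm{PM}}$, let $\hat\theta_{\mathrm{MAP}}$ be the MAP estimate of $\theta$ based on $\pi_{\mathrm{MAP}}$, and let $\hat\theta_{\mathrm{MLE}}$ be the maximum likelihood estimate, all computed from $y^n$. Suppose that, for every $a=1,\ldots,d$, $$\partial_a\log\frac{\pi_{\mathrm{PM}}}{\pi_{\mathrm{MAP}}}(\hat\theta_{\mathrm{MLE}})-\left(\partial_a\log\pi_{\mathrm J}(\hat\theta_{\mathrm{MLE}})+\frac12\, g^{cd}(\hat\theta_{\mathrm{MLE}})\,\Gamma^{(\mathrm e)}_{cda}(\hat\theta_{\mathrm{MLE}})\right)=o_p(n^{-1}).$$ Then $\hat\theta_{\mathrm{PM}}$ and $\hat\theta_{\mathrm{MAP}}$ coincide except for terms of $o_p(n^{-1})$, i.e. $\hat\theta^a_{\mathrm{PM}}-\hat\theta^a_{\mathrm{MAP}}=o_p(n^{-1})$ for every $a=1,\ldots,d$.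
   Context: Setting. Observations $y^n=\{y(1),\ldots,y(n)\}$ in a sample space $\mathcal Y$ with base measure $dy$ are independently distributed according to a density $p(y;\theta_0)$ belonging to a statistical model $\mathcal P=\{p(y;\theta)\mid\theta\in\Theta\}$, $\Theta\subset\mathbb R^d$; $\theta_0$ is the true parameter, and $o_p$ refers to $n\to\infty$ under $\theta_0$. Write $p(y^n;\theta)=\prod_{t=1}^n p(y(t);\theta)$, $\partial_a=\partial/\partial\theta^a$, $\partial_{ab}=\partial_a\partial_b$, and so on. Einstein's summation convention is used: an index occurring once as an upper and once as a lower index in one term is summed from $1$ to $d$. Estimators. A prior is a (possibly unnormalized) density $\pi(\theta)$. The posterior mean based on $\pi$ is $\int\theta\, p(y^n;\theta)\pi(\theta)d\theta/\int p(y^n;\theta)\pi(\theta)d\theta$. The MAP estimate based on $\pi$ maximizes $p(y^n;\theta)\pi(\theta)$ over $\theta$. The MLE maximizes $p(y^n;\theta)$ over $\theta$. Geometric quantities. Fisher information matrix: $g_{ab}(\theta)=\int p(y;\theta)\{\partial_a\log p(y;\theta)\}\{\partial_b\log p(y;\theta)\}dy$, with inverse matrix $(g^{ab})$ and determinant $|g|$. The e-connection coefficients are $\Gamma^{(\mathrm e)}_{abc}(\theta)=\int p(y;\theta)\{\partial_a\partial_b\log p(y;\theta)\}\{\partial_c\log p(y;\theta)\}dy$. The Jeffreys prior is $\pi_{\mathrm J}(\theta)=|g(\theta)|^{1/2}$. Standing regularity conditions (priors are restricted to those satisfying them), where $\pi(\theta\mid y^n)$ denotes the posterior density: A1. All derivatives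 of $\log p(y;\theta)$ up to the fifth order exist for all $y$ and all $\theta$ in a neighborhood of $\theta_0$. A2. All moments exist for the first four derivatives, as well as for the maximum squared fifth derivatives in a neighborhood of $\theta_0$; moreover the moments are differentiable in a neighborhood of $\theta_0$. A3. The information matrix with $(a,b)$ component $\mathrm E_{\theta_0}[\partial_a\log p(y^n;\theta)\,\partial_b\log p(y^n;\theta)]$ is positive definite. A4. $\mathrm E_{\theta_0}[\partial_{a_1}\cdots\partial_{a_r}p(y;\theta)/p(y;\theta)]_{\theta=\theta_0}=0$ for $r=1,\ldots,4$. A5. The prior density is positive and possesses two derivatives in a neighborhood of $\theta_0$. A6. For all $\epsilon>0$, $\mathrm P[\|\hat\theta_{\mathrm{MLE}}-\theta_0\|>\epsilon]=o(n^{-2})$. A7. $\int_{\|\theta-\theta_0\|>\epsilon}\sup_y p(y;\theta)\,\pi(\theta\mid y^n)\,d\theta=t_n/n^2$ for a random variable $t_n$ satisfying $\mathrm P(|t_n|>\epsilon)=o(n^{-2})$ for all $\epsilon>0$. A8. For all $\epsilon>0$ there exists $\delta>0$ such that $\int p(y;\theta)\log\{p(y;\theta)/p(y;\theta_0)\}dy<\delta$ implies $\|\theta-\theta_0\|<\epsilon$.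
   Formalization: Besides A1–A8, it is assumed that the MAP estimate converges in probability to θ0 and that, for every ε>0, the integral of ‖θ−θ0‖ against the posterior based on π_PM over ‖θ−θ0‖>ε is o_p(1/n); without these the claim can fail. *)

(* Defs.v *)
From HB Require Import structures.
From mathcomp Require Import all_boot all_order all_algebra.
From mathcomp Require Import all_classical all_reals all_analysis.
Set Implicit Arguments.
Unset Strict Implicit.
Unset Printing Implicit Defensive.
Import Order.TTheory GRing.Theory Num.Theory.
Import numFieldNormedType.Exports.
Local Open Scope classical_set_scope.
Local Open Scope ring_scope.

(** The sigma-algebra generated by the coordinates; for a real [T] it is the
    Borel sigma-algebra of R^n. *)
Definition measure_rV_display : measure_display -> measure_display.
Proof. exact. Qed.

Section measurable_rV.
Context {disp} {T : sigmaRingType disp}.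
Variable n : nat.

Definition rV_coord : 'I_n -> 'rV[T]_n -> T := fun i v => v ord0 i.

Let rV_set0 : g_sigma_preimage rV_coord set0.
Proof. exact: sigma_algebra0. Qed.

Let rV_setC A : g_sigma_preimage rV_coord A -> g_sigma_preimage rV_coord (~` A).
Proof. exact: sigma_algebraC. Qed.

Let rV_bigcup (F : _^nat) : (forall i, g_sigma_preimage rV_coord (F i)) ->
  g_sigma_preimage rV_coord (\bigcup_i (F i)).
Proof. exact: sigma_algebra_bigcup. Qed.

HB.instance Definition _ := @isMeasurable.Build (measure_rV_display disp)
  'rV[T]_n (g_sigma_preimage rV_coord) rV_set0 rV_setC rV_bigcup.

End measurable_rV.

Section measurable_fun_rV.
Context d1 d2 (T1 : measurableType d1) (T2 : measurableType d2).

Lemma measurable_rV_coord n (i : 'I_n) :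
  measurable_fun [set: 'rV[T2]_n] (fun v : 'rV[T2]_n => v ord0 i).
Proof.
move=> _ Y mY; rewrite setTI; apply: sub_sigma_algebra => /=.
rewrite -bigcup_seq/=; exists i => /=; first by rewrite mem_index_enum.
by exists Y => //; rewrite setTI.
Qed.

Lemma measurable_fun_rVP n (f : T1 -> 'rV[T2]_n) :
  measurable_fun [set: T1] f <->
  forall i, measurable_fun [set: T1] (fun x => f x ord0 i).
Proof.
split=> [mf i|mf].
  exact: (measurableT_comp (@measurable_rV_coord n i) mf).
move=> _ A; rewrite setTI; move: A; apply: smallest_sub.
  split => /= [|B mB|F mF].
  - by rewrite preimage_set0.
  - by rewrite setTD preimage_setC; exact: measurableC.
  - by rewrite preimage_bigcup; exact: bigcupT_measurable.
rewrite -bigcup_seq => B [i _ [C mC <-]] /=.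
rewrite setTI -comp_preimage -[X in measurable X]setTI.
exact: mf.
Qed.

End measurable_fun_rV.

Section lebesgue_rV.
Context {R : realType}.

Definition rV_cons n (x : R * 'rV[R]_n) : 'rV[R]_n.+1 := row_mx x.1%:M x.2.

Definition rV_uncons n (v : 'rV[R]_n.+1) : R * 'rV[R]_n :=
  (v ord0 ord0, \row_j v ord0 (lift ord0 j)).

Lemma rV_consE n (x : R * 'rV[R]_n) (i : 'I_n.+1) :
  rV_cons x ord0 i = if unlift ord0 i is Some j then x.2 ord0 j else x.1.
Proof.
rewrite /rV_cons; case: unliftP => [j ->|->].
  have -> : lift ord0 j = rshift 1 j by exact: val_inj.
  exact: row_mxEr.
have -> : ord0 = lshift n (ord0 : 'I_1) :> 'I_n.+1 by exact: val_inj.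
by rewrite [LHS]row_mxEl mxE eqxx mulr1n.
Qed.

Lemma rV_consK n : cancel (@rV_cons n) (@rV_uncons n).
Proof.
move=> x; rewrite [RHS]surjective_pairing /rV_uncons rV_consE unlift_none.
by congr pair; apply/rowP => j; rewrite mxE rV_consE liftK.
Qed.

Lemma measurable_rV_cons n : measurable_fun [set: R * 'rV[R]_n] (@rV_cons n).
Proof.
apply/measurable_fun_rVP => i; under eq_fun do rewrite rV_consE.
case: unlift => [j|]; last exact: measurable_fst.
apply: (@measurableT_comp _ _ _ _ _ _ (fun v : 'rV[R]_n => v ord0 j)) => //.
exact: measurable_rV_coord.
Qed.

Lemma measurable_rV_uncons n : measurable_fun [set: 'rV[R]_n.+1] (@rV_uncons n).
Proof.
apply: measurable_fun_pair; first exact: measurable_rV_coord.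
by apply/measurable_fun_rVP => i; under eq_fun do rewrite mxE;
  exact: measurable_rV_coord.
Qed.

Section lebesgue_rV_cons.
Variables (n : nat) (m : {sigma_finite_measure set 'rV[R]_n -> \bar R}).

Definition lebesgue_rV_cons : set 'rV[R]_n.+1 -> \bar R :=
  pushforward (@lebesgue_measure R \x m)%E (@rV_cons n).

Let lebesgue_rV_cons0 : lebesgue_rV_cons set0 = 0%E.
Proof. by rewrite /lebesgue_rV_cons /pushforward preimage_set0 measure0. Qed.

Let lebesgue_rV_cons_ge0 A : (0 <= lebesgue_rV_cons A)%E.
Proof. by rewrite /lebesgue_rV_cons /pushforward measure_ge0. Qed.

Let lebesgue_rV_cons_sigma_additive : semi_sigma_additive lebesgue_rV_cons.
Proof.
move=> F mF tF mUF; rewrite /lebesgue_rV_cons /pushforward preimage_bigcup.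
have mcons A : measurable A -> measurable (@rV_cons n @^-1` A).
  by move=> mA; rewrite -[X in measurable X]setTI; exact: measurable_rV_cons.
apply: measure_semi_sigma_additive => [k||].
- exact: mcons.
- apply/trivIsetP => i j _ _ ij.
  move/trivIsetP : tF => /(_ i j I I ij) Fij.
  by rewrite -preimage_setI Fij preimage_set0.
- by rewrite -preimage_bigcup; exact: mcons.
Qed.

HB.instance Definition _ := isMeasure.Build _ _ _ lebesgue_rV_cons
  lebesgue_rV_cons0 lebesgue_rV_cons_ge0 lebesgue_rV_cons_sigma_additive.

Let lebesgue_rV_cons_sigma_finite : sigma_finite setT lebesgue_rV_cons.
Proof.
have /sigma_finiteP[F [TF ndF Foo]] := sigma_finiteT (@lebesgue_measure R).
have /sigma_finiteP[G [TG ndG Goo]] := sigma_finiteT m.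
exists (fun k => @rV_uncons n @^-1` (F k `*` G k)).
  apply/seteqP; split => // v _.
  have [i _ Fi] : (\bigcup_k F k) (rV_uncons v).1 by rewrite -TF.
  have [j _ Gj] : (\bigcup_k G k) (rV_uncons v).2 by rewrite -TG.
  exists (maxn i j) => //; split => /=.
  - by move: Fi; exact/subsetPset/ndF/leq_maxl.
  - by move: Gj; exact/subsetPset/ndG/leq_maxr.
move=> k; have [mF Fk] := Foo k; have [mG Gk] := Goo k; split.
  rewrite -[X in measurable X]setTI; apply: measurable_rV_uncons => //.
  exact: measurableX.
rewrite /lebesgue_rV_cons /pushforward -comp_preimage.
rewrite (_ : _ \o _ = id); last by apply/funext => x; exact: rV_consK.
by rewrite preimage_id product_measure1E// lte_mul_pinfty// ge0_fin_numE.
Qed.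

HB.instance Definition _ := Measure_isSigmaFinite.Build _ _ _ lebesgue_rV_cons
  lebesgue_rV_cons_sigma_finite.

End lebesgue_rV_cons.

Fixpoint lebesgue_rV n : {sigma_finite_measure set 'rV[R]_n -> \bar R} :=
  match n with
  | 0 => @dirac _ 'rV[R]_0 0 R
  | n'.+1 => lebesgue_rV_cons (lebesgue_rV n')
  end.

Lemma lebesgue_rV_box n (A : 'I_n -> set R) : (forall i, measurable (A i)) ->
  lebesgue_rV n [set v | forall i, A i (v ord0 i)] =
  (\prod_(i < n) lebesgue_measure (A i))%E.
Proof.
elim: n A => [|n IH] A mA.
  rewrite big_ord0 /= diracE (_ : _ \in _ = true)//.
  by apply/mem_set => -[].
have mB : measurable [set v : 'rV[R]_n | forall i, A (lift ord0 i) (v ord0 i)].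
  rewrite (_ : mkset _ = \big[setI/setT]_(i < n)
      ((fun v : 'rV[R]_n => v ord0 i) @^-1` A (lift ord0 i))).
    apply: bigsetI_measurable => i _; rewrite -[X in measurable X]setTI.
    exact: measurable_rV_coord.
  by rewrite -bigcap_seq; apply/seteqP; split => v /= h i;
    [move=> _; exact: h|apply: h; rewrite /= mem_index_enum].
rewrite big_ord_recl -IH => [|i]; last exact: mA.
rewrite [LHS]/= /lebesgue_rV_cons /pushforward -product_measure1E//; last exact: mA.
congr (product_measure1 _ _ _); apply/seteqP; split => -[x v] /= h.
  split => [|i]; first by have := h ord0; rewrite rV_consE unlift_none.
  by have := h (lift ord0 i); rewrite rV_consE liftK.
by move=> i; rewrite rV_consE; case: unliftP => [j|] ->; case: h.
Qed.

End lebesgue_rV.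

Section derivatives.
Context {R : realType} {d : nat}.
Implicit Types (f : 'rV[R]_d -> R) (theta : 'rV[R]_d).

Definition partial (a : 'I_d) f : 'rV[R]_d -> R :=
  fun theta => 'D_(delta_mx ord0 a) f theta.

(** [partials [:: a; b] f] is the function d_a (d_b f). *)
Definition partials (s : seq 'I_d) f : 'rV[R]_d -> R := foldr partial f s.

(** Since the gradient map is differentiable iff all its components are, this
    is k-fold (Frechet) differentiability at [theta] as soon as it holds in a
    neighbourhood. *)
Definition times_differentiable (k : nat) f theta : Prop :=
  forall s : seq 'I_d, (size s < k)%N -> differentiable (partials s f) theta.

Definition maximizes (D : set 'rV[R]_d) f theta : Prop :=
  D theta /\ forall theta', D theta' -> f theta' <= f theta.

Definition positive_definite (M : 'M[R]_d) : Prop :=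
  forall v : 'rV[R]_d, v != 0 -> 0 < (v *m M *m v^T) ord0 ord0.

End derivatives.

(** Probabilities are outer probabilities ([mu_ext P] is the outer measure
    generated by [P]): they agree with [P] on measurable events, and make sense
    for estimators and derivatives whose measurability is not assumed. *)
Section stochastic_orders.
Context {R : realType} {dO : measure_display} {Omega : measurableType dO}.
Variable P : probability Omega R.

Definition prob_vanishes (E : nat -> set Omega) : Prop :=
  (fun n => mu_ext P (E n)) @ \oo --> 0%E.

Definition prob_small_o_n2 (E : nat -> set Omega) : Prop :=
  (fun n => (n%:R ^+ 2)%:E * mu_ext P (E n))%E @ \oo --> 0%E.

(** X_n = o_p(r_n) *)
Definition small_op (X : nat -> Omega -> R) (r : nat -> R) : Prop :=
  forall eps : R, 0 < eps ->
    prob_vanishes (fun n => [set w | eps * r n < `|X n w|]).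

End stochastic_orders.

Section model.
Context {R : realType} {d : nat} {dY : measure_display} {Y : measurableType dY}.
Variable mu : {sigma_finite_measure set Y -> \bar R}.
Variable p : Y -> 'rV[R]_d -> R.
Implicit Types (Theta : set 'rV[R]_d) (theta : 'rV[R]_d) (y : Y).

Definition density_family Theta : Prop :=
  forall theta, Theta theta ->
    [/\ measurable_fun [set: Y] (p ^~ theta),
        (forall y, 0 <= p y theta) &
        (\int[mu]_y (p y theta)%:E = 1)%E].

Definition logp y : 'rV[R]_d -> R := fun theta => ln (p y theta).

Definition expect theta (h : Y -> R) : R := \int[mu]_y (p y theta * h y).

Definition fisher theta : 'M[R]_d :=
  \matrix_(a, b) expect theta
    (fun y => partial a (logp y) theta * partial b (logp y) theta).

(** Gamma^(e)_{abc} *)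
Definition econnection theta (a b c : 'I_d) : R :=
  expect theta (fun y => partials [:: a; b] (logp y) theta
                         * partial c (logp y) theta).

Definition jeffreys theta : R := Num.sqrt (\det (fisher theta)).

(** d_a log pi_J + (1/2) g^{cd} Gamma^(e)_{cda} *)
Definition matching_field (a : 'I_d) theta : R :=
  partial a (fun t => ln (jeffreys t)) theta
  + 2^-1 * \sum_(c < d) \sum_(e < d)
             invmx (fisher theta) c e * econnection theta c e a.

Variable theta0 : 'rV[R]_d.

(** The existence of [log p] requires [p > 0]; [ln] is total in the library. *)
Definition log_density_differentiable : Prop :=
  \forall theta \near theta0, forall y,
    0 < p y theta /\ times_differentiable 5 (logp y) theta.

(** The product of the derivatives d_I log p, for I in [s]: its expectation is
    a (mixed) moment of the derivatives of log p. *)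
Definition score_monomial (s : seq (seq 'I_d)) theta y : R :=
  \prod_(I <- s) partials I (logp y) theta.

Definition moments_of_derivatives : Prop :=
  forall s : seq (seq 'I_d), all (fun I => 0 < size I <= 4)%N s ->
    \forall theta \near theta0,
      mu.-integrable [set: Y]
        (EFin \o (fun y => p y theta * score_monomial s theta y)) /\
      differentiable (fun t => expect t (score_monomial s t)) theta.

Definition sup_square_derivative (U : set 'rV[R]_d) (I : seq 'I_d) y : \bar R :=
  ereal_sup [set ((partials I (logp y) theta) ^+ 2)%:E | theta in U].

Definition moments_of_fifth_derivatives : Prop :=
  exists2 U : set 'rV[R]_d, nbhs theta0 U &
    forall (I : seq 'I_d) (k : nat), size I = 5 ->
      \forall theta \near theta0,
        mu.-integrable [set: Y]
          (fun y => (p y theta)%:E * sup_square_derivative U I y ^+ k)%E /\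
        differentiable (fun t => fine
          (\int[mu]_y ((p y t)%:E * sup_square_derivative U I y ^+ k))%E) theta.

Definition bartlett_identities : Prop :=
  forall s : seq 'I_d, (0 < size s <= 4)%N ->
    expect theta0 (fun y => partials s (p y) theta0 / p y theta0) = 0.

Definition kullback_leibler theta : \bar R :=
  (\int[mu]_y (p y theta * ln (p y theta / p y theta0))%:E)%E.

Definition kl_identifiable Theta : Prop :=
  forall eps : R, 0 < eps -> exists2 delta : R, 0 < delta &
    forall theta, Theta theta -> (kullback_leibler theta < delta%:E)%E ->
      `|theta - theta0| < eps.

Definition likelihood n (s : n.-tuple Y) theta : R :=
  \prod_(t < n) p (tnth s t) theta.

Variable Theta : set 'rV[R]_d.
Implicit Type pi : 'rV[R]_d -> R.

Definition prior_density pi : Prop :=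
  measurable_fun Theta pi /\ forall theta, Theta theta -> 0 <= pi theta.

Definition prior_differentiable pi : Prop :=
  \forall theta \near theta0, 0 < pi theta /\ times_differentiable 2 pi theta.

Definition evidence pi n (s : n.-tuple Y) : R :=
  \int[lebesgue_rV d]_(theta in Theta) (likelihood s theta * pi theta).

Definition proper_posterior pi n (s : n.-tuple Y) : Prop :=
  (lebesgue_rV d).-integrable Theta
    (EFin \o (fun theta => likelihood s theta * pi theta)) /\
  0 < evidence pi s.

Definition posterior pi n (s : n.-tuple Y) theta : R :=
  likelihood s theta * pi theta / evidence pi s.

Definition has_posterior_mean pi n (s : n.-tuple Y) : Prop :=
  proper_posterior pi s /\
  forall a : 'I_d, (lebesgue_rV d).-integrable Theta
    (EFin \o (fun theta => theta ord0 a * (likelihood s theta * pi theta))).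

Definition posterior_mean pi n (s : n.-tuple Y) : 'rV[R]_d :=
  \row_a (\int[lebesgue_rV d]_(theta in Theta)
            (theta ord0 a * (likelihood s theta * pi theta)) / evidence pi s).

(** The norm of the library on ['rV[R]_d] is the sup norm; this set, like
    [consistent] and [kl_identifiable], is only used for all [eps > 0], so that
    any equivalent norm gives the same conditions. *)
Definition outside (eps : R) : set 'rV[R]_d :=
  Theta `&` [set theta | eps < `|theta - theta0|].

Context {dO : measure_display} {Omega : measurableType dO}.
Variables (P : probability Omega R) (y : nat -> {RV P >-> Y}).

(** The observations y(1), ..., y(n) are [y 0], ..., [y n.-1]. *)
Definition sample n (w : Omega) : n.-tuple Y := [tuple y i w | i < n].

Definition iid_sample : Prop :=
  (forall t (A : set Y), measurable A ->
     P (y t @^-1` A) = (\int[mu]_(z in A) (p z theta0)%:E)%E) /\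
  (forall n (A : 'I_n -> set Y), (forall i, measurable (A i)) ->
     P [set w | forall i, A i (y i w)] = (\prod_(i < n) P (y i @^-1` A i))%E).

Definition eventually_almost_surely (Q : forall n, n.-tuple Y -> Prop) : Prop :=
  \forall n \near \oo, {ae P, forall w, Q n (sample n w)}.

Definition sample_information n : 'M[R]_d :=
  \matrix_(a, b) \int[P]_w
    (partial a (fun t => ln (likelihood (sample n w) t)) theta0
     * partial b (fun t => ln (likelihood (sample n w) t)) theta0).

Definition consistent (est : forall n, n.-tuple Y -> 'rV[R]_d) : Prop :=
  forall eps : R, 0 < eps ->
    prob_vanishes P (fun n => [set w | eps < `|est n (sample n w) - theta0|]).

Definition consistent_o_n2 (est : forall n, n.-tuple Y -> 'rV[R]_d) : Prop :=
  forall eps : R, 0 < eps ->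
    prob_small_o_n2 P (fun n => [set w | eps < `|est n (sample n w) - theta0|]).

(** The random variable t_n of the condition "integral = t_n / n^2" is n^2 times
    the integral, which may a priori be infinite. *)
Definition posterior_tail_condition pi : Prop :=
  eventually_almost_surely (@proper_posterior pi) /\
  forall eps delta : R, 0 < eps -> 0 < delta ->
    prob_small_o_n2 P (fun n => [set w | (delta%:E < (n%:R ^+ 2)%:E *
      \int[lebesgue_rV d]_(theta in outside eps)
        (ereal_sup (range (fun z => (p z theta)%:E))
         * (posterior pi (sample n w) theta)%:E))%E]).

(** The integrand of [posterior_tail_condition] has no factor [|theta|] and its
    weight sup_y p(y; theta) may tend to 0 at infinity, so that it does not bound
    the contribution of remote parameters to the posterior mean. *)
Definition posterior_mean_tail_condition pi : Prop :=
  forall eps : R, 0 < eps ->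
    small_op P (fun n w =>
      \int[lebesgue_rV d]_(theta in outside eps)
        (`|theta - theta0| * posterior pi (sample n w) theta))
      (fun n => n%:R^-1).

End model.

(* Main.v *)
Require Import Defs.
From HB Require Import structures.
From mathcomp Require Import all_boot all_order all_algebra.
From mathcomp Require Import all_classical all_reals all_analysis.
From mathcomp Require Import measurable_realfun ring lra.
Set Implicit Arguments.
Unset Strict Implicit.
Unset Printing Implicit Defensive.
Import Order.TTheory GRing.Theory Num.Theory.
Import numFieldNormedType.Exports.
Local Open Scope classical_set_scope.
Local Open Scope ring_scope.

(** Write l for the log-likelihood of n observations, g for the Fisher information at
    theta0, G for its inverse, L_{abc} for the expectation of d_a d_b d_c log p at theta0,
    and x for the maximum likelihood estimate. Both estimators are compared with x, on
    samples for which, near theta0, the second and third derivatives of l are close to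
    - n g and n L.

    The posterior mean is computed without Gaussian integrals. If phi is a cut-off around
    theta0 and q = exp(l) pi_PM, then the integral of d_a (phi h q) is zero. Up to a term
    carried by the tail of the posterior, this is Stein's identity
      E[d_a h + h d_a (l + log pi_PM)] = 0
    for posterior expectations ([stein_local]). Taking for h the coordinates of t - x and
    linearizing d_a l at x, where it vanishes, shows that n times the matrix of second
    moments of t - x is close to G. Taking h = 1 and expanding d_a l to second order gives
    the mean m of t - x:
      n g_{ab} m_b = d_a log pi_PM + (1/2) L_{abc} G_{bc} + o(1).
    The critical point equation of the MAP estimate z gives in the same way
      n g_{ab} (z - x)_b = d_a log pi_MAP + o(1),
    because the cubic term is now of order n |z - x|^2. Hence n (m - (z - x)) tends to
    zero as soon as
      d_a log (pi_PM / pi_MAP) + (1/2) L_{abc} G_{bc} = o(1)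
    at x. The lemma [posterior_mean_map_bound] makes this quantitative for a fixed sample.

    This condition is the hypothesis of the theorem. Differentiating total mass 1 and then
    the expected score under the integral sign gives g_{bc} = - E[d_b d_c log p] and
    d_a g_{bc} = - Gamma_{bca} - L_{abc} near theta0. By Jacobi's formula
    d_a log pi_J = (1/2) g^{bc} d_a g_{bc}, and therefore
    d_a log pi_J + (1/2) g^{bc} Gamma_{bca} = - (1/2) g^{bc} L_{abc}
    ([matching_fieldE]), a continuous function of the parameter ([matching_field_cvg]).

    It remains to see that samples are good with probability tending to 1. At theta0 the
    derivatives of l are controlled by the weak law of large numbers; around theta0, by
    the sample mean of an envelope built from the derivatives of orders three and four at
    theta0 and from the suprema of the squared fifth derivatives
    ([log_likelihood_derivatives]). Consistency of
    both point estimates, the matching hypothesis at x and the tail condition on the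
    posterior mean are also properties of vanishing exceptional probability. *)

(** * Lebesgue measure on row vectors and integration by parts *)

Section lebesgue_rV_calculus.
Context {R : realType}.

Lemma rV_coord_le_norm d (v : 'rV[R]_d) i : `|v ord0 i| <= `|v|.
Proof.
rewrite [leRHS]mx_normrE.
exact: (le_bigmax_cond _ (fun ij : 'I_1 * 'I_d => `|v ij.1 ij.2|) (j := (ord0, i))).
Qed.

Lemma rV_norm_le d (v : 'rV[R]_d) (c : R) : 0 <= c ->
  (forall i, `|v ord0 i| <= c) -> `|v| <= c.
Proof.
move=> c0 h; rewrite [`|v|]mx_normrE; apply: bigmax_le => // -[i j] _ /=.
by rewrite (ord1 i).
Qed.

(** An open set is the union of the boxes with rational centre and radius 1/(k+1)
    that it contains; there are countably many of them. *)
Lemma open_measurable_rV d (A : set 'rV[R]_d) : open A -> measurable A.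
Proof.
move=> oA.
pose B (i : 'rV[rat]_d * nat) := [set v : 'rV[R]_d |
  forall j, (`](ratr (i.1 ord0 j) - i.2.+1%:R^-1 : R),
               (ratr (i.1 ord0 j) + i.2.+1%:R^-1)[%classic) (v ord0 j)].
have mB i : measurable (B i).
  rewrite (_ : B i = \big[setI/setT]_(j < d)
      ((fun v : 'rV[R]_d => v ord0 j) @^-1`
       `](ratr (i.1 ord0 j) - i.2.+1%:R^-1 : R),
         (ratr (i.1 ord0 j) + i.2.+1%:R^-1)[%classic)).
    apply: bigsetI_measurable => j _; rewrite -[X in measurable X]setTI.
    exact: measurable_rV_coord.
  rewrite -bigcap_seq; apply/seteqP; split => v h j; first by move=> _; exact: h.
  by apply: h; rewrite /= mem_index_enum.
rewrite (_ : A = \bigcup_i (if `[< B i `<=` A >] then B i else set0)).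
  apply: countable_bigcupT_measurable => [|i]; first exact: countableP.
  by case: ifP.
apply/seteqP; split => [v Av|v [i _]]; last by case: asboolP => // h /h.
have /nbhs_ballP[e /= e0 eA] : nbhs v A by exact: open_nbhs_nbhs.
pose k := Num.truncn (2 / e).
have ke : k.+1%:R^-1 < e / 2.
  rewrite invf_plt ?posrE ?divr_gt0// invf_div.
  exact: truncnS_gt.
have k0 : 0 < k.+1%:R^-1 :> R by rewrite invr_gt0.
have /(_ _)/cid-/all_sig[q hq] : forall j, exists q : rat,
    ratr q \in `](v ord0 j - k.+1%:R^-1), (v ord0 j + k.+1%:R^-1)[.
  move=> j; have [|q] := @rat_in_itvoo R (v ord0 j - k.+1%:R^-1) (v ord0 j + k.+1%:R^-1).
    by rewrite ltrD2l gtrN.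
  by exists q.
move: k0 ke hq; set k' := k.+1%:R^-1 => k0 ke hq; exists ((\row_j q j), k) => //; rewrite asboolT.
  move=> j /=; rewrite !mxE in_itv/=; have := hq j; rewrite in_itv/=.
  rewrite -/k' => /andP[? ?]; apply/andP; split; lra.
move=> u /= hu; apply: eA; rewrite -ball_normE /=.
apply: (@le_lt_trans _ _ (2 * k')); last by lra.
apply: rV_norm_le; first lra.
move=> j; rewrite !mxE; have := hu j; have := hq j.
rewrite !mxE in_itv/= ler_norml -/k' [in X in _ -> X]in_itv/=.
move=> /andP[? ?] /andP[? ?]; apply/andP; split; lra.
Qed.

Lemma continuous_measurable_rV d (f : 'rV[R]_d -> R) :
  continuous f -> measurable_fun setT f.
Proof.
move=> cf; apply: (measurability _ (RGenOInfty.measurableE R)).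
move=> _ [_ [a ->] <-]; rewrite setTI.
apply: open_measurable_rV; apply: (@open_comp _ R f); last exact: rray_open.
by move=> x _; exact: cf.
Qed.

Lemma lebesgue_rV_ball_lty d (K : R) : 0 <= K ->
  measurable [set v : 'rV[R]_d | `|v| <= K] /\
  (lebesgue_rV d [set v : 'rV[R]_d | (`|v| <= K)%R] < +oo)%E.
Proof.
move=> K0; have mK : measurable [set v : 'rV[R]_d | `|v| <= K].
  have oK : open ((fun v : 'rV[R]_d => `|v|) @^-1` `]K, +oo[%classic).
    apply: (@open_comp _ R); last exact: rray_open.
    by move=> x _; exact: norm_continuous.
  rewrite (_ : mkset _ = ~` ((fun v : 'rV[R]_d => `|v|) @^-1` `]K, +oo[%classic)).
    by apply: measurableC; apply: open_measurable_rV; exact: oK.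
  by apply/seteqP; split => v /=; rewrite in_itv/= andbT leNgt => /negP.
split => //.
have E : [set v : 'rV[R]_d | `|v| <= K] =
    [set v | forall i, (fun _ : 'I_d => `[-K, K]%classic) i (v ord0 i)].
  apply/seteqP; split => v /= h.
    move=> i; rewrite in_itv/= -ler_norml.
    exact: le_trans (rV_coord_le_norm _ _) h.
  by apply: rV_norm_le => // i; have := h i; rewrite in_itv/= -ler_norml.
have := @lebesgue_rV_box R d (fun=> `[-K, K]%classic).
rewrite -E => -> //.
rewrite ltey_eq prode_fin_num// => i _.
by rewrite lebesgue_measure_itv/=; case: ifP.
Qed.

Lemma bounded_compact_support_rV d (f : 'rV[R]_d -> R) (K : R) :
  continuous f -> (forall v, K < `|v| -> f v = 0) ->
  exists2 C : R, 0 <= C & forall v, `|f v| <= C.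
Proof.
move=> cf f0; pose B := [set v : 'rV[R]_d | `|v| <= K].
have : bounded_set (f @` B).
  apply: compact_bounded; apply: continuous_compact.
    exact: continuous_subspaceT.
  apply: bounded_closed_compact.
    exists K; split; first exact: num_real.
    by move=> x Kx v /= Bv; apply/ltW/(le_lt_trans _ Kx).
  have -> : B = (fun v => `|v|) @^-1` `]-oo, K]%classic.
    by apply/seteqP; split => v; rewrite /B /= in_itv.
  apply: (@closed_comp _ R); last exact: lray_closed.
  by move=> x _; exact: norm_continuous.
move=> [M [Mr hM]]; exists (`|M| + 1) => [|v]; first exact: addr_ge0.
have [vK|/f0 ->] := leP `|v| K; last by rewrite normr0 addr_ge0.
apply: hM; last by exists v.
by rewrite (le_lt_trans (real_ler_norm Mr))// ltrDl.
Qed.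

Lemma integrable_compact_support_rV d (f : 'rV[R]_d -> R) (K : R) : 0 <= K ->
  continuous f -> (forall v, K < `|v| -> f v = 0) ->
  (lebesgue_rV d).-integrable setT (EFin \o f).
Proof.
move=> K0 cf f0; have [mK Kfin] := lebesgue_rV_ball_lty d K0.
set B := [set v | _] in mK Kfin.
have iB : (lebesgue_rV d).-integrable B (EFin \o f).
  apply: measurable_bounded_integrable => //.
    by apply: measurable_funTS; exact: continuous_measurable_rV.
  have [C _ fC] := bounded_compact_support_rV cf f0.
  by exists C; split => [|x Cx v _]; [exact: num_real|exact/(le_trans (fC v))/ltW].
rewrite (_ : EFin \o f = (EFin \o f) \_ B).
  have /iffLR := @integrable_mkcond _ _ _ (lebesgue_rV d) B (EFin \o f) mK.
  exact.
apply/funext => v; rewrite patchE; case: ifPn => // /negP vB /=.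
congr EFin; apply: f0; rewrite ltNge; apply/negP => h; apply: vB.
exact/mem_set.
Qed.

Lemma cvg_rV (T : Type) (F : set_system T) {FF : Filter F} d (f : T -> 'rV[R]_d) (v : 'rV[R]_d) :
  (forall i, (fun t => f t ord0 i) @ F --> v ord0 i) -> f @ F --> v.
Proof.
move=> h; apply/cvgrPdist_lt => e e0.
near do (rewrite (@le_lt_trans _ _ (e / 2)) ?ltr_pdivrMr ?ltr_pMr ?ltr1n//).
near=> t; apply: rV_norm_le => [|i]; first by rewrite divr_ge0// ltW.
rewrite !mxE; move: i; near: t.
apply: filter_forall => i; have /cvgrPdist_le := h i.
by apply; rewrite divr_gt0.
Unshelve. all: by end_near. Qed.

Lemma continuous_rV_cons d (x : R * 'rV[R]_d) :
  {for x, continuous (fun x : R * 'rV[R]_d => rV_cons x)}.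
Proof.
apply: cvg_rV => i.
pose G (z : R * 'rV[R]_d) := if unlift ord0 i is Some j then z.2 ord0 j else z.1.
suff : G @ x --> G x.
  have GE : G = (fun z => rV_cons z ord0 i).
    by apply/funext => z; rewrite [RHS]rV_consE.
  by rewrite GE; exact.
rewrite /G; case: unlift => [j|]; last exact: cvg_fst.
apply: (@cvg_comp _ _ _ snd (fun v : 'rV[R]_d => v ord0 j)); first exact: cvg_snd.
exact: coord_continuous.
Qed.

Lemma rV_cons_shiftl d (x h : R) (v : 'rV[R]_d) :
  rV_cons (h + x, v) = h *: delta_mx ord0 ord0 + rV_cons (x, v).
Proof.
apply/rowP => i; rewrite [LHS]rV_consE [RHS]mxE [X in _ = _ + X]rV_consE 2!mxE.
by case: unliftP => [j ->|->] /=; rewrite ?mulr0 ?add0r ?mulr1.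
Qed.

Lemma rV_cons_shiftr d (x h : R) (v : 'rV[R]_d) (j : 'I_d) :
  rV_cons (x, h *: delta_mx ord0 j + v)
  = h *: delta_mx ord0 (lift ord0 j) + rV_cons (x, v).
Proof.
apply/rowP => i; rewrite [LHS]rV_consE [RHS]mxE [X in _ = _ + X]rV_consE 2!mxE.
case: unliftP => [k ->|->] /=; last by rewrite mulr0 add0r.
by rewrite !mxE/= (inj_eq lift_inj).
Qed.

Lemma rV_cons_norml d (x : R) (v : 'rV[R]_d) : `|x| <= `|rV_cons (x, v)|.
Proof.
by have := rV_coord_le_norm (rV_cons (x, v)) ord0; rewrite rV_consE unlift_none.
Qed.

Lemma rV_cons_normr d (x : R) (v : 'rV[R]_d) : `|v| <= `|rV_cons (x, v)|.
Proof.
apply: rV_norm_le => // j.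
by have := rV_coord_le_norm (rV_cons (x, v)) (lift ord0 j); rewrite rV_consE liftK.
Qed.

(** The measure in dimension d+1 is an image of a product measure, so this is the
    change of variables that makes Fubini's theorem available for an induction on
    the dimension. *)
Lemma integral_lebesgue_rVS d (f : 'rV[R]_d.+1 -> R) :
  (lebesgue_rV d.+1).-integrable setT (EFin \o f) ->
  (\int[lebesgue_rV d.+1]_v (f v)%:E =
   \int[(@lebesgue_measure R) \x (lebesgue_rV d)]_z (f (rV_cons z))%:E)%E /\
  ((@lebesgue_measure R) \x (lebesgue_rV d))%E.-integrable setT
     (EFin \o (fun z => f (rV_cons z))).
Proof.
move=> intf.
have [mf _] := integrableP _ _ _ intf.
have mc := @measurable_rV_cons R d.
have ic : ((@lebesgue_measure R) \x (lebesgue_rV d))%E.-integrable setT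
     (EFin \o (fun z => f (rV_cons z))).
  apply/integrableP; split; first exact: (measurableT_comp mf mc).
  have /integrableP[_] := intf.
  rewrite ge0_integral_pushforward//; last first.
    by apply: measurableT_comp.
split => //.
have mc' : @measurable_fun _ _
    (g_sigma_algebraType (R.-ocitv.-measurable) * 'rV[R]_d)%type 'rV[R]_d.+1
    setT (@rV_cons R d) := mc.
have := @integral_pushforward _ _ _ _ R _ mc'
   ((@lebesgue_measure R) \x (lebesgue_rV d))%E setT (EFin \o f) mf ic measurableT.
exact.
Qed.

Let quotient_consl d (f : 'rV[R]_d.+1 -> R) x v :
  (fun h : R => h^-1 *: (((fun x : R => f (rV_cons (x, v))) \o shift x) (h *: 1) -
     f (rV_cons (x, v)))) =
  (fun h : R => h^-1 *: ((f \o shift (rV_cons (x, v))) (h *: delta_mx ord0 ord0) -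
    f (rV_cons (x, v)))).
Proof.
by apply/funext => h /=; rewrite -rV_cons_shiftl /GRing.scale/= mulr1.
Qed.

Let quotient_consr d (f : 'rV[R]_d.+1 -> R) x v j :
  (fun h : R => h^-1 *: (((fun v => f (rV_cons (x, v))) \o shift v)
     (h *: delta_mx ord0 j) - f (rV_cons (x, v)))) =
  (fun h : R => h^-1 *: ((f \o shift (rV_cons (x, v)))
      (h *: delta_mx ord0 (lift ord0 j)) - f (rV_cons (x, v)))).
Proof. by apply/funext => h /=; rewrite -rV_cons_shiftr. Qed.

Lemma partial_rV_consl d (f : 'rV[R]_d.+1 -> R) x v :
  partial ord0 f (rV_cons (x, v)) = 'D_1 (fun x => f (rV_cons (x, v))) x.
Proof. by rewrite /partial /derive quotient_consl. Qed.

Lemma derivable_rV_consl d (f : 'rV[R]_d.+1 -> R) x v :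
  derivable f (rV_cons (x, v)) (delta_mx ord0 ord0) ->
  derivable (fun x => f (rV_cons (x, v))) x 1.
Proof. by rewrite /derivable quotient_consl. Qed.

Lemma partial_rV_consr d (f : 'rV[R]_d.+1 -> R) x v j :
  partial (lift ord0 j) f (rV_cons (x, v)) = partial j (fun v => f (rV_cons (x, v))) v.
Proof. by rewrite /partial /derive quotient_consr. Qed.

Lemma derivable_rV_consr d (f : 'rV[R]_d.+1 -> R) x v j :
  derivable f (rV_cons (x, v)) (delta_mx ord0 (lift ord0 j)) ->
  derivable (fun v => f (rV_cons (x, v))) v (delta_mx ord0 j).
Proof. by rewrite /derivable quotient_consr. Qed.

Lemma partial_eq0_out d (a : 'I_d) (f : 'rV[R]_d -> R) (K : R) v :
  (forall v, K < `|v| -> f v = 0) -> K < `|v| -> partial a f v = 0.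
Proof.
move=> f0 Kv.
rewrite /partial (_ : 'D__ f v = 'D_(delta_mx ord0 a) (cst 0) v).
  exact: derive_cst.
apply: near_eq_derive => //.
have : \forall u \near v, K < `|u|.
  have := @norm_continuous _ _ v => /cvgr_gt; exact.
by apply: filterS => u Ku; exact: f0.
Qed.

(** Fundamental theorem of calculus on an interval whose endpoints lie outside the
    support. *)
Lemma integral_derive_compact_support (f : R -> R) (K : R) :
  (forall x, derivable f x 1) -> continuous (fun x => 'D_1 f x) ->
  (forall x, K < `|x| -> f x = 0) ->
  (\int[lebesgue_measure]_x ('D_1 f x)%:E = 0)%E.
Proof.
move=> df cf f0.
pose M : R := Num.max K 0 + 1.
have M0 : 0 < M by rewrite /M ltr_wpDl// le_max lexx orbT.
have KM : K < M by rewrite /M ltr_pwDr// le_max lexx.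
have out x : M <= `|x| -> 'D_1 f x = 0.
  move=> Mx; rewrite -[RHS](derive_cst (0:R) x 1); apply: near_eq_derive => //.
  have : \forall u \near x, K < `|u|.
    have := @norm_continuous _ _ x => /cvgr_gt; apply.
    exact: lt_le_trans Mx.
  by apply: filterS => u Ku; exact: f0.
pose D : set R := `[- M, M]%classic.
transitivity (\int[lebesgue_measure]_(x in D) ('D_1 f x)%:E)%E.
  rewrite [RHS]integral_mkcond; apply: eq_integral => x _.
  rewrite patchE; case: ifPn => // /negP xM; rewrite out//.
  rewrite leNgt; apply/negP => Mx; apply: xM; apply/mem_set.
  by rewrite /D /= in_itv/= -ler_norml ltW.
have cdf : continuous f.
  by move=> x; apply: differentiable_continuous; exact/derivable1_diffP.
rewrite (@continuous_FTC2 _ (fun x => 'D_1 f x) f).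
- by rewrite !f0 ?normrN ?gtr0_norm// -EFinB subrr.
- by lra.
- exact: continuous_subspaceT.
- split => [x _|  |]; first exact: df.
    by apply: cvg_at_right_filter; exact: cdf.
  by apply: cvg_at_left_filter; exact: cdf.
- by move=> x _; rewrite derive1E.
Qed.

Lemma continuous_slicer d (g : 'rV[R]_d.+1 -> R) (x : R) :
  continuous g -> continuous (fun v : 'rV[R]_d => g (rV_cons (x, v))).
Proof.
move=> cg v; apply: (@cvg_comp _ _ _ (fun v => rV_cons (x, v)) g _
  (nbhs (rV_cons (x, v)))); last exact: cg.
apply: (@cvg_comp _ _ _ (pair x) (@rV_cons R d) _ (nbhs (x, v))).
  by apply: (@cvg_pair _ _ _ (nbhs v) (nbhs x) (nbhs v) _ _ _ (fun=> x) id);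
    [exact: cvg_cst | exact: cvg_id].
exact: continuous_rV_cons.
Qed.

Lemma continuous_slicel d (g : 'rV[R]_d.+1 -> R) (v : 'rV[R]_d) :
  continuous g -> continuous (fun x : R => g (rV_cons (x, v))).
Proof.
move=> cg x; apply: (@cvg_comp _ _ _ (fun x => rV_cons (x, v)) g _
  (nbhs (rV_cons (x, v)))); last exact: cg.
apply: (@cvg_comp _ _ _ (pair^~ v) (@rV_cons R d) _ (nbhs (x, v))).
  by apply: (@cvg_pair _ _ _ (nbhs x) (nbhs x) (nbhs v) _ _ _ id (fun=> v));
    [exact: cvg_id | exact: cvg_cst].
exact: continuous_rV_cons.
Qed.

(** The divergence theorem without boundary term, on which all posterior moments
    below rest. For the first coordinate, integrate it first and use the
    one-dimensional case; for the other coordinates, apply the induction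
    hypothesis to the slices. *)
Lemma integral_partial_compact_support d (a : 'I_d) (f : 'rV[R]_d -> R) (K : R) :
  (forall v, derivable f v (delta_mx ord0 a)) -> continuous (partial a f) ->
  (forall v, K < `|v| -> f v = 0) ->
  (\int[lebesgue_rV d]_v (partial a f v)%:E = 0)%E.
Proof.
elim: d a f => [[]//|d IH] a f df cf f0.
have K0 : 0 <= Num.max K 0 by rewrite le_max lexx orbT.
have df0 v : Num.max K 0 < `|v| -> partial a f v = 0.
  move=> Kv; apply: partial_eq0_out f0 _; apply: le_lt_trans Kv.
  by rewrite le_max lexx.
have idf := integrable_compact_support_rV K0 cf df0.
have [-> idf2] := integral_lebesgue_rVS idf.
case: (unliftP ord0 a) => [j aj|aj]; rewrite aj in df cf idf2 *.
  rewrite -integral12_prod_meas1//=.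
  apply: integral0_eq => x _; rewrite /fubini_F.
  under eq_integral do rewrite /= partial_rV_consr.
  apply: IH.
  - by move=> v; exact: derivable_rV_consr.
  - have -> : partial j (fun v => f (rV_cons (x : R, v))) =
      fun v => partial (lift ord0 j) f (rV_cons (x : R, v)).
      by apply/funext => v; rewrite partial_rV_consr.
    exact: continuous_slicer.
  - by move=> v Kv; apply: f0; apply: (lt_le_trans Kv); exact: rV_cons_normr.
rewrite -integral21_prod_meas1//=.
apply: integral0_eq => v _; rewrite /fubini_G.
under eq_integral do rewrite /= partial_rV_consl.
apply: (@integral_derive_compact_support _ K).
- by move=> x; exact: derivable_rV_consl.
- have -> : (fun x => 'D_1 (fun x => f (rV_cons (x, v))) x) =
    fun x => partial ord0 f (rV_cons (x, v)).
    by apply/funext => x; rewrite partial_rV_consl.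
  exact: continuous_slicel.
- by move=> x Kx; apply: f0; apply: (lt_le_trans Kx); exact: rV_cons_norml.
Qed.
End lebesgue_rV_calculus.

(** * Mean value theorems for partial derivatives *)

Section rV_differential_calculus.
Context {R : realType} {d : nat}.
Implicit Types (f g : 'rV[R]_d -> R) (x y v : 'rV[R]_d).

Let subr_subC (A B D E : R) : A - B - (D - E) = A - D - (B - E).
Proof. ring. Qed.

Let second_differenceC f x u v :
  f (x + u + v) - f (x + u) - (f (x + v) - f x) =
  f (x + v + u) - f (x + v) - (f (x + u) - f x).
Proof. by rewrite [x + v + u]addrAC subr_subC. Qed.

Let dist_le_halves (A B w e : R) : `|A - w| < e / 2 -> `|B - w| < e / 2 -> `|A - B| <= e.
Proof.
by rewrite !ltr_norml ler_norml => /andP[? ?] /andP[? ?]; apply/andP; split; lra.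
Qed.

Lemma near_ballP x (Q : 'rV[R]_d -> Prop) :
  (\forall z \near x, Q z) ->
  exists2 r : R, 0 < r & forall z, `|z - x| < r -> Q z.
Proof.
move=> /nbhs_ballP[r /= r0 h]; exists r => // z zx; apply: h.
by rewrite -ball_normE /= distrC.
Qed.

Lemma ball_near x (Q : 'rV[R]_d -> Prop) (r : R) : 0 < r ->
  (forall z, `|z - x| < r -> Q z) -> \forall z \near x, Q z.
Proof.
move=> r0 h; apply/nbhs_ballP; exists r => //= z.
by rewrite -ball_normE /= distrC; exact: h.
Qed.

Lemma near_in_ball x z (r : R) : `|x - z| < r -> \forall y \near x, `|y - z| < r.
Proof.
move=> xr; have e0 : 0 < r - `|x - z| by rewrite subr_gt0.
apply: (ball_near e0) => y yx; rewrite -(subrKC x y) [x + _]addrC -addrA.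
by apply: (le_lt_trans (ler_normD _ _)); rewrite -ltrBrDr.
Qed.

Lemma derive_partialE f x v : differentiable f x ->
  'D_v f x = \sum_a v ord0 a * partial a f x.
Proof.
move=> df; rewrite deriveE// {1}[v]row_sum_delta linear_sum.
by apply: eq_bigr => a _; rewrite linearZ /partial deriveE.
Qed.

Lemma is_derive_line f x v (t : R) : differentiable f (x + t *: v) ->
  is_derive t 1 (fun s : R => f (x + s *: v))
    (\sum_a v ord0 a * partial a f (x + t *: v)).
Proof.
move=> df; rewrite -derive_partialE//.
have /derivableP dv : derivable f (x + t *: v) v by exact: diff_derivable.
have E : (fun h : R => h^-1 *: (((fun s : R => f (x + s *: v)) \o shift t) (h *: 1) -
     f (x + t *: v))) =
   (fun h : R => h^-1 *: ((f \o shift (x + t *: v)) (h *: v) - f (x + t *: v))).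
  apply/funext => h; congr (_ *: (_ - _)).
  have hE : shift t (h *: (1 : R)) = h + t by rewrite /= [h%:A]mulr1.
  by rewrite /comp hE scalerDl addrCA.
apply: DeriveDef.
  by rewrite /derivable E; apply: ex_derive.
by rewrite /derive E.
Qed.

Lemma segment_MVT f x y :
  (forall t : R, 0 <= t <= 1 -> differentiable f (x + t *: (y - x))) ->
  exists2 t : R, 0 < t < 1 &
    f y - f x = \sum_a (y - x) ord0 a * partial a f (x + t *: (y - x)).
Proof.
move=> df.
have dl (t : R) : 0 <= t <= 1 -> is_derive t 1 (fun s : R => f (x + s *: (y - x)))
    (\sum_a (y - x) ord0 a * partial a f (x + t *: (y - x))).
  by move=> /df; exact: is_derive_line.
have [||t] := @MVT R (fun s : R => f (x + s *: (y - x)))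
   (fun t => \sum_a (y - x) ord0 a * partial a f (x + t *: (y - x))) 0 1 ltr01.
- by move=> t; rewrite in_itv/= => /andP[t0 t1]; apply: dl; rewrite !ltW.
- apply: derivable_within_continuous => t; rewrite in_itv/= => t01.
  exact: (@ex_derive _ _ _ _ _ _ _ (dl _ t01)).
rewrite in_itv/= => t01; rewrite scale1r scale0r addr0 subr0 mulr1 subrKC => fE.
by exists t.
Qed.

Lemma segment_in_ball x y z (r t : R) : `|x - z| < r -> `|y - z| < r -> 0 <= t <= 1 ->
  `|x + t *: (y - x) - z| < r.
Proof.
move=> xr yr /andP[t0 t1].
have -> : x + t *: (y - x) - z = (1 - t) *: (x - z) + t *: (y - z).
  by apply/rowP => i; rewrite !mxE; ring.
apply: (le_lt_trans (ler_normD _ _)); rewrite !normrZ ger0_norm ?subr_ge0// ger0_norm//.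
have [->|t0'] := eqVneq t 0; first by rewrite mul0r addr0 subr0 mul1r.
have tp : 0 < t by rewrite lt_neqAle eq_sym t0'.
apply: (@lt_le_trans _ _ ((1 - t) * r + t * r)); last by rewrite -mulrDl subrK mul1r.
by rewrite ler_ltD ?ltr_pM2l// ler_wpM2l ?subr_ge0// ltW.
Qed.

Lemma segment_in_sub_ball x y (t : R) : 0 <= t <= 1 ->
  `|x + t *: (y - x) - x| <= `|y - x|.
Proof.
move=> /andP[t0 t1]; rewrite addrAC subrr add0r normrZ ger0_norm//.
by rewrite ler_piMl.
Qed.

Lemma delta_mxE (a b : 'I_d) : (delta_mx ord0 a : 'rV[R]_d) ord0 b = (b == a)%:R.
Proof. by rewrite mxE eqxx. Qed.

Lemma norm_delta_mx_le (a : 'I_d) : `|delta_mx ord0 a : 'rV[R]_d| <= 1.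
Proof.
apply: rV_norm_le => // i; rewrite delta_mxE; case: eqP => _; rewrite ?normr1 ?normr0//.
Qed.

Lemma partial_MVT f x (a : 'I_d) (t : R) : 0 < t ->
  (forall s : R, 0 <= s <= t -> differentiable f (x + s *: delta_mx ord0 a)) ->
  exists2 s : R, 0 < s < t &
    f (x + t *: delta_mx ord0 a) - f x = t * partial a f (x + s *: delta_mx ord0 a).
Proof.
move=> t0 df.
have E : (x + t *: delta_mx ord0 a) - x = t *: delta_mx ord0 a.
  by rewrite addrAC subrr add0r.
have [s /andP[s0 s1]|s /andP[s0 s1]] := @segment_MVT f x (x + t *: delta_mx ord0 a).
  by rewrite E scalerA; apply: df; rewrite mulr_ge0 ?ler_piMl// ltW.
rewrite E scalerA => ->; exists (s * t).
  by rewrite mulr_gt0//= gtr_pMl.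
rewrite (bigD1 a)//= big1 ?addr0 => [|b ba].
  by rewrite mxE delta_mxE eqxx mulr1.
by rewrite mxE delta_mxE (negbTE ba) mulr0 mul0r.
Qed.

Lemma partial_line (F : 'rV[R]_d -> R) x (a : 'I_d) (s : R) :
  'D_1 (fun t : R => F (x + t *: delta_mx ord0 a)) s = partial a F (x + s *: delta_mx ord0 a).
Proof.
rewrite /partial /derive.
suff -> : (fun h : R => h^-1 *: (((fun t : R => F (x + t *: delta_mx ord0 a)) \o shift s) (h *: 1) -
     F (x + s *: delta_mx ord0 a))) =
  (fun h : R => h^-1 *: ((F \o shift (x + s *: delta_mx ord0 a)) (h *: delta_mx ord0 a) -
     F (x + s *: delta_mx ord0 a))) by [].
apply/funext => h; congr (_ *: (_ - _)).
have hE : shift s (h *: (1 : R)) = h + s by rewrite /= [h%:A]mulr1.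
by rewrite /comp hE scalerDl addrCA.
Qed.

Lemma partial_shift f x v (a : 'I_d) :
  partial a (fun z => f (z + v)) x = partial a f (x + v).
Proof.
rewrite /partial /derive.
have -> // : (fun h : R => h^-1 *: (((fun z => f (z + v)) \o shift x) (h *: delta_mx ord0 a) -
     f (x + v))) = (fun h : R => h^-1 *: ((f \o shift (x + v)) (h *: delta_mx ord0 a) -
     f (x + v))).
by apply/funext => h /=; rewrite addrA.
Qed.

(** Two applications of the mean value theorem, first along a to the difference of
    f along b, then along b to the derivative of f along a. *)
Lemma second_difference f x (a b : 'I_d) (t r : R) : 0 < t -> 2 * t < r ->
  (forall z, `|z - x| < r -> differentiable f z) ->
  (forall z, `|z - x| < r -> differentiable (partial a f) z) ->
  exists2 z, `|z - x| < r &
  f (x + t *: delta_mx ord0 a + t *: delta_mx ord0 b) - f (x + t *: delta_mx ord0 a)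
   - (f (x + t *: delta_mx ord0 b) - f x) = t ^+ 2 * partial b (partial a f) z.
Proof.
move=> t0 tr df ddf.
have inr (s1 s2 : R) : 0 <= s1 <= t -> 0 <= s2 <= t ->
    `|x + s1 *: delta_mx ord0 a + s2 *: delta_mx ord0 b - x| < r.
  move=> /andP[s10 s1t] /andP[s20 s2t]; apply: le_lt_trans tr.
  have -> : x + s1 *: delta_mx ord0 a + s2 *: delta_mx ord0 b - x =
      s1 *: delta_mx ord0 a + s2 *: delta_mx ord0 b.
    by apply/rowP => i; rewrite !mxE; ring.
  rewrite mulr_natl mulr2n.
  apply: (le_trans (ler_normD _ _)); rewrite !normrZ !ger0_norm//.
  have a1 := norm_delta_mx_le a; have b1 := norm_delta_mx_le b.
  by apply: lerD; rewrite -[leRHS]mulr1 ler_pM.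
pose g := fun z => f (z + t *: delta_mx ord0 b) - f z.
have dsh z : differentiable (fun z : 'rV[R]_d => z + t *: delta_mx ord0 b) z.
  exact: differentiableD.
have dfs z : `|z + t *: delta_mx ord0 b - x| < r ->
    differentiable (f \o (fun z : 'rV[R]_d => z + t *: delta_mx ord0 b)) z.
  by move=> zr; apply: differentiable_comp => //; exact: df.
have z0 : 0 <= t <= t by rewrite lexx ltW.
have z0' : (0 : R) <= 0 <= t by rewrite lexx ltW.
have [s s0t|s /andP[s0 st]] := @partial_MVT g x a t t0.
  apply: differentiableB; first by apply: dfs; exact: inr.
  apply: df; have := inr _ _ s0t z0'; by rewrite scale0r addr0.
rewrite /g => gE.
have s0t : 0 <= s <= t by rewrite !ltW.
have [|u /andP[u0 ut]] := @partial_MVT (partial a f) (x + s *: delta_mx ord0 a) b t t0.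
  by move=> w w0t; apply: ddf; exact: inr.
move=> hE.
have u0t : 0 <= u <= t by rewrite !ltW.
exists (x + s *: delta_mx ord0 a + u *: delta_mx ord0 b); first exact: inr.
rewrite expr2 -mulrA -hE -[LHS]/(f (x + t *: delta_mx ord0 a + t *: delta_mx ord0 b) - f (x + t *: delta_mx ord0 a)
   - (f (x + t *: delta_mx ord0 b) - f x)) gE; congr (_ * _).
set q := x + s *: delta_mx ord0 a.
have dq : differentiable f q.
  by have := inr _ _ s0t z0'; rewrite scale0r addr0 => /df.
have dq2 : differentiable f (q + t *: delta_mx ord0 b) by apply: df; exact: inr.
rewrite {1}/partial deriveB; last 2 first.
- by apply: diff_derivable; apply: dfs; exact: inr.
- by apply: diff_derivable; exact: dq.
by rewrite -!/(partial a _ _) partial_shift.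
Qed.

(** Schwarz's theorem: the second difference does not depend on the order in which
    the increments are taken, and both mixed derivatives are its limits after
    division by the square of the step. *)
Lemma partialC f x (a b : 'I_d) :
  (\forall z \near x, [/\ differentiable f z, differentiable (partial a f) z &
     differentiable (partial b f) z]) ->
  {for x, continuous (partial a (partial b f))} ->
  {for x, continuous (partial b (partial a f))} ->
  partial a (partial b f) x = partial b (partial a f) x.
Proof.
move=> /near_ballP[r0 r00 hr] cab cba.
apply/eqP; rewrite -subr_eq0 -normr_le0; apply/ler_addgt0Pl => e e0; rewrite addr0.
have e20 : 0 < e / 2 by rewrite divr_gt0.
have /near_ballP[r1 r10 h1] : \forall z \near x,
    `|partial a (partial b f) x - partial a (partial b f) z| < e / 2.
  by move/cvgrPdist_lt : cab; exact.
have /near_ballP[r2 r20 h2] : \forall z \near x,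
    `|partial b (partial a f) x - partial b (partial a f) z| < e / 2.
  by move/cvgrPdist_lt : cba; exact.
pose r := Num.min r0 (Num.min r1 r2).
have rr : 0 < r by rewrite !lt_min r00 r10.
have inr z : `|z - x| < r -> [/\ `|z - x| < r0, `|z - x| < r1 & `|z - x| < r2].
  by rewrite !lt_min => /and3P[].
have t0 : 0 < r / 3 by rewrite divr_gt0.
have t2 : 2 * (r / 3) < r by lra.
have [||z zr hz] := @second_difference f x a b _ r t0 t2.
- by move=> z /inr[/hr[]].
- by move=> z /inr[/hr[]].
have [||y yr hy] := @second_difference f x b a _ r t0 t2.
- by move=> z' /inr[/hr[]].
- by move=> z' /inr[/hr[]].
have E : partial b (partial a f) z = partial a (partial b f) y.
  have t20 : (r / 3) ^+ 2 != 0 by rewrite expf_neq0// gt_eqF.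
  suff : (r / 3) ^+ 2 * partial b (partial a f) z =
      (r / 3) ^+ 2 * partial a (partial b f) y by move/(mulfI t20).
  exact: (etrans (esym hz) (etrans (second_differenceC _ _ _ _) hy)).
have /inr[_ _ /h2 hz2] := zr; have /inr[_ /h1 hy1 _] := yr.
by rewrite E in hz2; exact: dist_le_halves hy1 hz2.
Qed.

Lemma partial_local_max f x (a : 'I_d) :
  (\forall z \near x, differentiable f z) ->
  (\forall z \near x, f z <= f x) -> partial a f x = 0.
Proof.
move=> /near_ballP[r1 r10 h1] /near_ballP[r2 r20 h2].
have r0 : 0 < Num.min r1 r2 by rewrite lt_min r10.
have inr (s : R) : s \in `](- Num.min r1 r2), (Num.min r1 r2)[ ->
    `|x + s *: delta_mx ord0 a - x| < r1 /\ `|x + s *: delta_mx ord0 a - x| < r2.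
  rewrite in_itv/= -ltr_norml => sr.
  rewrite addrAC subrr add0r; suff : `|s *: (delta_mx ord0 a : 'rV[R]_d)| < Num.min r1 r2.
    by rewrite lt_min => /andP.
  apply: le_lt_trans sr; rewrite normrZ -[leRHS]mulr1 ler_wpM2l//.
  exact: norm_delta_mx_le.
have dl (s : R) : s \in `](- Num.min r1 r2), (Num.min r1 r2)[ ->
    is_derive s 1 (fun s : R => f (x + s *: delta_mx ord0 a))
     (\sum_b (delta_mx ord0 a : 'rV[R]_d) ord0 b * partial b f (x + s *: delta_mx ord0 a)).
  by move=> /inr[/h1 df _]; exact: is_derive_line.
have i0 : 0 \in `](- Num.min r1 r2), (Num.min r1 r2)[ by rewrite in_itv/= oppr_lt0 r0.
have := @derive1_at_max R (fun s : R => f (x + s *: delta_mx ord0 a))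
  (- Num.min r1 r2) (Num.min r1 r2) 0.
case => //.
- by rewrite ge0_cp// ltW.
- by move=> t /dl dt; exact: ex_derive.
- by move=> t /inr[_ /h2]; rewrite scale0r addr0.
move=> _ d0; have := @derive_val _ _ _ _ _ _ _ (dl _ i0).
rewrite d0 scale0r addr0 (bigD1 a)//= big1 ?addr0 => [|b ba].
  by rewrite delta_mxE eqxx mul1r.
by rewrite delta_mxE (negbTE ba) mul0r.
Qed.

End rV_differential_calculus.

(** * Differentiation rules and determinants *)

Section chain_rule.
Context {R : realType} {d : nat}.
Implicit Types (f g : 'rV[R]_d -> R) (x : 'rV[R]_d).

Lemma differentiable_comp1 (phi : R -> R) f x :
  derivable phi (f x) 1 -> differentiable f x -> differentiable (phi \o f) x.
Proof.
by move=> /derivable1_diffP dphi df; exact: differentiable_comp.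
Qed.

Lemma partial_comp1 (phi : R -> R) f x a :
  derivable phi (f x) 1 -> differentiable f x ->
  partial a (phi \o f) x = derive1 phi (f x) * partial a f x.
Proof.
move=> dphi df; have /derivable1_diffP dphi' := dphi.
rewrite /partial !deriveE//; last exact: differentiable_comp.
by rewrite diff_comp//= deriv1E// [LHS]mulrC.
Qed.

Lemma differentiable_ln f x : 0 < f x -> differentiable f x ->
  differentiable (fun z => ln (f z)) x.
Proof.
move=> f0 df; apply: (@differentiable_comp1 (@ln R)) => //.
by apply: ex_derive; exact: is_derive1_ln.
Qed.

Lemma partial_ln f x a : 0 < f x -> differentiable f x ->
  partial a (fun z => ln (f z)) x = partial a f x / f x.
Proof.
move=> f0 df; rewrite (@partial_comp1 (@ln R))//; last first.
  by apply: ex_derive; exact: is_derive1_ln.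
by rewrite derive1E (@derive_val _ _ _ _ _ _ _ (is_derive1_ln f0)) mulrC.
Qed.

Lemma differentiable_expR f x : differentiable f x ->
  differentiable (fun z => expR (f z)) x.
Proof. by move=> df; apply: (@differentiable_comp1 (@expR R)). Qed.

Lemma partial_expR f x a : differentiable f x ->
  partial a (fun z => expR (f z)) x = expR (f x) * partial a f x.
Proof.
by move=> df; rewrite (@partial_comp1 (@expR R))// derive1E derive_val.
Qed.

Lemma partialM f g x a : differentiable f x -> differentiable g x ->
  partial a (fun z => f z * g z) x = partial a f x * g x + f x * partial a g x.
Proof.
move=> df dg; rewrite /partial (@deriveM _ _ f g)//; try exact: diff_derivable.
by rewrite addrC; congr (_ + _); rewrite [LHS]mulrC.
Qed.

Lemma partialD f g x a : differentiable f x -> differentiable g x ->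
  partial a (fun z => f z + g z) x = partial a f x + partial a g x.
Proof.
by move=> df dg; rewrite /partial (@deriveD _ _ _ f g)//; exact: diff_derivable.
Qed.

Lemma partialB f g x a : differentiable f x -> differentiable g x ->
  partial a (fun z => f z - g z) x = partial a f x - partial a g x.
Proof.
by move=> df dg; rewrite /partial (@deriveB _ _ _ f g)//; exact: diff_derivable.
Qed.

Lemma partialZ (k : R) f x a : differentiable f x ->
  partial a (fun z => k * f z) x = k * partial a f x.
Proof.
by move=> df; rewrite /partial (@deriveZ _ _ _ f)//; exact: diff_derivable.
Qed.

Lemma near_eq_partial f g x a : (\forall z \near x, f z = g z) ->
  partial a f x = partial a g x.
Proof. by move=> h; exact: near_eq_derive. Qed.

Lemma differentiable_bigsum (I : Type) (r : seq I) (F : I -> 'rV[R]_d -> R) x :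
  (forall i, differentiable (F i) x) ->
  differentiable (fun z => \sum_(i <- r) F i z) x.
Proof.
move=> dF; elim: r => [|i r IH].
  by under eq_fun do rewrite big_nil; exact: differentiable_cst.
by under eq_fun do rewrite big_cons; exact: differentiableD.
Qed.

Lemma partial_bigsum (I : Type) (r : seq I) (F : I -> 'rV[R]_d -> R) x a :
  (forall i, differentiable (F i) x) ->
  partial a (fun z => \sum_(i <- r) F i z) x = \sum_(i <- r) partial a (F i) x.
Proof.
move=> dF; elim: r => [|i r IH].
  by under eq_fun do rewrite big_nil; rewrite big_nil; exact: derive_cst.
rewrite big_cons -IH -partialD//; last exact: differentiable_bigsum.
by congr (partial a _ x); apply/funext => z; rewrite big_cons.
Qed.

Lemma differentiable_bigprod (I : Type) (r : seq I) (Q : pred I) (F : I -> 'rV[R]_d -> R) x :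
  (forall i, differentiable (F i) x) ->
  differentiable (fun z => \prod_(i <- r | Q i) F i z) x.
Proof.
move=> dF; elim: r => [|i r IH].
  by under eq_fun do rewrite big_nil; exact: differentiable_cst.
have -> : (fun z => \prod_(j <- i :: r | Q j) F j z) =
    if Q i then (fun z => F i z * \prod_(j <- r | Q j) F j z)
    else (fun z => \prod_(j <- r | Q j) F j z).
  by apply/funext => z; rewrite big_cons; case: ifP.
by case: ifP => // _; exact: differentiableM.
Qed.

Lemma partial_bigprod (I : eqType) (r : seq I) (F : I -> 'rV[R]_d -> R) x a :
  uniq r -> (forall i, differentiable (F i) x) ->
  partial a (fun z => \prod_(i <- r) F i z) x =
  \sum_(i <- r) partial a (F i) x * \prod_(j <- r | j != i) F j x.
Proof.
move=> + dF; elim: r => [|i r IH] /=.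
  by rewrite big_nil; under eq_fun do rewrite big_nil; move=> _; exact: derive_cst.
move=> /andP[ir ur].
have -> : (fun z => \prod_(j <- i :: r) F j z) = (fun z => F i z * \prod_(j <- r) F j z).
  by apply/funext => z; rewrite big_cons.
rewrite partialM//; last exact: differentiable_bigprod.
rewrite big_cons big_cons eqxx /=; congr (_ * _ + _).
  rewrite big_seq_cond [RHS]big_seq_cond; apply: eq_bigl => j /=.
  by rewrite andbT; case jr : (j \in r) => //=; apply/esym; apply: contraNneq ir => <-.
rewrite IH// big_distrr/= big_seq_cond [RHS]big_seq_cond; apply: eq_bigr => j.
rewrite andbT => jr; rewrite big_cons.
rewrite ifT; first by rewrite mulrCA.
by apply: contraNneq ir => ->.
Qed.

End chain_rule.

Section determinants.
Context {R : realType}.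

Lemma continuous_bigsum (T : topologicalType) (I : Type) (r : seq I) (F : I -> T -> R) x :
  (forall i, {for x, continuous (F i)}) ->
  {for x, continuous (fun z => \sum_(i <- r) F i z)}.
Proof.
move=> dF; elim: r => [|i r IH].
  have -> : (fun z => \sum_(i <- [::]) F i z) = fun=> 0.
    by apply/funext => z; rewrite big_nil.
  exact: cvg_cst.
have -> : (fun z => \sum_(j <- i :: r) F j z) = (fun z => F i z + \sum_(j <- r) F j z).
  by apply/funext => z; rewrite big_cons.
exact: cvgD (dF i) IH.
Qed.

Lemma continuous_bigprod (T : topologicalType) (I : Type) (r : seq I) (F : I -> T -> R) x :
  (forall i, {for x, continuous (F i)}) ->
  {for x, continuous (fun z => \prod_(i <- r) F i z)}.
Proof.
move=> dF; elim: r => [|i r IH].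
  have -> : (fun z => \prod_(i <- [::]) F i z) = fun=> 1.
    by apply/funext => z; rewrite big_nil.
  exact: cvg_cst.
have -> : (fun z => \prod_(j <- i :: r) F j z) = (fun z => F i z * \prod_(j <- r) F j z).
  by apply/funext => z; rewrite big_cons.
exact: cvgM (dF i) IH.
Qed.

Lemma continuous_det (T : topologicalType) n (M : T -> 'M[R]_n) x :
  (forall i j, {for x, continuous (fun z => M z i j)}) ->
  {for x, continuous (fun z => \det (M z))}.
Proof.
move=> cM; apply: continuous_bigsum => s.
apply: cvgM; first exact: cvg_cst.
by apply: continuous_bigprod => i; exact: cM.
Qed.

Lemma invmxE n (A : 'M[R]_n) i j : \det A != 0 ->
  invmx A i j = cofactor A j i / \det A.
Proof.
move=> dA; rewrite /invmx unitmxE unitfE dA !mxE mulrC.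
by [].
Qed.

Lemma continuous_cofactor (T : topologicalType) n (M : T -> 'M[R]_n) x i j :
  (forall i j, {for x, continuous (fun z => M z i j)}) ->
  {for x, continuous (fun z => cofactor (M z) i j)}.
Proof.
move=> cM; apply: cvgM; first exact: cvg_cst.
apply: (@continuous_det T n.-1 (fun z => row' i (col' j (M z)))) => k l.
have -> : (fun z => row' i (col' j (M z)) k l) = (fun z => M z (lift i k) (lift j l)).
  by apply/funext => z; rewrite !mxE.
exact: cM.
Qed.

Lemma continuous_invmx (T : topologicalType) n (M : T -> 'M[R]_n) x i j :
  \det (M x) != 0 -> (forall i j, {for x, continuous (fun z => M z i j)}) ->
  {for x, continuous (fun z => invmx (M z) i j)}.
Proof.
move=> dM cM; rewrite /prop_for /continuous_at invmxE//.
have cd := continuous_det cM.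
have dn : \forall z \near x, \det (M z) != 0.
  by apply: (cvgr_neq0 _ cd).
have h := cvgM (@continuous_cofactor _ _ M x j i cM) (cvgV dM cd).
have hn : {near x, (fun z => cofactor (M z) j i * (\det (M z))^-1) =1
    (fun z => invmx (M z) i j)}.
  by apply: filterS dn => z dz; rewrite invmxE.
by move=> A /(h _ _); apply: (near_eq_cvg hn).
Qed.

(** Jacobi's formula: the Leibniz expansion of the determinant is multilinear in the
    rows, so the derivative is the sum over i of the determinants in which row i has
    been differentiated; expand each of them along that row. *)
Lemma partial_det d n (M : 'rV[R]_d -> 'M[R]_n) x a :
  (forall i j, differentiable (fun z => M z i j) x) ->
  partial a (fun z => \det (M z)) x =
  \sum_i \sum_j partial a (fun z => M z i j) x * cofactor (M x) i j.
Proof.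
move=> dM.
pose B i := \matrix_(k, j) if k == i then partial a (fun z => M z k j) x else M x k j.
transitivity (\sum_i \det (B i)).
  rewrite partial_bigsum => [|s]; last first.
    apply: differentiableM; first exact: differentiable_cst.
    by apply: differentiable_bigprod.
  rewrite exchange_big /=; apply: eq_bigr => s _.
  rewrite partialZ; last exact: differentiable_bigprod.
  rewrite partial_bigprod//; last exact: index_enum_uniq.
  rewrite big_distrr /=; apply: eq_bigr => i _; congr (_ * _).
  rewrite [RHS](bigD1 i)//= mxE eqxx; congr (_ * _).
  by apply: eq_bigr => j ji; rewrite mxE (negbTE ji).
apply: eq_bigr => i _; rewrite (expand_det_row _ i); apply: eq_bigr => j _.
rewrite mxE eqxx; congr (_ * _); rewrite /cofactor; congr (_ * \det _).
by apply/matrixP => k l; rewrite !mxE eq_sym (negbTE (neq_lift _ _)).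
Qed.

(** The segment from the identity to G stays positive definite, hence invertible, and
    the determinant cannot change sign along it. As G need not be symmetric, it
    cannot simply be diagonalized. *)
Lemma positive_definite_det_gt0 n (G : 'M[R]_n) : positive_definite G -> 0 < \det G.
Proof.
move=> pG.
pose M (t : R) : 'M[R]_n := (1 - t)%:M + t *: G.
have dM t : 0 <= t <= 1 -> \det (M t) != 0.
  move=> /andP[t0 t1]; apply/det0P => -[v v0 vM].
  have : (v *m M t *m v^T) ord0 ord0 = 0 by rewrite vM mul0mx mxE.
  rewrite /M mulmxDr mulmxDl mul_mx_scalar -scalemxAr -!scalemxAl.
  rewrite mxE mxE [X in _ + X]mxE; set q := (v *m v^T) _ _; set q' := (v *m G *m v^T) _ _.
  have q'0 : 0 < q' by exact: pG.
  have q0 : 0 < q.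
    rewrite /q mxE; under eq_bigr do rewrite mxE -expr2.
    have [i vi] : exists i, v ord0 i != 0.
      apply/existsP; apply: contraNT v0; rewrite negb_exists => /forallP h.
      by apply/eqP/rowP => i; rewrite mxE; apply/eqP; have := h i; rewrite negbK.
    rewrite (bigD1 i)//= ltr_pwDl//; first by rewrite exprn_even_gt0.
    by apply: sumr_ge0 => j _; exact: sqr_ge0.
  nra.
rewrite ltNge; apply/negP => G0.
have cM : {within `[0, 1], continuous (fun t => \det (M t))}.
  apply: continuous_subspaceT => t; apply: (@continuous_det _ n M) => i j.
  have -> : (fun z => M z i j) = (fun z => (1 - z) *+ (i == j) + z * G i j).
    by apply/funext => z; rewrite !mxE.
  apply: cvgD.
    by apply: cvgMn; apply: cvgB; [exact: cvg_cst|exact: cvg_id].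
  by apply: cvgM; [exact: cvg_id|exact: cvg_cst].
have M0 : \det (M 0) = 1 by rewrite /M subr0 scale0r addr0 det1.
have M1 : \det (M 1) = \det G by rewrite /M subrr scale1r raddf0 add0r.
have [|t t01 /eqP] := @IVT R (fun t => \det (M t)) 0 1 0 ler01 cM.
  rewrite M0 M1; apply/andP; split; first by rewrite ge_min G0 orbT.
  by rewrite le_max ler01.
by rewrite in_itv/= in t01; exact/negP/dM.
Qed.

End determinants.

(** * Events of vanishing probability and the weak law of large numbers *)

Lemma cvg_invn0 {R : realType} : (n%:R^-1 : R) @[n --> \oo] --> (0 : R).
Proof.
apply/gtr0_cvgV0; last exact: cvgr_idn.
by exists 1%N => // n /= n1; rewrite ltr0n.
Qed.

Lemma ler_norm_mul_sqr {R : realDomainType} (a b : R) : `|a * b| <= a ^+ 2 + b ^+ 2.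
Proof.
have := sqr_ge0 (a + b); have := sqr_ge0 (a - b); rewrite !expr2 => ? ?.
by rewrite ler_norml; apply/andP; split; nra.
Qed.

Lemma sqrB_le {R : realDomainType} (a b : R) : (a - b) ^+ 2 <= 2 * a ^+ 2 + 2 * b ^+ 2.
Proof. by have := sqr_ge0 (a + b); rewrite !expr2; nra. Qed.

Section vanishing_probability.
Context {R : realType} {dO : measure_display} {Omega : measurableType dO}.
Variable P : probability Omega R.
Implicit Types E F : nat -> set Omega.

Lemma prob_vanishes_le E (u : nat -> R) :
  (\forall n \near \oo, (mu_ext P (E n) <= (u n)%:E)%E) -> u @ \oo --> 0 ->
  prob_vanishes P E.
Proof.
move=> Eu u0; apply: (@squeeze_cvge _ _ _ _ (cst 0%E) _ (EFin \o u)).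
- by apply: filterS Eu => n Eun; rewrite mu_ext_ge0.
- exact: cvg_cst.
- by apply: cvg_comp u0 _; exact: cvg_id.
Qed.

Lemma prob_vanishes_sub E F : (\forall n \near \oo, E n `<=` F n) ->
  prob_vanishes P F -> prob_vanishes P E.
Proof.
move=> EF F0.
have h : \forall n \near \oo, (cst 0%E n <= mu_ext P (E n) <= mu_ext P (F n))%E.
  by apply: filterS EF => n EFn; apply/andP; split; [exact: mu_ext_ge0|exact: le_mu_ext].
exact: (squeeze_cvge h (cvg_cst _) F0).
Qed.

Lemma prob_vanishesU E F : prob_vanishes P E -> prob_vanishes P F ->
  prob_vanishes P (fun n => E n `|` F n).
Proof.
move=> E0 F0.
apply: (@squeeze_cvge _ _ _ _ (cst 0%E) _ (fun n => mu_ext P (E n) + mu_ext P (F n))%E).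
- by apply: nearW => n; apply/andP; split; [exact: mu_ext_ge0|exact: outer_measureU2].
- exact: cvg_cst.
- by rewrite -[0%E]adde0; apply: cvgeD.
Qed.

Lemma prob_vanishes_ex (I : finType) (E : I -> nat -> set Omega) :
  (forall i, prob_vanishes P (E i)) ->
  prob_vanishes P (fun n => [set w | exists i, E i n w]).
Proof.
move=> E0.
suff h (s : seq I) : prob_vanishes P (fun n => [set w | exists2 i, i \in s & E i n w]).
  apply: prob_vanishes_sub (h (index_enum I)); apply: nearW => n w [i Ei].
  by exists i => //; rewrite mem_index_enum.
elim: s => [|i s IH].
  apply: (@prob_vanishes_le _ (cst 0)); last exact: cvg_cst.
  apply: nearW => n; rewrite (_ : [set _ | _] = set0) ?mu_ext0//.
  by apply/seteqP; split => w //= -[].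
apply: prob_vanishes_sub (prob_vanishesU (E0 i) IH); apply: nearW => n w [j].
by rewrite inE => /predU1P[->|js] Ej; [left|right; exists j].
Qed.

Lemma prob_vanishes_ae {d : measure_display} {Y : measurableType d}
    (y : nat -> {RV P >-> Y}) (Q : forall n, n.-tuple Y -> Prop) :
  eventually_almost_surely y Q ->
  prob_vanishes P (fun n => [set w | ~ Q n (sample y n w)]).
Proof.
move=> h; apply: (@prob_vanishes_le _ (cst 0)); last exact: cvg_cst.
apply: filterS h => n [A [mA A0 QA]] /=.
rewrite (_ : (cst 0 n)%:E = 0%E)// -A0 -measurable_mu_extE//.
exact: le_mu_ext.
Qed.

End vanishing_probability.

Section law_of_large_numbers.
Context {R : realType} {dO : measure_display} {Omega : measurableType dO}
  {dY : measure_display} {Y : measurableType dY}.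
Variables (P : probability Omega R) (y : nat -> {RV P >-> Y}) (nu : probability Y R).
Hypothesis law : forall t A, measurable A -> P (y t @^-1` A) = nu A.
Hypothesis indep : forall i j A B, i != j -> measurable A -> measurable B ->
  P (y i @^-1` A `&` y j @^-1` B) = (nu A * nu B)%E.

Lemma ge0_integral_law t (h : Y -> \bar R) : measurable_fun setT h ->
  (forall z, 0 <= h z)%E -> (\int[P]_w h (y t w) = \int[nu]_z h z)%E.
Proof.
move=> mh h0.
transitivity (\int[distribution P (y t)]_z h z)%E.
  by rewrite ge0_integral_distribution.
apply: eq_measure_integral => A mA _.
exact: law.
Qed.

Lemma integrable_law t (h : Y -> \bar R) :
  nu.-integrable setT h -> P.-integrable setT (h \o y t).
Proof.
move=> /integrableP[mh ih]; apply/integrableP; split; first exact: measurableT_comp.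
rewrite (@ge0_integral_law t (fun z => `|h z|)%E)//.
exact: measurableT_comp.
Qed.

Lemma integral_law t (h : Y -> \bar R) : nu.-integrable setT h ->
  (\int[P]_w h (y t w) = \int[nu]_z h z)%E.
Proof.
move=> ih; transitivity (\int[distribution P (y t)]_z h z)%E.
  rewrite integral_distribution//.
    by case/integrableP: ih.
  exact: (integrable_law t ih).
apply: eq_measure_integral => A mA _.
exact: law.
Qed.

(** Independence identifies the joint law of two observations with a product measure,
    since the two measures agree on rectangles. *)
Lemma integral_law_pair i j (h : Y * Y -> \bar R) : i != j ->
  (nu \x nu)%E.-integrable setT h ->
  (\int[P]_w h (y i w, y j w) = \int[nu \x nu]_z h z)%E.
Proof.
move=> ij ih.
pose X := fun w => (y i w, y j w).
have mX : measurable_fun setT X by apply: measurable_fun_pair.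
have pE : forall A, measurable A -> (nu \x nu)%E A = pushforward P X A.
  apply: product_measure_unique => A B mA mB.
  exact: (indep ij mA mB).
have mh : measurable_fun setT h by case/integrableP: ih.
transitivity (\int[pushforward P X]_z h z)%E; last first.
  by apply: eq_measure_integral => A mA _; exact: (esym (pE A mA)).
rewrite (integral_pushforward mX mh)//.
apply/integrableP; split; first exact: measurableT_comp.
have /integrableP[_] := ih; apply: le_lt_trans.
rewrite (eq_measure_integral (pushforward P X)) => [|A mA _]; last exact: pE.
by rewrite ge0_integral_pushforward//; exact: measurableT_comp.
Qed.

Lemma uncorrelated i j (f : Y -> R) : i != j ->
  nu.-integrable setT (EFin \o f) -> (\int[nu]_z (f z)%:E = 0)%E ->
  (\int[P]_w (f (y i w) * f (y j w))%:E = 0)%E.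
Proof.
move=> ij intf f0.
have mf : measurable_fun setT f by apply/measurable_EFinP; case/integrableP: intf.
have ifin : (\int[nu]_z `|(f z)%:E| < +oo)%E by case/integrableP: intf.
have mff : measurable_fun setT (fun z : Y * Y => (f z.1 * f z.2)%:E).
  apply/measurable_EFinP; apply: measurable_funM.
    exact: (measurableT_comp mf measurable_fst).
  exact: (measurableT_comp mf measurable_snd).
have iff : (nu \x nu)%E.-integrable setT (fun z : Y * Y => (f z.1 * f z.2)%:E).
  have mnf : measurable_fun setT (fun z => (`|f z|)%:E).
    by apply/measurable_EFinP; exact: measurableT_comp.
  apply/integrable12ltyP => //=.
  under eq_integral => x _.
    under eq_integral do rewrite normrM EFinM.
    rewrite ge0_integralZl//.
    over.
  rewrite ge0_integralZr//; last exact: integral_ge0.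
  by rewrite lte_mul_pinfty// ?integral_ge0// ge0_fin_numE// integral_ge0.
rewrite (@integral_law_pair i j (fun z => (f z.1 * f z.2)%:E) ij iff).
rewrite -integral12_prod_meas1//; apply: integral0_eq => x _; rewrite /fubini_F.
under eq_integral do rewrite /= EFinM.
by rewrite integralZl//= f0 mule0.
Qed.

Lemma second_moment_sum n (f : Y -> R) :
  nu.-integrable setT (EFin \o f) -> nu.-integrable setT (EFin \o (fun z => f z ^+ 2)) ->
  (\int[nu]_z (f z)%:E = 0)%E ->
  (\int[P]_w ((\sum_(i < n) f (y i w)) ^+ 2)%:E =
   n%:R%:E * \int[nu]_z (f z ^+ 2)%:E)%E.
Proof.
move=> intf intf2 f0.
have mf : measurable_fun setT f by apply/measurable_EFinP; case/integrableP: intf.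
have ii i j : P.-integrable setT (fun w => (f (y i w) * f (y j w))%:E).
  apply: (@le_integrable _ _ _ _ _ measurableT _
    (fun w => (f (y i w) ^+ 2 + f (y j w) ^+ 2)%:E)) => //.
  - apply/measurable_EFinP; apply: measurable_funM; exact: measurableT_comp.
  - move=> w _ /=; rewrite lee_fin [leRHS]ger0_norm ?addr_ge0 ?sqr_ge0//.
    exact: ler_norm_mul_sqr.
  - apply: (@integrableD _ _ _ _ _ measurableT (fun w => (f (y i w) ^+ 2)%:E)
      (fun w => (f (y j w) ^+ 2)%:E)).
      exact: (@integrable_law i (EFin \o (fun z => f z ^+ 2))).
    exact: (@integrable_law j (EFin \o (fun z => f z ^+ 2))).
under eq_integral => w _.
  rewrite expr2 big_distrlr/= -sumEFin.
  under eq_bigr do rewrite -sumEFin.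
  over.
rewrite integral_sum//; last by move=> i; exact: integrable_sum.
transitivity (\sum_(i < n) \int[nu]_z (f z ^+ 2)%:E)%E; last first.
  rewrite -(fineK (integrable_fin_num measurableT intf2)) sumEFin.
  by rewrite sumr_const card_ord -EFinM mulr_natl.
apply: eq_bigr => i _; rewrite integral_sum//.
rewrite (bigD1 i)//= big1 ?adde0 => [|j ji].
  rewrite -(@integral_law i (EFin \o (fun z => f z ^+ 2)))//.
by apply: uncorrelated => //; rewrite eq_sym.
Qed.

(** Chebyshev's inequality; pairwise independence makes the variance of the sum of n
    centred terms linear in n. The centred sum is measurable, so that outer and
    inner probabilities agree here. *)
Lemma law_of_large_numbers (f : Y -> R) (e : R) : 0 < e ->
  measurable_fun setT f -> nu.-integrable setT (EFin \o (fun z => f z ^+ 2)) ->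
  prob_vanishes P (fun n => [set w |
    e < `|n%:R^-1 * \sum_(i < n) f (y i w) - \int[nu]_z f z| ]).
Proof.
move=> e0 mf if2.
have if1 : nu.-integrable setT (EFin \o f).
  apply: (@le_integrable _ _ _ _ _ measurableT _ (EFin \o (fun z => 1 + f z ^+ 2))) => //.
  - exact/measurable_EFinP.
  - move=> z _ /=; rewrite lee_fin [leRHS]ger0_norm ?addr_ge0 ?sqr_ge0//.
    by have := ler_norm_mul_sqr 1 (f z); rewrite mul1r expr1n.
  - apply: (@integrableD _ _ _ _ _ measurableT (cst 1%:E) (fun z => (f z ^+ 2)%:E)) => //.
    exact: finite_measure_integrable_cst.
set m := \int[nu]_z f z.
pose g := fun z => f z - m.
have mE : (\int[nu]_z (f z)%:E = m%:E)%E by rewrite /m /Rintegral fineK// integrable_fin_num.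
have cst1 c : nu.-integrable setT (EFin \o (cst c : Y -> R)).
  exact: finite_measure_integrable_cst.
have ig : nu.-integrable setT (EFin \o g).
  have -> : EFin \o g = (fun z => (EFin \o f) z - (EFin \o cst m) z)%E by apply/funext.
  by apply: integrableB.
have g0 : (\int[nu]_z (g z)%:E = 0)%E.
  transitivity (\int[nu]_z ((f z)%:E - (cst m z)%:E))%E; first by [].
  rewrite (@integralB_EFin _ _ _ nu setT f (cst m) measurableT if1 (cst1 m)).
  rewrite mE; have -> : (\int[nu]_z (cst m z)%:E = m%:E)%E; last by rewrite subee.
  have := @integral_cst _ _ _ nu setT measurableT m%:E.
  move=> h; apply: (etrans h); rewrite -[RHS]mule1; congr (_ * _)%E.
  exact: probability_setT.
have ig2 : nu.-integrable setT (EFin \o (fun z => g z ^+ 2)).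
  apply: (@le_integrable _ _ _ _ _ measurableT _ (EFin \o (fun z => 2 * f z ^+ 2 + 2 * m ^+ 2))) => //.
  - by apply/measurable_EFinP; apply: measurable_funX; exact: measurable_funB.
  - move=> z _ /=; rewrite lee_fin [leLHS]ger0_norm ?sqr_ge0// [leRHS]ger0_norm; last first.
      by rewrite addr_ge0// mulr_ge0// sqr_ge0.
    exact: sqrB_le.
  - have h := integrableD measurableT (integrableZl measurableT 2 if2) (cst1 (2 * m ^+ 2)).
    exact: h.
pose s2 := fine (\int[nu]_z (g z ^+ 2)%:E)%E.
have s2E : (\int[nu]_z (g z ^+ 2)%:E = s2%:E)%E by rewrite /s2 fineK// integrable_fin_num.
apply: (@prob_vanishes_le _ _ _ _ _ (fun n => s2 / e ^+ 2 * n%:R^-1)); last first.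
  rewrite -[X in _ --> X](mulr0 (s2 / e ^+ 2)); apply: cvgM; first exact: cvg_cst.
  exact: cvg_invn0.
near=> n.
have n0 : 0 < n%:R :> R by rewrite ltr0n; near: n; exact: nbhs_infty_gt.
pose S := fun w => \sum_(i < n) g (y i w).
have mS : measurable_fun setT S.
  apply: measurable_sum => i; apply: measurableT_comp => //; exact: measurable_funB.
pose A := [set w | (e * n%:R) ^+ 2 <= S w ^+ 2].
have mA : measurable A.
  have -> : A = setT `&` [set w | ((e * n%:R) ^+ 2)%:E <= (S w ^+ 2)%:E]%E.
    by rewrite setTI; apply/seteqP; split => w; rewrite /A/= lee_fin.
  apply: emeasurable_fun_c_infty => //; apply/measurable_EFinP; exact: measurable_funX.
apply: (@le_trans _ _ (mu_ext P A)).
  apply: le_mu_ext => w /= h; rewrite /A /=.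
  have SE : S w = n%:R * (n%:R^-1 * \sum_(i < n) f (y i w) - m).
    rewrite /S /g sumrB sumr_const card_ord mulrBr mulrA divff ?gt_eqF// mul1r.
    by rewrite mulr_natl.
  rewrite SE -[leRHS]real_normK ?num_real// ler_pXn2r ?nnegrE//; last first.
    by rewrite mulr_ge0// ltW.
  by rewrite normrM (ger0_norm (ltW n0)) mulrC ler_pM2l// ltW.
rewrite measurable_mu_extE//.
have c0 : 0 < (e * n%:R) ^+ 2 by rewrite exprn_gt0// mulr_gt0.
have : (((e * n%:R) ^+ 2)%:E * P A <= n%:R%:E * s2%:E)%E.
  rewrite -s2E -second_moment_sum// -/(S _).
  rewrite -integral_cst//.
  apply: (@le_trans _ _ (\int[P]_(w in A) (S w ^+ 2)%:E)%E).
    apply: ge0_le_integral => //=.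
    - by move=> w _; rewrite lee_fin ltW.
    - apply/measurable_EFinP; apply: measurable_funX; exact: measurable_funTS.
  apply: ge0_subset_integral => //.
    by apply/measurable_EFinP; exact: measurable_funX.
  by move=> w _; rewrite lee_fin sqr_ge0.
have PA : P A = (fine (P A))%:E by rewrite fineK// fin_num_measure.
rewrite {1}PA -!EFinM !lee_fin -ler_pdivlMl// => h.
apply: (@le_trans _ _ (fine (P A))%:E).
  have -> : (fine (P A))%:E = P A by rewrite -PA.
  exact: lexx.
rewrite lee_fin; apply: (le_trans h); rewrite le_eqVlt; apply/orP; left; apply/eqP.
have e0' : e != 0 by rewrite gt_eqF.
have n0' : n%:R != 0 :> R by rewrite gt_eqF.
rewrite exprMn invfM; move: (n%:R : R) n0' => N N0; clear -e0' N0.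
by field; rewrite e0' N0.
Unshelve. all: by end_near. Qed.

End law_of_large_numbers.

(** * Sample means under the true density *)

Section density.
Context {R : realType} {dY : measure_display} {Y : measurableType dY}.
Variables (mu : {sigma_finite_measure set Y -> \bar R}) (nu : probability Y R) (q : Y -> R).
Hypotheses (mq : measurable_fun setT q) (q0 : forall z, 0 <= q z).
Hypothesis nuE : forall A, measurable A -> nu A = (\int[mu]_(z in A) (q z)%:E)%E.

Lemma density_integrable : mu.-integrable setT (EFin \o q).
Proof.
apply/integrableP; split; first exact/measurable_EFinP.
under eq_integral do rewrite /= ger0_norm//.
by rewrite -nuE// -ge0_fin_numE// fin_num_measure.
Qed.

Lemma density_dominates : nu `<< mu.
Proof.
apply/null_content_dominatesP => A mA A0; rewrite nuE//.
by apply: null_set_integral => //; exact: measurable_funTS (measurable_int _ density_integrable).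
Qed.

(** The Radon-Nikodym derivative of nu agrees with its density q almost everywhere. *)
Lemma ge0_integral_density (h : Y -> \bar R) : measurable_fun setT h ->
  (forall z, 0 <= h z)%E -> (\int[nu]_z h z = \int[mu]_z (h z * (q z)%:E))%E.
Proof.
move=> mh h0; have numu := density_dominates.
rewrite -(Radon_Nikodym_SigmaFinite.change_of_variables numu h0 measurableT mh).
have fi := Radon_Nikodym_SigmaFinite.f_integrable numu.
have mf := measurable_int _ fi.
apply: ae_eq_integral => //.
- exact: emeasurable_funM.
- by apply: emeasurable_funM => //; exact/measurable_EFinP.
- apply: ae_eqe_mul2l; apply: integral_ae_eq => //.
    exact/measurable_EFinP.
  move=> A _ mA; rewrite -Radon_Nikodym_SigmaFinite.f_integral//.
  exact: nuE.
Qed.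

Lemma integrable_density (f : Y -> R) : measurable_fun setT f ->
  mu.-integrable setT (EFin \o (fun z => q z * f z)) ->
  nu.-integrable setT (EFin \o f).
Proof.
move=> mf /integrableP[_ h]; apply/integrableP; split; first exact/measurable_EFinP.
rewrite ge0_integral_density//; last by apply: measurableT_comp => //; exact/measurable_EFinP.
apply: le_lt_trans h; rewrite le_eqVlt; apply/orP; left; apply/eqP.
by apply: eq_integral => z _ /=; rewrite normrM ger0_norm// mulrC EFinM.
Qed.

Lemma integral_density (f : Y -> R) : measurable_fun setT f ->
  mu.-integrable setT (EFin \o (fun z => q z * f z)) ->
  \int[nu]_z f z = \int[mu]_z (q z * f z).
Proof.
move=> mf ih; rewrite /Rintegral; congr fine.
rewrite (integralE nu) (integralE mu); congr (_ - _)%E.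
- rewrite ge0_integral_density//; last by apply: measurable_funepos; exact/measurable_EFinP.
  apply: eq_integral => z _.
  by rewrite !funeposE /= -!EFin_max -EFinM maxr_pMl// mul0r [q z * _]mulrC.
- rewrite ge0_integral_density//; last by apply: measurable_funeneg; exact/measurable_EFinP.
  apply: eq_integral => z _.
  by rewrite !funenegE /= -!EFin_max -EFinM maxr_pMl// mul0r mulNr [q z * _]mulrC.
Qed.

End density.

Section iid_model.
Context {R : realType} {d : nat} {dY : measure_display} {Y : measurableType dY}.
Variables (mu : {sigma_finite_measure set Y -> \bar R}) (p : Y -> 'rV[R]_d -> R)
  (theta0 : 'rV[R]_d).
Context {dO : measure_display} {Omega : measurableType dO}.
Variables (P : probability Omega R) (y : nat -> {RV P >-> Y}).
Hypotheses (mp : measurable_fun setT (p ^~ theta0)) (p0 : forall z, 0 < p z theta0).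
Hypothesis y_iid : iid_sample mu p theta0 y.

Let nu : probability Y R := distribution P (y 0%N).

Let nuE A : measurable A -> nu A = (\int[mu]_(z in A) (p z theta0)%:E)%E.
Proof. by move=> mA; exact: (y_iid.1 0%N A mA). Qed.

Let law t A : measurable A -> P (y t @^-1` A) = nu A.
Proof. by move=> mA; rewrite nuE//; exact: (y_iid.1 t A mA). Qed.

Let indep i j A B : i != j -> measurable A -> measurable B ->
  P (y i @^-1` A `&` y j @^-1` B) = (nu A * nu B)%E.
Proof.
move=> ij mA mB; pose n := (maxn i j).+1.
have ilt : (i < n)%N by rewrite ltnS leq_maxl.
have jlt : (j < n)%N by rewrite ltnS leq_maxr.
pose C (k : 'I_n) := if k == i :> nat then A else if k == j :> nat then B else setT.
have mC k : measurable (C k) by rewrite /C; do 2 case: ifP => // _.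
have := y_iid.2 n C mC.
rewrite (bigD1 (Ordinal ilt))//= (bigD1 (Ordinal jlt))/=; last first.
  by rewrite -val_eqE /= eq_sym.
rewrite [X in (_ * (_ * X))%E]big1 => [|k /andP[ki kj]]; last first.
  rewrite /C; rewrite -val_eqE /= in ki; rewrite -val_eqE /= in kj.
  by rewrite (negbTE ki) (negbTE kj) preimage_setT; exact: probability_setT.
rewrite /C /= !eqxx [j == i]eq_sym (negbTE ij) mule1 law// law// => <-.
congr (P _); apply/seteqP; split => w /=.
  move=> [Aw Bw] k; case: ifPn => [/eqP ->//|_]; case: ifPn => // /eqP -> //.
move=> h; split; first by have := h (Ordinal ilt); rewrite /= eqxx.
by have := h (Ordinal jlt); rewrite /= eq_sym (negbTE ij) eqxx.
Qed.

(** |f| <= 1 + f^2, and the density integrates to 1. *)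
Lemma expect_square_integrable (f : Y -> R) : measurable_fun setT f ->
  mu.-integrable setT (EFin \o (fun z => p z theta0 * f z ^+ 2)) ->
  mu.-integrable setT (EFin \o (fun z => p z theta0 * f z)).
Proof.
move=> mf if2.
apply: (@le_integrable _ _ _ _ _ measurableT _
  (EFin \o (fun z => p z theta0 + p z theta0 * f z ^+ 2))) => //.
- by apply/measurable_EFinP; exact: measurable_funM.
- move=> z _ /=; rewrite lee_fin normrM [leRHS]ger0_norm; last first.
    by have := ltW (p0 z) => pz; rewrite addr_ge0// mulr_ge0// sqr_ge0.
  rewrite (gtr0_norm (p0 z)) -[X in X + _]mulr1 -mulrDr ler_pM2l//.
  by have := ler_norm_mul_sqr 1 (f z); rewrite mul1r expr1n.
- have h := integrableD measurableT (density_integrable mp (fun z => ltW (p0 z)) nuE) if2.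
  exact: h.
Qed.

Lemma sample_mean_cvg (f : Y -> R) (e : R) : 0 < e -> measurable_fun setT f ->
  mu.-integrable setT (EFin \o (fun z => p z theta0 * f z ^+ 2)) ->
  prob_vanishes P (fun n => [set w |
    e < `|n%:R^-1 * \sum_(i < n) f (y i w) - expect mu p theta0 f| ]).
Proof.
move=> e0 mf if2.
rewrite /expect -(integral_density mp (fun z => ltW (p0 z)) nuE mf); last first.
  exact: expect_square_integrable.
apply: law_of_large_numbers => //.
apply: (integrable_density mp (fun z => ltW (p0 z)) nuE) => //.
exact: measurable_funX.
Qed.

Lemma expect_sample (f : Y -> R) : measurable_fun setT f ->
  mu.-integrable setT (EFin \o (fun z => p z theta0 * f z)) ->
  \int[P]_w f (y 0%N w) = expect mu p theta0 f.
Proof.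
move=> mf if1.
rewrite /expect -(integral_density mp (fun z => ltW (p0 z)) nuE mf)//.
rewrite /Rintegral; congr fine.
apply: (integral_law law) => //.
exact: (integrable_density mp (fun z => ltW (p0 z)) nuE).
Qed.

(** For one observation the sample information is the Fisher information. *)
Lemma fisher_posdef :
  (forall a b : 'I_d, measurable_fun setT (fun z =>
     partial a (logp p z) theta0 * partial b (logp p z) theta0)) ->
  (forall a b : 'I_d, mu.-integrable setT (EFin \o (fun z => p z theta0 *
     (partial a (logp p z) theta0 * partial b (logp p z) theta0)))) ->
  positive_definite (sample_information p theta0 y 1) ->
  positive_definite (fisher mu p theta0).
Proof.
move=> mf if1; suff -> : sample_information p theta0 y 1 = fisher mu p theta0 by [].
apply/matrixP => a b; rewrite !mxE.
rewrite -(expect_sample (mf a b) (if1 a b)).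
apply: eq_Rintegral => w _.
suff -> : (fun t => ln (likelihood p (sample y 1 w) t)) = logp p (y 0%N w) by [].
by apply/funext => t; rewrite /likelihood big_ord1 tnth_mktuple.
Qed.

End iid_model.

(** * Differentiation under the integral sign *)

Section caratheodory.
Context {R : realType} {dY : measure_display} {Y : measurableType dY}.

(** A function which is measurable in z and continuous in t is the limit of its values
    at the grid points floor(t (n+1)) / (n+1), and each of these approximations is
    measurable because only countably many grid points occur. *)
Lemma caratheodory_measurable (k : Y -> R -> R) :
  (forall t, measurable_fun setT (k ^~ t)) -> (forall z, continuous (k z)) ->
  measurable_fun setT (fun x : Y * R => k x.1 x.2).
Proof.
move=> mk ck.
pose r (n : nat) (t : R) : R := (Num.floor (t * n.+1%:R))%:~R / n.+1%:R.
apply: (@measurable_fun_cvg _ _ _ _ (fun n (x : Y * R) => k x.1 (r n x.2))) => //; last first.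
  move=> [z t] _ /=.
  apply: (@cvg_comp _ _ _ (r^~ t) (k z) _ (nbhs t)); last exact: ck.
  apply/cvgrPdist_le => e e0; near=> n.
  have n0 : 0 < n.+1%:R :> R by [].
  have -> : t - r n t = (t * n.+1%:R - (Num.floor (t * n.+1%:R))%:~R) / n.+1%:R.
    by rewrite mulrBl mulfK// gt_eqF.
  have := floor_itv (t * n.+1%:R); rewrite intrD1 => /andP[f1 f2].
  rewrite ger0_norm; last by rewrite divr_ge0// subr_ge0.
  apply: (@le_trans _ _ (1 / n.+1%:R)).
    by rewrite ler_pM2r ?invr_gt0// lerBlDl ltW.
  rewrite ler_pdivrMr// -ler_pdivrMl// mulr1.
  apply: (@le_trans _ _ n%:R); last by rewrite ler_nat.
  by near: n; exact: nbhs_infty_ger.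
move=> n _ B mB; rewrite setTI.
rewrite (_ : _ @^-1` B = \bigcup_(j : int)
   ((k ^~ (j%:~R / n.+1%:R) @^-1` B) `*`
    (fun t => Num.floor (t * n.+1%:R)) @^-1` [set j])); last first.
  apply/seteqP; split => [[z t] /= h|[z t] [j _ [/= h1 h2]]].
    by exists (Num.floor (t * n.+1%:R)).
  by rewrite /r h2.
apply: countable_bigcupT_measurable => [|j]; first exact: countableP.
apply: measurableX; first by rewrite -[X in measurable X]setTI; exact: mk.
have -> : (fun t : R => Num.floor (t * n.+1%:R)) @^-1` [set j] =
   `[(j%:~R / n.+1%:R : R), ((j + 1)%:~R / n.+1%:R)[%classic.
  have n0 : 0 < n.+1%:R :> R by [].
  apply/seteqP; split => t /=; rewrite in_itv/= ler_pdivrMr// ltr_pdivlMr//.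
    by move=> <-; exact: floor_itv.
  by move=> h; apply/eqP; rewrite floor_eq.
exact: measurable_itv.
Unshelve. all: by end_near. Qed.

(** Only a uniform bound on the integrals of |k(., t)| is required, no integrable
    function dominating all the k(., t): by Fubini's theorem the difference of two
    integrals of f is the integral in t of the integrals of k, and continuity of the
    latter in t allows to differentiate. This is the form adapted to conditions that
    speak of moments. *)
Lemma derive_integral (mu : {sigma_finite_measure set Y -> \bar R})
    (f k : Y -> R -> R) (u C x : R) :
  0 < x < u ->
  (forall z t, 0 <= t <= u -> is_derive t 1 (f z) (k z t)) ->
  (forall z t, 0 <= t <= u -> {for t, continuous (k z)}) ->
  (forall t, 0 <= t <= u -> mu.-integrable setT (EFin \o f ^~ t)) ->
  (forall t, 0 <= t <= u -> measurable_fun setT (k ^~ t)) ->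
  (forall t, 0 <= t <= u -> (\int[mu]_z `|(k z t)%:E| <= C%:E)%E) ->
  {for x, continuous (fun t => \int[mu]_z k z t)} ->
  'D_1 (fun t => \int[mu]_z f z t) x = \int[mu]_z k z x.
Proof.
move=> /andP[x0 xu] fk ck intf mk kC cG.
(* Clamping t to [0, u] extends the hypotheses to all t, so that measurability can be
   asked on the whole product. *)
pose c (t : R) := Num.max 0 (Num.min t u).
have u0 : 0 < u by exact: lt_trans xu.
have cI t : 0 <= c t <= u.
  by rewrite /c le_max lexx/= ge_max (ltW u0)/= ge_min lexx orbT.
have cE t : 0 <= t <= u -> c t = t.
  by move=> /andP[t0 tu]; rewrite /c min_l// max_r.
have cc : continuous c.
  move=> t; apply: (@continuous_max _ _ (cst 0) (fun t => Num.min t u)).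
    exact: cvg_cst.
  apply: (@continuous_min _ _ id (cst u)); first exact: cvg_id.
  exact: cvg_cst.
pose kc z t := k z (c t).
have mkc : measurable_fun setT (fun w : Y * R => kc w.1 w.2).
  apply: caratheodory_measurable => [t|z t]; first by apply: mk; exact: cI.
  by apply: (@continuous_comp _ _ _ c (k z)); [exact: cc|exact: (ck z (c t) (cI t))].
pose G t := \int[mu]_z k z t.
pose K s (w : Y * R) := kc w.1 w.2 * \1_(`[0, s] : set R) w.2.
have mK s : measurable_fun setT (K s).
  apply: measurable_funM => //.
  exact: (measurableT_comp (measurable_indic (measurable_itv `[0, s])) measurable_snd).
have mEK s : measurable_fun setT (EFin \o K s) by apply/measurable_EFinP; exact: mK.
have iK s : 0 <= s <= u -> (mu \x (@lebesgue_measure R))%E.-integrable setT (EFin \o K s).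
  move=> /andP[s0 su]; apply/integrable21ltyP; first exact: mEK.
  apply: (@le_lt_trans _ _ (\int[lebesgue_measure]_(t in `[0%R, s]%classic) C%:E)%E).
    rewrite [leRHS]integral_mkcond; apply: ge0_le_integral => //.
    - by move=> t _; exact: integral_ge0.
    - have := @measurable_fun_fubini_tonelli_G _ _ _ _ R mu (fun w => `|(EFin \o K s) w|)%E.
      by apply => //; exact: measurableT_comp.
    - by apply/measurable_restrict => //; exact: measurable_cst.
    - move=> t _; rewrite patchE; case: ifPn => [|tn].
        rewrite inE/= in_itv/= => /andP[t0 ts].
        have tu : 0 <= t <= u by rewrite t0 (le_trans ts).
        apply: le_trans (kC t tu); rewrite le_eqVlt; apply/orP; left; apply/eqP.
        apply: eq_integral => z _; rewrite /K /kc /= cE// indicE mem_set ?mulr1//=.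
        by rewrite in_itv/= t0.
      rewrite integral0_eq// => z _.
      by rewrite /K /= indicE (negbTE tn) mulr0 normr0.
  by rewrite integral_cst//= lebesgue_measure_itv/=; case: ifPn => _;
    rewrite ?mule0 ?ltry// -EFinB -EFinM ltry.
have uu : 0 <= u <= u by rewrite lexx ltW.
have ikt t : 0 <= t <= u -> mu.-integrable setT (EFin \o k ^~ t).
  move=> tu; apply/integrableP; split.
    by apply/measurable_EFinP; exact: mk.
  exact: le_lt_trans (kC t tu) (ltry _).
have fG t : 0 <= t <= u -> (\int[mu]_z (k z t)%:E)%E \is a fin_num.
  by move=> tu; apply: integrable_fin_num => //; exact: ikt.
have FG s : 0 < s <= u -> \int[mu]_z f z s - \int[mu]_z f z 0 =
    \int[lebesgue_measure]_(t in `[0, s]) G t.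
  move=> /andP[s0 su].
  have s0u : 0 <= s <= u by rewrite (ltW s0).
  have z0u : (0 : R) <= 0 <= u by rewrite lexx ltW.
  have := Fubini (iK s s0u).
  have -> : (\int[mu]_z \int[lebesgue_measure]_t (EFin \o K s) (z, t) =
             \int[mu]_z (f z s - f z 0)%:E)%E.
    apply: eq_integral => z _.
    transitivity (\int[lebesgue_measure]_(t in `[0%R, s]%classic) (k z t)%:E)%E.
      rewrite [RHS]integral_mkcond; apply: eq_integral => t _; rewrite patchE /K /kc /=.
      rewrite indicE; case: ifPn => tn; last by rewrite mulr0.
      rewrite mulr1 cE//; move: tn; rewrite inE/= in_itv/= => /andP[-> ts].
      exact: le_trans su.
    have inu t : t \in `[0, s] -> 0 <= t <= u.
      by rewrite in_itv/= => /andP[-> ts]; exact: le_trans su.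
    rewrite (@continuous_FTC2 _ (k z) (f z))// ?EFinB//.
    - apply: continuous_in_subspaceT => t; rewrite inE => /inu; exact: ck.
    - have cf t : 0 <= t <= u -> {for t, continuous (f z)}.
        move=> tu; apply: differentiable_continuous; apply/derivable1_diffP.
        exact: (@ex_derive _ _ _ _ _ _ _ (fk z t tu)).
      split => [t /(subset_itv_oo_cc) /inu tu||].
      + exact: (@ex_derive _ _ _ _ _ _ _ (fk z t tu)).
      + by apply: cvg_at_right_filter; exact: cf.
      + by apply: cvg_at_left_filter; exact: cf.
    - move=> t /(subset_itv_oo_cc) /inu tu; rewrite derive1E.
      exact: (@derive_val _ _ _ _ _ _ _ (fk z t tu)).
  have -> : (\int[lebesgue_measure]_t \int[mu]_z (EFin \o K s) (z, t) =
     \int[lebesgue_measure]_(t in `[0%R, s]%classic) \int[mu]_z (k z t)%:E)%E.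
    rewrite [RHS]integral_mkcond; apply: eq_integral => t _; rewrite patchE.
    case: ifPn => tn.
      apply: eq_integral => z _; rewrite /K /kc /= indicE tn mulr1 cE//.
      move: tn; rewrite inE/= in_itv/= => /andP[-> ts]; exact: le_trans su.
    by apply: integral0_eq => z _; rewrite /K /= indicE (negbTE tn) mulr0.
  move=> /(congr1 fine); rewrite -/(Rintegral _ _ _) RintegralB//; last 2 first.
  - exact: intf.
  - exact: intf.
  move=> ->; rewrite /Rintegral; congr fine; apply: eq_integral => t.
  rewrite inE/= in_itv/= => /andP[t0 ts].
  have tu : 0 <= t <= u by rewrite t0 (le_trans ts).
  by rewrite /G /Rintegral fineK// fG.
pose I : set R := `[0, u]%classic.
have iG : lebesgue_measure.-integrable I (EFin \o G).
  have h := measurable_fubini_G (iK u uu).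
  have lu : (lebesgue_measure I < +oo)%E.
    by rewrite /I lebesgue_measure_itv/=; case: ifPn => _; rewrite -?EFinB ltry.
  apply: measurable_bounded_integrable => //.
  - exact: measurable_itv.
  - have : measurable_fun I (fine \o fubini_G mu (EFin \o K u)).
      by apply: measurableT_comp => //; exact: (measurable_funTS h).
    apply: eq_measurable_fun => t tn.
    have tu : 0 <= t <= u by move: tn; rewrite inE /I /= in_itv.
    rewrite /fubini_G /G /Rintegral /=; congr fine; apply: eq_integral => z _.
    by rewrite /K /kc /= indicE tn mulr1 cE.
  - exists C; split; first exact: num_real.
    move=> b Cb t; rewrite /I /= in_itv/= => tu.
    apply: le_trans (ltW Cb); rewrite -lee_fin; apply: le_trans (kC t tu).
    rewrite /G EFin_normr_Rintegral//; last exact: ikt.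
    by apply: le_abse_integral => //; apply/measurable_EFinP; exact: mk.
have [dG GE] := continuous_FTC1_closed xu iG x0 cG.
pose H (s : R) := \int[lebesgue_measure]_(t in [set` `[0, s]]) G t.
transitivity ('D_1 (cst (\int[mu]_z f z 0) + H) x).
  apply: near_eq_derive => //.
  have xI : x \in `]0, u[ by rewrite in_itv/= x0.
  have := near_in_itvoo xI.
  apply: filterS => s; rewrite in_itv/= => /andP[s0 su].
  by rewrite /= fctE /H -FG ?s0 ?ltW// addrC subrK.
rewrite deriveD; [|exact: derivable_cst|exact: dG].
by rewrite derive_cst add0r -derive1E GE.
Qed.

End caratheodory.

(** * The matching field in terms of third derivatives *)

Section matching_field_limit.
Context {R : realType} {d : nat} {dY : measure_display} {Y : measurableType dY}.
Variables (mu : {sigma_finite_measure set Y -> \bar R}) (p : Y -> 'rV[R]_d -> R)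
  (Theta : set 'rV[R]_d) (theta0 : 'rV[R]_d).
Hypotheses (Theta_theta0 : nbhs theta0 Theta) (p_density : density_family mu p Theta)
  (p_diff : log_density_differentiable p theta0)
  (p_moments : moments_of_derivatives mu p theta0).
Local Notation l := (logp p).
Local Notation E := (expect mu p).

(** What the moment conditions provide for each monomial in the derivatives of the
    log-density; unlike differentiability it is easily seen to be stable under
    sums. *)
Definition moment_regular (h : 'rV[R]_d -> Y -> R) : Prop :=
  \forall theta \near theta0,
    mu.-integrable setT (EFin \o (fun y => p y theta * h theta y)) /\
    {for theta, continuous (fun t => E t (h t))}.

Lemma moment_regular_monomial (s : seq (seq 'I_d)) :
  all (fun I => 0 < size I <= 4)%N s -> moment_regular (score_monomial p s).
Proof.
move=> hs; apply: filterS (p_moments hs) => t [it dt]; split => //.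
exact: differentiable_continuous.
Qed.

Lemma moment_regularD h1 h2 : moment_regular h1 -> moment_regular h2 ->
  moment_regular (fun t y => h1 t y + h2 t y).
Proof.
move=> m1 m2.
have ED : \forall t \near theta0, E t (fun y => h1 t y + h2 t y) = E t (h1 t) + E t (h2 t).
  near=> t; have [i1 _] : mu.-integrable setT (EFin \o (fun y => p y t * h1 t y)) /\
    {for t, continuous (fun t => E t (h1 t))} by near: t.
  have [i2 _] : mu.-integrable setT (EFin \o (fun y => p y t * h2 t y)) /\
    {for t, continuous (fun t => E t (h2 t))} by near: t.
  by rewrite /expect -RintegralD//; apply: eq_Rintegral => y _; rewrite mulrDr.
have ED' := near_join ED.
near=> t; have [i1 c1] : mu.-integrable setT (EFin \o (fun y => p y t * h1 t y)) /\
    {for t, continuous (fun t => E t (h1 t))} by near: t.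
have [i2 c2] : mu.-integrable setT (EFin \o (fun y => p y t * h2 t y)) /\
    {for t, continuous (fun t => E t (h2 t))} by near: t.
split.
  have := integrableD measurableT i1 i2.
  by apply: eq_integrable => // y _; rewrite /= mulrDr.
have nE : \forall s \near t, E s (h1 s) + E s (h2 s) = E s (fun y => h1 s y + h2 s y).
  by apply: filterS (_ : \forall s \near t, E s (fun y => h1 s y + h2 s y) = E s (h1 s) + E s (h2 s)) => [s ->//|]; near: t.
rewrite /prop_for /continuous_at -(nbhs_singleton nE).
have h := cvgD c1 c2.
by move=> A /(h _ _); apply: (near_eq_cvg nE).
Unshelve. all: by end_near. Qed.

(** Differentiation of an expectation whose density moves with the parameter: w is the
    derivative of p m divided by p. Since |w| <= 1 + w^2, the second moment of w bounds
    its first absolute moment uniformly near theta0, as required to differentiate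
    under the integral along a line parallel to a coordinate axis. *)
Lemma expect_partial (m w : 'rV[R]_d -> Y -> R) a :
  (\forall t \near theta0, forall y, differentiable (m^~ y) t /\
     {for t, continuous (w^~ y)} /\
     w t y = m t y * partial a (l y) t + partial a (m^~ y) t) ->
  moment_regular m -> moment_regular w -> moment_regular (fun t y => w t y ^+ 2) ->
  \forall t \near theta0, partial a (fun t => E t (m t)) t = E t (w t).
Proof.
move=> dmw mm mw mw2.
have : \forall t \near theta0, E t (fun y => w t y ^+ 2) <= E theta0 (fun y => w theta0 y ^+ 2) + 1.
  have [_ c0] := nbhs_singleton mw2.
  have := c0 => /cvgr_le; apply.
  by rewrite ltrDl.
set C := E theta0 _ + 1 => wC.
have /near_ballP[r r0 hr] : \forall t \near theta0,
   [/\ Theta t, (forall y, 0 < p y t /\ times_differentiable 5 (l y) t),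
       (forall y, differentiable (m^~ y) t /\ {for t, continuous (w^~ y)} /\
         w t y = m t y * partial a (l y) t + partial a (m^~ y) t) &
      [/\ mu.-integrable setT (EFin \o (fun y => p y t * m t y)),
          mu.-integrable setT (EFin \o (fun y => p y t * w t y)) /\
            {for t, continuous (fun t => E t (w t))},
          mu.-integrable setT (EFin \o (fun y => p y t * w t y ^+ 2)) &
          E t (fun y => w t y ^+ 2) <= C]].
  near=> t; split; [by near: t|by near: t|by near: t|split].
  - have : mu.-integrable setT (EFin \o (fun y => p y t * m t y)) /\
      {for t, continuous (fun t => E t (m t))} by near: t.
    by case.
  - by near: t.
  - have : mu.-integrable setT (EFin \o (fun y => p y t * w t y ^+ 2)) /\
      {for t, continuous (fun t => E t (fun y => w t y ^+ 2))} by near: t.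
    by case.
  - by near: t.
have r4 : 0 < r / 4 by rewrite divr_gt0.
apply: (@ball_near _ _ _ _ (r / 4)) => // x xr.
(* The line through x is parametrized so that x corresponds to the interior point r/4
   of the interval [0, r/2]. *)
pose x' := x - (r / 4) *: delta_mx ord0 a.
pose g (t : R) := x' + t *: (delta_mx ord0 a : 'rV[R]_d).
have gin t : 0 <= t <= r / 2 -> `|g t - theta0| < r.
  move=> /andP[t0 t2].
  have -> : g t - theta0 = (x - theta0) + (t - r / 4) *: delta_mx ord0 a.
    by apply/rowP => i; rewrite !mxE; ring.
  apply: (le_lt_trans (ler_normD _ _)); rewrite normrZ.
  have h1 : `|t - r / 4| <= r / 4 by rewrite ler_norml; apply/andP; split; lra.
  have h2 : `|t - r / 4| * `|delta_mx ord0 a : 'rV[R]_d| <= r / 4.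
    by apply: le_trans h1; rewrite ler_piMr// norm_delta_mx_le.
  by apply: (le_lt_trans (lerD (ltW xr) h2)); lra.
have gx : g (r / 4) = x by rewrite /g /x' subrK.
have r42 : 0 <= r / 4 <= r / 2 by apply/andP; split; lra.
(* Near theta0 the densities are positive and equal to exp(log p), the form in which they
   can be differentiated. *)
pose pe y z := expR (l y z).
have peE y z : `|z - theta0| < r -> pe y z = p y z.
  by move=> /hr[_ pl _ _]; rewrite /pe /logp lnK ?posrE//; have [] := pl y.
have xr' : `|x - theta0| < r by rewrite -gx; exact: gin.
have cg t : {for t, continuous g}.
  apply: cvgD; first exact: cvg_cst.
  by apply: cvgZ; [exact: cvg_id|exact: cvg_cst].
transitivity ('D_1 (fun t : R => \int[mu]_y (pe y (g t) * m (g t) y)) (r / 4)).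
  rewrite -[in LHS]gx -partial_line; apply: near_eq_derive => //.
  have : \forall s \near r / 4, `|g s - theta0| < r.
    have cn : {for r / 4, continuous (fun s => `|g s - theta0|)}.
      apply: (@continuous_comp _ _ _ (fun s => g s - theta0) (fun z => `|z|)); last first.
        exact: norm_continuous.
      by apply: cvgB; [exact: cg|exact: cvg_cst].
    by move/cvgr_lt : cn; apply; rewrite gx.
  apply: filterS => s gs; rewrite /expect; apply: eq_Rintegral => y _.
  by rewrite peE.
transitivity (\int[mu]_y (pe y (g (r / 4)) * w (g (r / 4)) y)); last first.
  by rewrite gx /expect; apply: eq_Rintegral => y _; rewrite peE.
apply: (@derive_integral R dY Y mu
  (fun y t => pe y (g t) * m (g t) y) (fun y t => pe y (g t) * w (g t) y) (r / 2) (1 + C)).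
- by apply/andP; split; lra.
- move=> y t /gin gr; have [_ pl /(_ y)[dm [_ wE]] _] := hr _ gr.
  have [py dl] := pl y.
  have dly : differentiable (l y) (g t) by exact: (dl [::]).
  pose G := fun z => expR (l y z) * m z y.
  have de : differentiable (fun z => expR (l y z)) (g t) by exact: differentiable_expR.
  have dG : differentiable G (g t) by exact: differentiableM.
  have := is_derive_line dG.
  suff -> : \sum_b (delta_mx ord0 a : 'rV[R]_d) ord0 b * partial b G (g t) =
     pe y (g t) * w (g t) y by [].
  rewrite (bigD1 a)//= big1 ?addr0 => [|b ba]; last first.
    by rewrite delta_mxE (negbTE ba) mul0r.
  rewrite delta_mxE eqxx mul1r partialM// partial_expR// wE mulrDr -mulrA.
  by rewrite [m _ _ * _]mulrC.
- move=> y t /gin gr; have [_ pl /(_ y)[_ [cw _]] _] := hr _ gr.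
  have [_ dl] := pl y.
  have dly : differentiable (l y) (g t) by exact: (dl [::]).
  apply: cvgM.
    apply: (@continuous_comp _ _ _ g (pe y)); first exact: cg.
    by apply: differentiable_continuous; exact: differentiable_expR.
  by apply: (@continuous_comp _ _ _ g (w^~ y)); first exact: cg.
- move=> t /gin gr; have [_ _ _ [im _ _ _]] := hr _ gr.
  by apply: eq_integrable im => // y _ /=; rewrite peE.
- move=> t /gin gr; have [_ _ _ [_ [/integrableP[/measurable_EFinP + _] _] _ _]] := hr _ gr.
  by apply: eq_measurable_fun => y _; rewrite peE.
- move=> t /gin gr; have [Tt pl _ [_ [iw _] iw2 wC']] := hr _ gr.
  have [mp pp p1] := p_density Tt.
  have ip : mu.-integrable setT (EFin \o p^~ (g t)).
    apply/integrableP; split; first exact/measurable_EFinP.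
    have -> : (\int[mu]_y `|(EFin \o p^~ (g t)) y| = \int[mu]_y (p y (g t))%:E)%E.
      by apply: eq_integral => y _ /=; rewrite ger0_norm.
    by rewrite p1 ltry.
  apply: (@le_trans _ _ (\int[mu]_y ((p y (g t))%:E + (p y (g t) * w (g t) y ^+ 2)%:E))%E).
    have /integrableP[mwy _] := iw; have /integrableP[mwy2 _] := iw2.
    apply: ge0_le_integral => //.
    - apply: measurableT_comp => //.
      by apply: eq_measurable_fun mwy => y _ /=; rewrite peE.
    - by apply: emeasurable_funD => //; exact/measurable_EFinP.
    - move=> y _; rewrite peE// /= -EFinD lee_fin normrM ger0_norm//.
      rewrite -[X in X + _]mulr1 -mulrDr ler_wpM2l//.
      by have := ler_norm_mul_sqr 1 (w (g t) y); rewrite mul1r expr1n.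
  rewrite integralD_EFin// p1 EFinD leeD2l//.
  rewrite -(fineK (integrable_fin_num measurableT iw2)) lee_fin.
  exact: wC'.
- have [_ _ _ [_ [_ cw] _ _]] := hr _ xr'.
  have nE : \forall s \near r / 4, E (g s) (w (g s)) = \int[mu]_y (pe y (g s) * w (g s) y).
    have : \forall s \near r / 4, `|g s - theta0| < r.
      have cn : {for r / 4, continuous (fun s => `|g s - theta0|)}.
        apply: (@continuous_comp _ _ _ (fun s => g s - theta0) (fun z => `|z|)); last first.
          exact: norm_continuous.
        by apply: cvgB; [exact: cg|exact: cvg_cst].
      by move/cvgr_lt : cn; apply; rewrite gx.
    by apply: filterS => s gs; rewrite /expect; apply: eq_Rintegral => y _; rewrite peE.
  rewrite /prop_for /continuous_at -(nbhs_singleton nE).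
  have h : {for r / 4, continuous (fun s => E (g s) (w (g s)))}.
    apply: (@continuous_comp _ _ _ g (fun t => E t (w t))); first exact: cg.
    by rewrite gx.
  by move=> A /h; apply: (near_eq_cvg nE).
Unshelve. all: by end_near. Qed.

Lemma partials_diff (I : seq 'I_d) : (size I < 5)%N ->
  \forall t \near theta0, forall y, differentiable (partials I (l y)) t.
Proof. by move=> h; apply: filterS p_diff => t pt y; have [_] := pt y; exact. Qed.

Let moment_regular_prod (s : seq (seq 'I_d)) (h : 'rV[R]_d -> Y -> R) :
  all (fun I => 0 < size I <= 4)%N s ->
  (forall t y, h t y = score_monomial p s t y) -> moment_regular h.
Proof.
move=> hs hE; have -> : h = score_monomial p s by apply/funext => t; apply/funext => y.
exact: moment_regular_monomial.
Qed.

(** The square of the derivative of the integrand is again a sum of monomials in the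
    derivatives of the log-density, so that its moment is regular. *)
Lemma expect_partial_partials (J : seq 'I_d) a : (0 < size J <= 3)%N ->
  \forall t \near theta0, partial a (fun t => E t (fun y => partials J (l y) t)) t =
    E t (fun y => partials J (l y) t * partial a (l y) t) +
    E t (fun y => partials (a :: J) (l y) t).
Proof.
move=> /andP[J0 J3].
have J4 : (size J <= 4)%N by exact: (leq_trans J3).
have mJ : moment_regular (fun t y => partials J (l y) t).
  by apply: (@moment_regular_prod [:: J]) => [|t y]; rewrite /= ?J0 ?J4// /score_monomial big_seq1.
have mJa : moment_regular (fun t y => partials J (l y) t * partial a (l y) t).
  apply: (@moment_regular_prod [:: J; [:: a]]) => [|t y]; rewrite /= ?J0 ?J4//.
  by rewrite /score_monomial !big_cons big_nil mulr1.
have maJ : moment_regular (fun t y => partials (a :: J) (l y) t).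
  apply: (@moment_regular_prod [:: a :: J]) => [|t y]; first by rewrite /= andbT ltnS.
  by rewrite /score_monomial big_seq1.
have : \forall t \near theta0, partial a (fun t => E t (fun y => partials J (l y) t)) t =
    E t (fun y => partials J (l y) t * partial a (l y) t + partials (a :: J) (l y) t).
  apply: (@expect_partial (fun t y => partials J (l y) t)
    (fun t y => partials J (l y) t * partial a (l y) t + partials (a :: J) (l y) t) a _ mJ).
  - have d0 := @partials_diff [:: a] isT.
    have dJ := @partials_diff J (@leq_ltn_trans 3 _ 5 J3 isT).
    have daJ := @partials_diff (a :: J) (J3 : (size (a :: J) < 5)%N).
    near=> t.
    have dJt' : forall y, differentiable (partials J (l y)) t by near: t.
    have dat' : forall y, differentiable (partial a (l y)) t by near: t.
    have daJt' : forall y, differentiable (partials (a :: J) (l y)) t by near: t.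
    move=> y; have dJt := dJt' y; have dat := dat' y; have daJt := daJt' y.
    split; [exact: dJt|split; last by []].
    have c1 := differentiable_continuous dJt.
    have c2 := differentiable_continuous dat.
    have c3 := differentiable_continuous daJt.
    exact: (cvgD (cvgM c1 c2) c3).
  - exact: moment_regularD.
  - have -> : (fun t y => (partials J (l y) t * partial a (l y) t + partials (a :: J) (l y) t) ^+ 2) =
      (fun t y => ((score_monomial p [:: J; J; [:: a]; [:: a]] t y +
         score_monomial p [:: J; [:: a]; a :: J] t y) +
         score_monomial p [:: J; [:: a]; a :: J] t y) +
         score_monomial p [:: a :: J; a :: J] t y).
      apply/funext => t; apply/funext => y; rewrite /score_monomial !big_cons !big_nil.
      rewrite -[partials [:: a] (l y) t]/(partial a (l y) t).
      by move: (partials J _ _) (partial a _ _) (partials (a :: J) _ _) => u v z; ring.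
    have k1 : moment_regular (score_monomial p [:: J; J; [:: a]; [:: a]]).
      by apply: moment_regular_monomial; rewrite /= J0 J4.
    have k2 : moment_regular (score_monomial p [:: J; [:: a]; a :: J]).
      by apply: moment_regular_monomial; rewrite /= J0 J4 ltnS J3.
    have k3 : moment_regular (score_monomial p [:: a :: J; a :: J]).
      by apply: moment_regular_monomial; rewrite /= ltnS J3.
    exact: (moment_regularD (moment_regularD (moment_regularD k1 k2) k2) k3).
move=> h; near=> t.
have -> : partial a (fun t => E t (fun y => partials J (l y) t)) t =
    E t (fun y => partials J (l y) t * partial a (l y) t + partials (a :: J) (l y) t).
  by near: t.
have [i1 _] : mu.-integrable setT (EFin \o (fun y => p y t * (partials J (l y) t * partial a (l y) t))) /\
    {for t, continuous (fun t => E t (fun y => partials J (l y) t * partial a (l y) t))} by near: t.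
have [i2 _] : mu.-integrable setT (EFin \o (fun y => p y t * partials (a :: J) (l y) t)) /\
    {for t, continuous (fun t => E t (fun y => partials (a :: J) (l y) t))} by near: t.
by rewrite /expect -RintegralD//; apply: eq_Rintegral => y _; rewrite mulrDr.
Unshelve. all: by end_near. Qed.

(** Differentiate the total mass, which is 1 near theta0. *)
Lemma expect_score : forall a, \forall t \near theta0, E t (fun y => partial a (l y) t) = 0.
Proof.
move=> a.
have nT := Theta_theta0.
have E1 : \forall t \near theta0, E t (fun=> 1) = 1.
  apply: filterS nT => t Tt; have [_ _ p1] := p_density Tt.
  by rewrite /expect /Rintegral; under eq_integral do rewrite mulr1; rewrite p1.
have E1' := near_join E1.
have maJ : moment_regular (fun t y => partials [:: a] (l y) t).
  by apply: (@moment_regular_prod [:: [:: a]]) => [//|t y]; rewrite /score_monomial big_seq1.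
have m1 : moment_regular (fun _ _ => 1).
  near=> t; split; last first.
    have nE : \forall s \near t, E s (fun=> 1) = cst 1 s by near: t.
    have nE' : \forall s \near t, cst 1 s = E s (fun=> 1) by apply: filterS nE => s ->.
    rewrite /prop_for /continuous_at (nbhs_singleton nE).
    by move=> A /(@cst_continuous 'rV[R]_d R 1 t); apply: (near_eq_cvg nE').
  have Tt : Theta t by near: t.
  have [mp pp p1] := p_density Tt.
  have ip : mu.-integrable setT (EFin \o p^~ t).
    apply/integrableP; split; first exact/measurable_EFinP.
    have -> : (\int[mu]_y `|(EFin \o p^~ t) y| = \int[mu]_y (p y t)%:E)%E.
      by apply: eq_integral => y _ /=; rewrite ger0_norm.
    by rewrite p1 ltry.
  by apply: eq_integrable ip => // y _; rewrite /= mulr1.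
have h : \forall t \near theta0, partial a (fun t => E t (fun=> 1)) t =
    E t (fun y => partials [:: a] (l y) t).
  apply: (@expect_partial (fun _ _ => 1) (fun t y => partials [:: a] (l y) t) a _ m1 maJ).
  - have d0 := @partials_diff [:: a] isT.
    near=> t => y; split; last split.
    + exact: differentiable_cst.
    + by apply: differentiable_continuous; move: y; near: t.
    + by rewrite mul1r /partial derive_cst addr0.
  - apply: (@moment_regular_prod [:: [:: a]; [:: a]]) => [//|t y].
    by rewrite /score_monomial !big_cons big_nil mulr1 expr2.
near=> t.
have <- : partial a (fun t => E t (fun=> 1)) t = E t (fun y => partials [:: a] (l y) t).
  by near: t.
rewrite (@near_eq_partial _ _ _ (cst 1)); last by near: t.
exact: derive_cst.
Unshelve. all: by end_near. Qed.

Definition mean_third (a c e : 'I_d) (t : 'rV[R]_d) : R := E t (fun y => partials [:: a; c; e] (l y) t).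

Lemma fisherE t b c :
  fisher mu p t b c = E t (fun y => partial b (l y) t * partial c (l y) t).
Proof. by rewrite mxE. Qed.

Let near_forall2 (Q : 'I_d -> 'I_d -> 'rV[R]_d -> Prop) :
  (forall b c, \forall t \near theta0, Q b c t) ->
  \forall t \near theta0, forall b c, Q b c t.
Proof.
move=> h.
have h1 b : \forall t \near theta0, forall c, Q b c t.
  exact: (@filter_forall 'rV[R]_d 'I_d (fun c t => Q b c t) (nbhs theta0) _ (h b)).
exact: (@filter_forall 'rV[R]_d 'I_d (fun b t => forall c, Q b c t) (nbhs theta0) _ h1).
Qed.

(** Second Bartlett identity, obtained by differentiating the expected score. It is
    needed on a whole neighbourhood of theta0 in order to be differentiated once
    more. *)
Lemma fisher_second b c : \forall t \near theta0,
  fisher mu p t b c = - E t (fun y => partials [:: b; c] (l y) t).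
Proof.
have h := expect_partial_partials b (isT : (0 < size [:: c] <= 3)%N).
have s0 := near_join (expect_score c).
near=> t.
have : partial b (fun t => E t (fun y => partials [:: c] (l y) t)) t =
    E t (fun y => partials [:: c] (l y) t * partial b (l y) t) +
    E t (fun y => partials [:: b; c] (l y) t) by near: t.
rewrite (@near_eq_partial _ _ _ (cst 0)); last by near: t.
rewrite /partial derive_cst => /esym/eqP; rewrite addr_eq0 => /eqP <-.
by rewrite fisherE; congr (expect _ _ _ _); apply/funext => y; rewrite [LHS]mulrC.
Unshelve. all: by end_near. Qed.

Lemma fisher_differentiable b c : \forall t \near theta0,
  differentiable (fun t => fisher mu p t b c) t.
Proof.
have hs : all (fun I : seq 'I_d => 0 < size I <= 4)%N [:: [:: b]; [:: c]] by [].
apply: filterS (p_moments hs) => t [_].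
suff -> : (fun t => fisher mu p t b c) =
  (fun t => E t (score_monomial p [:: [:: b]; [:: c]] t)) by [].
apply/funext => s; rewrite fisherE; congr (expect _ _ _ _); apply/funext => y.
by rewrite /score_monomial !big_cons big_nil mulr1.
Qed.

Lemma partial_fisher a b c : \forall t \near theta0,
  partial a (fun t => fisher mu p t b c) t =
   - econnection mu p t b c a - mean_third a b c t.
Proof.
have h := expect_partial_partials a (isT : (0 < size [:: b; c] <= 3)%N).
have s0 := near_join (fisher_second b c).
have dF := fisher_differentiable b c.
near=> t.
have : partial a (fun t => E t (fun y => partials [:: b; c] (l y) t)) t =
    E t (fun y => partials [:: b; c] (l y) t * partial a (l y) t) +
    E t (fun y => partials [:: a; b; c] (l y) t) by near: t.
have nF : \forall s \near t, fisher mu p s b c = - E s (fun y => partials [:: b; c] (l y) s).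
  by near: t.
rewrite (@near_eq_partial _ _ _ (fun s => -1 * fisher mu p s b c)); last first.
  by apply: filterS nF => s ->; rewrite mulN1r opprK.
rewrite partialZ; last by near: t.
rewrite mulN1r -/(econnection mu p t b c a) -/(mean_third a b c t) => /(congr1 -%R).
by rewrite opprK opprD.
Unshelve. all: by end_near. Qed.

Hypothesis fisher_pd : positive_definite (fisher mu p theta0).

(** By Jacobi's formula d_a log pi_J is one half of g^{bc} d_a g_{bc}, and
    d_a g_{bc} = - Gamma_{bca} - E[d_a d_b d_c log p]; the connection terms
    cancel. *)
Lemma matching_fieldE a : \forall t \near theta0,
  matching_field mu p a t =
  - (2^-1 * \sum_c \sum_e invmx (fisher mu p t) c e * mean_third a c e t).
Proof.
have dF : \forall t \near theta0, forall b c, differentiable (fun t => fisher mu p t b c) t.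
  exact: (near_forall2 fisher_differentiable).
have pF : \forall t \near theta0, forall b c, partial a (fun t => fisher mu p t b c) t =
   - econnection mu p t b c a - mean_third a b c t.
  exact: (near_forall2 (partial_fisher a)).
have det0 : 0 < \det (fisher mu p theta0) by exact: positive_definite_det_gt0.
have detp : \forall t \near theta0, 0 < \det (fisher mu p t).
  have cdet : {for theta0, continuous (fun t => \det (fisher mu p t))}.
    apply: continuous_det => b c; apply: differentiable_continuous.
    by move: b c; exact: nbhs_singleton dF.
  by move/cvgr_gt : cdet; exact.
have detp' := near_join detp.
near=> t.
have Dt : 0 < \det (fisher mu p t) by near: t.
have dFt : forall b c, differentiable (fun t => fisher mu p t b c) t by near: t.
have pFt : forall b c, partial a (fun t => fisher mu p t b c) t =
   - econnection mu p t b c a - mean_third a b c t by near: t.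
have Dn : \forall s \near t, 0 < \det (fisher mu p s) by near: t.
rewrite /matching_field.
rewrite (@near_eq_partial _ _ _ (fun s => 2^-1 * ln (\det (fisher mu p s)))); last first.
  apply: filterS Dn => s Ds; rewrite /jeffreys.
  rewrite -{2}(sqr_sqrtr (ltW Ds)) lnXn ?sqrtr_gt0//.
  by rewrite -[ln _ *+ 2]mulr_natl mulrA mulVf ?mul1r// pnatr_eq0.
have ddet : differentiable (fun s => \det (fisher mu p s)) t.
  rewrite /determinant; apply: differentiable_bigsum => s.
  apply: differentiableM; first exact: differentiable_cst.
  by apply: differentiable_bigprod.
rewrite partialZ; last exact: differentiable_ln.
rewrite partial_ln// partial_det// -mulrN -mulrDr; congr (_ * _).
have symF : (fisher mu p t)^T = fisher mu p t.
  apply/matrixP => i j; rewrite mxE !fisherE; congr (expect _ _ _ _).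
  by apply/funext => y; rewrite [LHS]mulrC.
have invS i j : invmx (fisher mu p t) i j = invmx (fisher mu p t) j i.
  by rewrite -{1}symF -trmx_inv mxE.
rewrite big_distrl/= -big_split/= -sumrN; apply: eq_bigr => i _.
rewrite big_distrl/= -big_split/= -sumrN; apply: eq_bigr => j _.
rewrite pFt invS invmxE ?gt_eqF//.
rewrite -mulrA; move: (cofactor _ _ _ / _) (econnection _ _ _ _ _ _)
  (mean_third _ _ _ _) => q G L; ring.
Unshelve. all: by end_near. Qed.

(** The right-hand side of the previous identity, unlike the matching field itself,
    involves no derivative of an expectation, and is visibly continuous. *)
Lemma matching_field_cvg a :
  matching_field mu p a @ theta0 -->
  - (2^-1 * \sum_c \sum_e invmx (fisher mu p theta0) c e * mean_third a c e theta0).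
Proof.
have cdet b c : {for theta0, continuous (fun t => fisher mu p t b c)}.
  by apply: differentiable_continuous; exact: nbhs_singleton (fisher_differentiable b c).
have det0 : 0 < \det (fisher mu p theta0) by exact: positive_definite_det_gt0.
have h : {for theta0, continuous (fun t =>
    - (2^-1 * \sum_c \sum_e invmx (fisher mu p t) c e * mean_third a c e t))}.
  have hs : {for theta0, continuous (fun t =>
      \sum_c \sum_e invmx (fisher mu p t) c e * mean_third a c e t)}.
    apply: continuous_bigsum => c; apply: continuous_bigsum => e.
    have ci : {for theta0, continuous (fun t => invmx (fisher mu p t) c e)}.
      by apply: (@continuous_invmx R _ d (fisher mu p)); rewrite ?gt_eqF.
    have mJ : moment_regular (fun t y => partials [:: a; c; e] (l y) t).
      by apply: (@moment_regular_prod [:: [:: a; c; e]]) => [//|t y]; rewrite /score_monomial big_seq1.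
    have [_ cm] := nbhs_singleton mJ.
    exact: (cvgM ci cm).
  exact: (cvgN (cvgM (@cst_continuous _ _ (2^-1 : R) theta0) hs)).
have nE := matching_fieldE a.
have nE' : \forall t \near theta0,
  - (2^-1 * \sum_c \sum_e invmx (fisher mu p t) c e * mean_third a c e t) =
  matching_field mu p a t by apply: filterS nE => t ->.
by move=> A /h; apply: (near_eq_cvg nE').
Qed.

End matching_field_limit.

(** * Taylor expansions and a smooth cut-off *)

Section score_expansion.
Context {R : realType} {d : nat}.
Implicit Types (l : 'rV[R]_d -> R) (x y : 'rV[R]_d).

Lemma norm_sum_le (c x : 'I_d -> R) (K X : R) : 0 <= K -> 
  (forall a, `|c a| <= K) -> (forall a, `|x a| <= X) ->
  `|\sum_a c a * x a| <= d%:R * (K * X).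
Proof.
move=> K0 cK xX; apply: (le_trans (ler_norm_sum _ _ _)).
apply: (@le_trans _ _ (\sum_(a < d) K * X)).
  by apply: ler_sum => a _; rewrite normrM ler_pM.
by rewrite sumr_const card_ord mulr_natl.
Qed.

(** The mean value theorem along the segment, with the derivatives close to a fixed
    vector g rather than to their values at x: this is how the law of large numbers
    provides them. *)
Lemma partial_expansion1 f (g : 'I_d -> R) z (r e : R) x y :
  (forall u, `|u - z| < r -> differentiable f u) ->
  (forall u b, `|u - z| < r -> `|partial b f u - g b| <= e) ->
  `|x - z| < r -> `|y - z| < r ->
  `|f y - f x - \sum_b (y - x) ord0 b * g b| <= d%:R * (`|y - x| * e).
Proof.
move=> df gf xr yr.
have [t t01|t /andP[t0 t1] ->] := @segment_MVT R d f x y.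
  by apply: df; exact: segment_in_ball.
rewrite -sumrB; under eq_bigr do rewrite -mulrBr.
apply: (@norm_sum_le (fun b => (y - x) ord0 b)
  (fun b => partial b f (x + t *: (y - x)) - g b)) => // b.
- exact: rV_coord_le_norm.
- by apply: gf; apply: segment_in_ball => //; rewrite !ltW.
Qed.

(** Along the segment, t |-> f - (linear term) - t^2 (quadratic term) has a derivative
    to which the first-order expansion of the gradient applies. The mean value
    theorem loses a factor 2 against Taylor's formula. *)
Lemma partial_expansion2 f (L : 'I_d -> 'I_d -> R) z (r e : R) x y : 0 <= e ->
  (forall u, `|u - z| < r -> differentiable f u) ->
  (forall u b, `|u - z| < r -> differentiable (partial b f) u) ->
  (forall u c b, `|u - z| < r -> `|partial c (partial b f) u - L c b| <= e) ->
  `|x - z| < r -> `|y - z| < r ->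
  `|f y - f x - \sum_b (y - x) ord0 b * partial b f x
    - 2^-1 * \sum_b (y - x) ord0 b * (\sum_c (y - x) ord0 c * L c b)|
   <= d%:R * (`|y - x| * (d%:R * (`|y - x| * e))).
Proof.
move=> e0 df ddf Lf xr yr.
set h := y - x.
pose S1 := \sum_b h ord0 b * partial b f x.
pose S2 := \sum_b h ord0 b * (\sum_c h ord0 c * L c b).
pose w (t : R) := f (x + t *: h) - t * S1 - t ^+ 2 * (2^-1 * S2).
pose dw (t : R) := \sum_b h ord0 b * partial b f (x + t *: h) - S1 - t * S2.
have inr (t : R) : 0 <= t <= 1 -> `|x + t *: h - z| < r by move=> t01; exact: segment_in_ball.
have dwE (t : R) : 0 <= t <= 1 -> is_derive t 1 w (dw t).
  move=> t01; have dl := is_derive_line (df _ (inr _ t01)).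
  have dS : is_derive t 1 (id * cst S1 : R -> R) S1.
    apply: (is_derive_eq (is_deriveM (is_derive_id t 1) (is_derive_cst S1 t 1))).
    by rewrite /GRing.scale/= mulr0 add0r mulr1.
  have dQ : is_derive t 1 (id * id * cst (2^-1 * S2) : R -> R) (t * S2).
    apply: (is_derive_eq (is_deriveM (is_deriveM (is_derive_id t 1) (is_derive_id t 1))
       (is_derive_cst (2^-1 * S2) t 1))).
    rewrite /GRing.scale/= mulr0 add0r !mulr1.
    by field.
  exact: (is_deriveB (is_deriveB dl dS) dQ).
have [||t] := @MVT R w dw 0 1 ltr01.
- by move=> t; rewrite in_itv/= => /andP[t0 t1]; apply: dwE; rewrite !ltW.
- apply: derivable_within_continuous => t; rewrite in_itv/= => t01.
  exact: (@ex_derive _ _ _ _ _ _ _ (dwE _ t01)).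
rewrite in_itv/= => /andP[t0 t1]; have t01 : 0 <= t <= 1 by rewrite !ltW.
have -> : w 1 - w 0 = f y - f x - S1 - 2^-1 * S2.
  rewrite /w scale1r scale0r addr0 !mul0r expr0n/= mul0r !subr0 expr1n !mul1r.
  by rewrite /h [x + _]addrC subrK; ring.
rewrite subr0 mulr1 => ->.
have -> : dw t = \sum_b h ord0 b * (partial b f (x + t *: h) - partial b f x
    - \sum_c (x + t *: h - x) ord0 c * L c b).
  rewrite /dw /S1 /S2 big_distrr/= -!sumrB; apply: eq_bigr => b _.
  have -> : \sum_c (x + t *: h - x) ord0 c * L c b = t * \sum_c h ord0 c * L c b.
    rewrite big_distrr/=; apply: eq_bigr => c _; rewrite addrAC subrr add0r mxE.
    by rewrite mulrA.
  by move: (partial b f _) (partial b f x) (\sum_c _) (h _ _) => A B D E; ring.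
apply: norm_sum_le => // b; first exact: rV_coord_le_norm.
apply: le_trans (@partial_expansion1 (partial b f) (fun c => L c b) z r e x _ _ _ _ _) _ => //.
- by move=> u; exact: ddf.
- by move=> u c; exact: Lf.
- exact: inr.
- rewrite ler_wpM2l// ler_wpM2r//.
  exact: segment_in_sub_ball.
Qed.

End score_expansion.

Section cutoff.
Context {R : realType}.

(** The square makes this positive part continuously differentiable, which is all the
    smoothness needed of a cut-off for one integration by parts. *)
Definition sqpos (x : R) : R := Num.max x 0 ^+ 2.

Lemma sqpos_ge0 x : 0 <= sqpos x. Proof. exact: sqr_ge0. Qed.

Lemma sqpos_le0 x : x <= 0 -> sqpos x = 0.
Proof. by move=> x0; rewrite /sqpos max_r// expr0n. Qed.

Lemma sqpos_ge0E x : 0 <= x -> sqpos x = x ^+ 2.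
Proof. by move=> x0; rewrite /sqpos max_l. Qed.

Lemma is_derive_sqpos (x : R) : is_derive x 1 sqpos (2 * Num.max x 0).
Proof.
have [x0|x0|->] := ltgtP x 0.
- rewrite mulr0.
  apply: (@near_eq_is_derive _ _ _ (cst 0)) => //.
  by near=> z; rewrite sqpos_le0// ltW//; near: z; exact: lt_nbhsl.
- apply: (@near_eq_is_derive _ R R (id * id) sqpos).
    near=> z; rewrite sqpos_ge0E//; apply: ltW.
    by near: z; exact: lt_nbhsr.
  apply: (is_derive_eq (is_deriveM (is_derive_id x 1) (is_derive_id x 1))).
  by rewrite /GRing.scale/= !mulr1 mulr_natl.
- rewrite ?maxxx mulr0.
  have h : (fun h : R => h^-1 *: ((sqpos \o shift 0) (h *: 1) - sqpos 0)) @ 0^' --> (0 : R).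
    apply/cvgrPdist_le => e e0; near=> t.
    rewrite /= sub0r normrN addr0 [_ *: 1]mulr1 (sqpos_le0 (lexx 0)) subr0 normrM.
    have t0 : t != 0 by near: t; exact: nbhs_dnbhs_neq.
    have te : `|t| <= e.
      near: t; apply: nbhs_dnbhs; have := @norm_continuous _ R 0 => /cvgr_le; apply.
      by rewrite normr0.
    rewrite normfV ler_pdivrMl ?normr_gt0//.
    apply: (@le_trans _ _ (`|t| * `|t|)); last by rewrite ler_wpM2l.
    rewrite ger0_norm ?sqpos_ge0// /sqpos -expr2 real_normK ?num_real//.
    by have [tp|tn] := leP t 0; rewrite // expr0n sqr_ge0.
  apply: DeriveDef; first by apply/cvg_ex; exists 0.
  exact/cvg_lim.
Unshelve. all: by end_near. Qed.

Lemma continuous_sqpos' : continuous (fun x : R => 2 * Num.max x 0).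
Proof.
move=> x; apply: cvgM; first exact: cvg_cst.
apply: (@continuous_max _ _ id (cst 0)); [exact: cvg_id|exact: cvg_cst].
Qed.

Variables (d : nat) (theta0 : 'rV[R]_d) (r : R).
Hypothesis r0 : 0 < r.

Definition bump_arg (v : 'rV[R]_d) : R := 1 - (4 / r ^+ 2) * \sum_i
  (sqpos (v ord0 i - theta0 ord0 i - r / 2) + sqpos (theta0 ord0 i - v ord0 i - r / 2)).

(** The argument equals 1 exactly when each coordinate is within r/2 of that of theta0,
    and is at most 0 as soon as one of them is at distance r or more, because then one term of
    the sum is at least r^2/4. *)
Definition bump (v : 'rV[R]_d) : R := sqpos (bump_arg v).

Let c0 : 0 < 4 / r ^+ 2.
Proof. by rewrite divr_gt0// exprn_gt0. Qed.

Lemma bump_arg_le1 v : bump_arg v <= 1.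
Proof.
rewrite /bump_arg lerBlDr lerDl; apply: mulr_ge0; first exact: ltW.
by apply: sumr_ge0 => i _; rewrite addr_ge0// sqpos_ge0.
Qed.

Lemma bump_ge0 v : 0 <= bump v. Proof. exact: sqpos_ge0. Qed.

Lemma bump_le1 v : bump v <= 1.
Proof.
have := bump_arg_le1 v; rewrite /bump /sqpos => h.
by rewrite -(expr1n _ 2) ler_pXn2r// ?nnegrE// ?le_max ?lexx ?orbT// ge_max h ler01.
Qed.

Lemma bump1 v : `|v - theta0| <= r / 2 -> bump v = 1.
Proof.
move=> h; have vi i : `|v ord0 i - theta0 ord0 i| <= r / 2.
  by have := le_trans (rV_coord_le_norm (v - theta0) i) h; rewrite !mxE.
rewrite /bump /bump_arg big1 ?mulr0 ?subr0 ?sqpos_ge0E ?expr1n// => i _.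
have := vi i; rewrite ler_norml => /andP[h1 h2].
by rewrite !sqpos_le0 ?addr0//; lra.
Qed.

Lemma bump0 v : r <= `|v - theta0| -> bump v = 0.
Proof.
move=> h; rewrite /bump sqpos_le0//.
have [i vi] : exists i, r <= `|v ord0 i - theta0 ord0 i|.
  apply: contrapT => /forallNP hn; move: h; rewrite leNgt => /negP; apply.
  have [E|[i0 vi0]] : v - theta0 = 0 \/ exists i, `|v - theta0| = `|(v - theta0) ord0 i|.
    have [->|] := eqVneq (v - theta0) 0; first by left.
    rewrite -normr_eq0 => nz; right.
    have [[k i] E] := mx_norm_neq0 nz; exists i.
    by rewrite [LHS]E /= (ord1 k).
    by rewrite E normr0.
  by rewrite vi0 !mxE ltNge; apply/negP; exact: hn.
have S i' : 0 <= sqpos (v ord0 i' - theta0 ord0 i' - r / 2) + sqpos (theta0 ord0 i' - v ord0 i' - r / 2).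
  by rewrite addr_ge0// sqpos_ge0.
have Si : r ^+ 2 / 4 <= sqpos (v ord0 i - theta0 ord0 i - r / 2) + sqpos (theta0 ord0 i - v ord0 i - r / 2).
  have q (x : R) : r / 2 <= x -> r ^+ 2 / 4 <= sqpos x.
    move=> rx; rewrite sqpos_ge0E; last by apply: le_trans rx; rewrite divr_ge0// ltW.
    have -> : r ^+ 2 / 4 = (r / 2) ^+ 2 by field.
    by rewrite ler_pXn2r ?nnegrE// ?divr_ge0 ?ltW// (lt_le_trans _ rx)// divr_gt0.
  have := sqpos_ge0 (v ord0 i - theta0 ord0 i - r / 2).
  have := sqpos_ge0 (theta0 ord0 i - v ord0 i - r / 2).
  have [vp|vn] := leP 0 (v ord0 i - theta0 ord0 i).
    by rewrite ger0_norm// in vi; move=> s1 _; rewrite -[leLHS]addr0 lerD// q//; lra.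
  rewrite ltr0_norm// in vi; move=> _ s1; rewrite -[leLHS]add0r lerD// q//; lra.
rewrite /bump_arg subr_le0 -(@ler_pdivrMl _ (4 / r ^+ 2))// mulr1 invf_div.
rewrite (bigD1 i)//=; apply: (le_trans Si); rewrite lerDl.
by apply: sumr_ge0 => j _.
Qed.

Lemma differentiable_coord1 (i : 'I_d) (v : 'rV[R]_d) :
  differentiable (fun v : 'rV[R]_d => v ord0 i) v.
Proof. exact: differentiable_coord. Qed.

Lemma differentiable_bump_arg v : differentiable bump_arg v.
Proof.
apply: differentiableB; first exact: differentiable_cst.
apply: differentiableM; first exact: differentiable_cst.
apply: differentiable_bigsum => i; apply: differentiableD.
  apply: (@differentiable_comp1 _ _ sqpos); first exact: (@ex_derive _ _ _ _ _ _ _ (is_derive_sqpos _)).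
  by do 2 (apply: differentiableB; last exact: differentiable_cst); exact: differentiable_coord1.
apply: (@differentiable_comp1 _ _ sqpos); first exact: (@ex_derive _ _ _ _ _ _ _ (is_derive_sqpos _)).
apply: differentiableB; last exact: differentiable_cst.
by apply: differentiableB; [exact: differentiable_cst|exact: differentiable_coord1].
Qed.

Lemma differentiable_bump v : differentiable bump v.
Proof.
apply: (@differentiable_comp1 _ _ sqpos).
  exact: (@ex_derive _ _ _ _ _ _ _ (is_derive_sqpos _)).
exact: differentiable_bump_arg.
Qed.

Lemma partial_coord (a i : 'I_d) (v : 'rV[R]_d) :
  partial a (fun v : 'rV[R]_d => v ord0 i) v = (i == a)%:R.
Proof.
have E : v = v + 0 *: delta_mx ord0 a by rewrite scale0r addr0.
rewrite {1}E -partial_line.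
have -> : (fun t : R => (v + t *: delta_mx ord0 a) ord0 i) =
    (cst (v ord0 i) + id * cst (i == a)%:R : R -> R).
  by apply/funext => t; rewrite !mxE eqxx.
have := is_deriveD (is_derive_cst (v ord0 i) (0 : R) 1)
  (is_deriveM (is_derive_id (0 : R) 1) (is_derive_cst ((i == a)%:R : R) (0 : R) 1)).
move=> h; rewrite (@derive_val _ _ _ _ _ _ _ h).
by rewrite /GRing.scale/= !mul0r !add0r mulr1.
Qed.

Let partial_sqpos (f : 'rV[R]_d -> R) v a : differentiable f v ->
  partial a (sqpos \o f) v = 2 * Num.max (f v) 0 * partial a f v.
Proof.
move=> df; rewrite partial_comp1//; last exact: (@ex_derive _ _ _ _ _ _ _ (is_derive_sqpos _)).
by rewrite derive1E (@derive_val _ _ _ _ _ _ _ (is_derive_sqpos _)).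
Qed.

Let argp i (v : 'rV[R]_d) := v ord0 i - theta0 ord0 i - r / 2.
Let argm i (v : 'rV[R]_d) := theta0 ord0 i - v ord0 i - r / 2.

Let dargp i v : differentiable (argp i) v.
Proof.
by do 2 (apply: differentiableB; last exact: differentiable_cst); exact: differentiable_coord1.
Qed.

Let dargm i v : differentiable (argm i) v.
Proof.
apply: differentiableB; last exact: differentiable_cst.
by apply: differentiableB; [exact: differentiable_cst|exact: differentiable_coord1].
Qed.

Let pargp a i v : partial a (argp i) v = (i == a)%:R.
Proof.
have d1 := @differentiable_coord1 i v.
have dc (c : R) : differentiable (cst c : 'rV[R]_d -> R) v by exact: differentiable_cst.
rewrite /argp (@partialB _ _ (fun v : 'rV[R]_d => v ord0 i - theta0 ord0 i) (cst (r / 2)))//; last first.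
  exact: differentiableB.
rewrite (@partialB _ _ (fun v : 'rV[R]_d => v ord0 i) (cst (theta0 ord0 i)))//.
by rewrite partial_coord /partial !derive_cst !subr0.
Qed.

Let pargm a i v : partial a (argm i) v = - (i == a)%:R.
Proof.
have d1 := @differentiable_coord1 i v.
have dc (c : R) : differentiable (cst c : 'rV[R]_d -> R) v by exact: differentiable_cst.
rewrite /argm (@partialB _ _ (fun v : 'rV[R]_d => theta0 ord0 i - v ord0 i) (cst (r / 2)))//; last first.
  exact: differentiableB.
rewrite (@partialB _ _ (cst (theta0 ord0 i)) (fun v : 'rV[R]_d => v ord0 i))//.
by rewrite partial_coord /partial !derive_cst subr0 sub0r.
Qed.

Lemma partial_bump a v : partial a bump v = 2 * Num.max (bump_arg v) 0 *
  - (4 / r ^+ 2 * \sum_i (2 * Num.max (argp i v) 0 * (i == a)%:R +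
      2 * Num.max (argm i v) 0 * - (i == a)%:R)).
Proof.
have ds (f : 'rV[R]_d -> R) : differentiable f v -> differentiable (sqpos \o f) v.
  move=> df; apply: (@differentiable_comp1 _ _ sqpos) => //.
  exact: (@ex_derive _ _ _ _ _ _ _ (is_derive_sqpos _)).
have dc (c : R) : differentiable (cst c : 'rV[R]_d -> R) v by exact: differentiable_cst.
have dS i : differentiable (fun v => (sqpos \o argp i) v + (sqpos \o argm i) v) v.
  by apply: differentiableD; apply: ds.
rewrite (@partial_sqpos bump_arg); last exact: differentiable_bump_arg.
congr (_ * _).
rewrite (@partialB _ _ (cst 1) (fun v => (4 / r ^+ 2) *
   \sum_i ((sqpos \o argp i) v + (sqpos \o argm i) v)))//; last first.
  by apply: differentiableM => //; exact: differentiable_bigsum.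
rewrite {1}/partial derive_cst sub0r partialZ; last exact: differentiable_bigsum.
rewrite partial_bigsum//; congr (- (_ * _)); apply: eq_bigr => i _.
by rewrite partialD ?partial_sqpos ?pargp ?pargm//; apply: ds.
Qed.

Lemma continuous_partial_bump a : continuous (partial a bump).
Proof.
move=> v; have -> : partial a bump = fun v => 2 * Num.max (bump_arg v) 0 *
  - (4 / r ^+ 2 * \sum_i (2 * Num.max (argp i v) 0 * (i == a)%:R +
      2 * Num.max (argm i v) 0 * - (i == a)%:R)).
  by apply/funext => u; exact: partial_bump.
have cs (f : 'rV[R]_d -> R) : differentiable f v ->
    {for v, continuous (fun v => 2 * Num.max (f v) 0)}.
  move=> df; apply: (@continuous_comp _ _ _ f (fun x => 2 * Num.max x 0)).
    exact: differentiable_continuous.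
  exact: continuous_sqpos'.
have cc (c : R) : {for v, continuous (cst c : 'rV[R]_d -> R)} by exact: cst_continuous.
have h : {for v, continuous (fun v => \sum_i (2 * Num.max (argp i v) 0 * (i == a)%:R +
      2 * Num.max (argm i v) 0 * - (i == a)%:R))}.
  apply: continuous_bigsum => i.
  exact: (cvgD (cvgM (cs _ (dargp i v)) (cc _)) (cvgM (cs _ (dargm i v)) (cc _))).
exact: (cvgM (cs _ (differentiable_bump_arg v)) (cvgN (cvgM (cc _) h))).
Qed.

End cutoff.

(** * The localized posterior and its integration by parts identity *)

Section localized_posterior.
Context {R : realType} {d : nat}.
Variables (Theta : set 'rV[R]_d) (theta0 : 'rV[R]_d) (r : R) (q v : 'rV[R]_d -> R).
Hypotheses (r0 : 0 < r) (mTheta : measurable Theta)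
  (ballTheta : forall t, `|t - theta0| < 2 * r -> Theta t)
  (qE : forall t, `|t - theta0| < 2 * r -> q t = expR (v t))
  (dv : forall t, `|t - theta0| < 2 * r -> differentiable v t)
  (cv : forall t a, `|t - theta0| < 2 * r -> {for t, continuous (partial a v)}).
Hypotheses (iq : (lebesgue_rV d).-integrable Theta (EFin \o q))
  (q0 : forall t, Theta t -> 0 <= q t).
Hypothesis iq1 : forall a : 'I_d,
  (lebesgue_rV d).-integrable Theta (EFin \o (fun t : 'rV[R]_d => t ord0 a * q t)).
Let Z := \int[lebesgue_rV d]_(t in Theta) q t.
Hypothesis Z0 : 0 < Z.
Let phi := bump theta0 r.
Local Notation leb := (lebesgue_rV d).

(** The cut-off vanishes outside the ball of radius r; continuity on a larger ball
    makes products with it continuous on the whole space. *)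
Definition cont_on_ball (g : 'rV[R]_d -> R) : Prop :=
  forall t, `|t - theta0| < 2 * r -> {for t, continuous g}.

Let cdist t : {for t, continuous (fun s : 'rV[R]_d => `|s - theta0|)}.
Proof.
have h : {for t, continuous (fun s : 'rV[R]_d => s - theta0)}.
  by apply: differentiable_continuous; exact: differentiableB.
exact: (continuous_comp h (@norm_continuous _ _ (t - theta0))).
Qed.

Lemma cont_on_ballD g h : cont_on_ball g -> cont_on_ball h -> cont_on_ball (fun t => g t + h t).
Proof. by move=> cg ch t ht; exact: (cvgD (cg t ht) (ch t ht)). Qed.

Lemma cont_on_ballM g h : cont_on_ball g -> cont_on_ball h -> cont_on_ball (fun t => g t * h t).
Proof. by move=> cg ch t ht; exact: (cvgM (cg t ht) (ch t ht)). Qed.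

Lemma cont_on_ball_cst (c : R) : cont_on_ball (fun=> c).
Proof. by move=> t ht; exact: cst_continuous. Qed.

Let near_in t : `|t - theta0| < 2 * r -> \forall s \near t, `|s - theta0| < 2 * r.
Proof.
move=> h; have c := @cdist t.
by move/cvgr_lt : c; exact.
Qed.

Let near_out t : r < `|t - theta0| -> \forall s \near t, r < `|s - theta0|.
Proof.
move=> h; have c := @cdist t.
by move/cvgr_gt : c; exact.
Qed.

Let r2 : r < 2 * r. Proof. by rewrite mulr_natl mulr2n ltrDl. Qed.

Let r42 : r / 4 < r / 2.
Proof. by rewrite ltr_pM2l// ltf_pV2 ?posrE ?ltr_nat. Qed.

Let in_or_out t : `|t - theta0| < 2 * r \/ r < `|t - theta0|.
Proof. by have [h|h] := ltP `|t - theta0| (2 * r); [left|right; exact: lt_le_trans r2 h]. Qed.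

Let continuous_near_eq (g h : 'rV[R]_d -> R) t : (\forall s \near t, g s = h s) ->
  {for t, continuous g} -> {for t, continuous h}.
Proof.
move=> nE cg; rewrite /prop_for /continuous_at -(nbhs_singleton nE).
by move=> A /cg; apply: (near_eq_cvg nE).
Qed.

Lemma continuous_glue g : cont_on_ball g ->
  (forall t, r < `|t - theta0| -> g t = 0) -> continuous g.
Proof.
move=> cg g0 t; have [/cg//|/near_out h] := in_or_out t.
apply: (@continuous_near_eq (cst 0)); last exact: cst_continuous.
by apply: filterS h => s /g0 ->.
Qed.

Let far (t : 'rV[R]_d) : `|theta0| + 2 * r < `|t| -> 2 * r < `|t - theta0|.
Proof.
move=> h; rewrite -(ltrD2l `|theta0|); apply: (lt_le_trans h).
by rewrite -[in leLHS](subrKC theta0 t) ler_normD.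
Qed.

Let K0 : 0 <= `|theta0| + 2 * r.
Proof. by rewrite addr_ge0// mulr_ge0// ltW. Qed.

Lemma integrable_glue g : cont_on_ball g ->
  (forall t, r < `|t - theta0| -> g t = 0) -> leb.-integrable setT (EFin \o g).
Proof.
move=> cg g0; apply: (@integrable_compact_support_rV _ _ _ (`|theta0| + 2 * r)) => //.
  exact: continuous_glue.
by move=> t /far h; apply: g0; exact: lt_trans h.
Qed.

Let cq : cont_on_ball q.
Proof.
move=> t ht; apply: (@continuous_near_eq (fun s => expR (v s))).
  by apply: filterS (near_in ht) => s /qE.
apply: differentiable_continuous; exact/differentiable_expR/dv.
Qed.

Let phi_out t : r < `|t - theta0| -> phi t = 0.
Proof. by move=> h; apply: bump0 => //; exact: ltW. Qed.

Let dphi_out a t : r < `|t - theta0| -> partial a phi t = 0.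
Proof.
move=> h; rewrite (@near_eq_partial _ _ phi (cst 0)); first exact: derive_cst.
by apply: filterS (near_out h) => s /phi_out.
Qed.

Let dphi_in a t : `|t - theta0| <= r / 4 -> partial a phi t = 0.
Proof.
move=> h; rewrite (@near_eq_partial _ _ phi (cst 1)); first exact: derive_cst.
have : \forall s \near t, `|s - theta0| < r / 2.
  have c := @cdist t.
  by move/cvgr_lt : c; apply; exact: le_lt_trans h r42.
by apply: filterS => s hs; apply: bump1 => //; exact: ltW.
Qed.

Let cphi : cont_on_ball phi.
Proof. by move=> t _; apply: differentiable_continuous; exact: differentiable_bump. Qed.

Let cdphi a : cont_on_ball (partial a phi).
Proof. by move=> t _; exact: continuous_partial_bump. Qed.

Lemma integrable_loc g : cont_on_ball g ->
  leb.-integrable Theta (EFin \o (fun t => phi t * g t * q t)).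
Proof.
move=> cg; apply: (@integrableS _ _ _ _ setT) => //; apply: integrable_glue.
  exact: cont_on_ballM (cont_on_ballM cphi cg) cq.
by move=> t /phi_out ->; rewrite !mul0r.
Qed.

Lemma integrable_dloc a g : cont_on_ball g ->
  leb.-integrable Theta (EFin \o (fun t => partial a phi t * g t * q t)).
Proof.
move=> cg; apply: (@integrableS _ _ _ _ setT) => //; apply: integrable_glue.
  exact: cont_on_ballM (cont_on_ballM (@cdphi a) cg) cq.
by move=> t /dphi_out ->; rewrite !mul0r.
Qed.

(** The posterior expectation of g restricted by the cut-off: an honest expectation up
    to the total mass, which differs from 1 by a tail term. *)
Definition loc (g : 'rV[R]_d -> R) : R := (\int[leb]_(t in Theta) (phi t * g t * q t)) / Z.

Lemma locD g h : cont_on_ball g -> cont_on_ball h -> loc (fun t => g t + h t) = loc g + loc h.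
Proof.
move=> cg ch; rewrite /loc -mulrDl -RintegralD//; try exact: integrable_loc.
by congr (_ / _); apply: eq_Rintegral => t _; rewrite mulrDr mulrDl.
Qed.

Lemma locZ (c : R) g : cont_on_ball g -> loc (fun t => c * g t) = c * loc g.
Proof.
move=> cg; rewrite /loc mulrA -RintegralZl//; last exact: integrable_loc.
congr (_ / _); apply: eq_Rintegral => t _.
by move: (phi t) (g t) (q t) => A B D; ring.
Qed.

Lemma cont_on_ball_sum (I : finType) (g : I -> 'rV[R]_d -> R) :
  (forall i, cont_on_ball (g i)) -> cont_on_ball (fun t => \sum_i g i t).
Proof. by move=> cg t ht; apply: continuous_bigsum => i; exact: cg. Qed.

Lemma loc_sum (I : finType) (g : I -> 'rV[R]_d -> R) : (forall i, cont_on_ball (g i)) ->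
  loc (fun t => \sum_i g i t) = \sum_i loc (g i).
Proof.
move=> cg; suff h (s : seq I) : cont_on_ball (fun t => \sum_(i <- s) g i t) /\
    loc (fun t => \sum_(i <- s) g i t) = \sum_(i <- s) loc (g i) by have [] := h (index_enum I).
elim: s => [|i s [cs IH]].
  have -> : (fun t => \sum_(i <- [::]) g i t) = (fun=> 0) by apply/funext => t; rewrite big_nil.
  split; first exact: cont_on_ball_cst.
  rewrite big_nil /loc; under eq_Rintegral do rewrite mulr0 mul0r.
  by rewrite Rintegral_cst// !mul0r.
have -> : (fun t => \sum_(j <- i :: s) g j t) = (fun t => g i t + \sum_(j <- s) g j t).
  by apply/funext => t; rewrite big_cons.
by split; [exact: cont_on_ballD|rewrite locD// IH big_cons].
Qed.

Lemma loc_le g h : cont_on_ball g -> cont_on_ball h ->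
  (forall t, `|t - theta0| < r -> g t <= h t) -> loc g <= loc h.
Proof.
move=> cg ch gh; rewrite /loc ler_pM2r ?invr_gt0//; apply: le_Rintegral => //.
- exact: integrable_loc.
- exact: integrable_loc.
move=> t Tt; have [h'|h'] := ltP `|t - theta0| r.
  by rewrite ler_wpM2r ?q0// ler_wpM2l ?gh// bump_ge0.
by rewrite /phi bump0// !mul0r.
Qed.

Lemma loc_norm_le g h : cont_on_ball g -> cont_on_ball h ->
  (forall t, `|t - theta0| < r -> `|g t| <= h t) -> `|loc g| <= loc h.
Proof.
move=> cg ch gh; rewrite ler_norml; apply/andP; split.
  rewrite -mulN1r -locZ//; apply: loc_le => //.
    by apply: cont_on_ballM => //; exact: cont_on_ball_cst.
  by move=> t /gh; rewrite mulN1r ler_norml => /andP[].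
by apply: loc_le => // t /gh; rewrite ler_norml => /andP[].
Qed.

(** The first moment of the posterior far from theta0. The radius r/4 leaves room
    between the maximum likelihood estimate, to be within r/4 of theta0, and the region where
    the cut-off differs from 1. *)
Definition tail_moment : R :=
  \int[leb]_(t in outside theta0 Theta (r / 4)) (`|t - theta0| * (q t / Z)).

(** The integrand is d_a (phi h q), because q = exp v on the ball; its integral over
    the whole space vanishes, phi having compact support. *)
Lemma stein a h : (forall t, `|t - theta0| < 2 * r -> differentiable h t) ->
  cont_on_ball (partial a h) ->
  \int[leb]_(t in Theta) ((partial a phi t * h t +
     phi t * (partial a h t + h t * partial a v t)) * q t) = 0.
Proof.
move=> dh ch.
(* The value 0 outside the ball of radius 2 r makes F smooth everywhere. *)
pose F t := if `|t - theta0| < 2 * r then phi t * h t * expR (v t) else 0.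
pose K t := (partial a phi t * h t + phi t * (partial a h t + h t * partial a v t)) * q t.
have FF t : `|t - theta0| < 2 * r -> \forall s \near t, phi s * h s * expR (v s) = F s.
  by move=> /near_in; apply: filterS => s hs; rewrite /F hs.
have F0 t : r < `|t - theta0| -> F t = 0.
  by move=> /phi_out p0; rewrite /F p0 !mul0r; case: ifP.
have F0' t : r < `|t - theta0| -> \forall s \near t, cst 0 s = F s.
  by move=> /near_out; apply: filterS => s /F0.
have dphi t : differentiable phi t by exact: differentiable_bump.
have dF t : derivable F t (delta_mx ord0 a).
  have [ht|/F0' ht] := in_or_out t.
    apply: near_eq_derivable (FF t ht) _; apply: diff_derivable.
    apply: differentiableM; last exact/differentiable_expR/dv.
    by apply: differentiableM => //; exact: dh.
  by apply: near_eq_derivable ht _; exact: derivable_cst.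
have KE t : partial a F t = K t.
  have [ht|ht] := in_or_out t; last first.
    rewrite -(near_eq_partial a (F0' t ht)) /partial derive_cst /K.
    by rewrite phi_out// dphi_out// !mul0r add0r mul0r.
  have de : differentiable (fun s => expR (v s)) t by exact/differentiable_expR/dv.
  have dph : differentiable (fun s => phi s * h s) t by apply: differentiableM => //; exact: dh.
  rewrite -(near_eq_partial a (FF t ht)) (@partialM _ _ (fun s => phi s * h s))//.
  rewrite (@partialM _ _ phi h)//; last exact: dh.
  rewrite partial_expR; last exact: dv.
  rewrite /K qE//.
  move: (partial a phi t) (partial a h t) (partial a v t) (phi t) (h t) (expR (v t)).
  by move=> A B C D E G; ring.
have K_out t : r < `|t - theta0| -> K t = 0.
  by move=> ht; rewrite /K phi_out// dphi_out// !mul0r add0r mul0r.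
have cK : cont_on_ball K.
  have chh : cont_on_ball h by move=> t ht; apply: differentiable_continuous; exact: dh.
  apply: cont_on_ballM cq.
  apply: cont_on_ballD.
    exact: cont_on_ballM (@cdphi a) chh.
  apply: (cont_on_ballM cphi).
  apply: cont_on_ballD => //; apply: cont_on_ballM => // t ht; exact: cv.
have FK : partial a F = K by apply/funext => t; exact: KE.
have cF : continuous (partial a F) by rewrite FK; exact: continuous_glue.
have := @integral_partial_compact_support R d a F (`|theta0| + 2 * r) dF cF.
rewrite FK => h0.
rewrite -/(K _) Rintegral_mkcond.
have -> : ((fun t => K t) \_ Theta) = K.
  apply/funext => t; rewrite patchE; case: ifPn => // /negP nT.
  have [/ballTheta Tt|/K_out //] := in_or_out t.
  by exfalso; apply: nT; exact/mem_set.
rewrite /Rintegral h0// => t /far ht; apply: F0; exact: lt_trans ht.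
Qed.

Let measurable_outside : measurable (outside theta0 Theta (r / 4)).
Proof.
apply: measurableI => //.
have -> : [set t : 'rV[R]_d | r / 4 < `|t - theta0|] =
    (fun t => `|t - theta0|) @^-1` `]r / 4, +oo[%classic.
  by apply/seteqP; split => t /=; rewrite in_itv/= andbT.
have mn : measurable_fun setT (fun t : 'rV[R]_d => `|t - theta0|).
  apply: continuous_measurable_rV => t.
  exact: cdist.
by rewrite -[X in measurable X]setTI; apply: mn => //; exact: measurable_itv.
Qed.

Let integrable_weighted :
  leb.-integrable Theta (EFin \o (fun t => `|t - theta0| * q t)).
Proof.
have h1 : leb.-integrable Theta (fun t => \sum_(a < d) (`|t ord0 a * q t|)%:E)%E.
  apply: integrable_sum => // a; have := iq1 a => /integrable_norm; exact.
have h2 : leb.-integrable Theta (fun t => (`|theta0|)%:E * (q t)%:E)%E by exact: integrableZl.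
have h := integrableD mTheta h1 h2.
apply: le_integrable h => //.
  apply/measurable_EFinP; apply: measurable_funM.
    apply: measurable_funTS; apply: continuous_measurable_rV => t.
    exact: cdist.
  by apply/measurable_EFinP; case/integrableP: iq.
move=> t Tt /=; rewrite sumEFin -EFinM -EFinD /= lee_fin normrM normr_id.
rewrite (ger0_norm (q0 Tt)) [leRHS]ger0_norm; last first.
  by rewrite addr_ge0 ?mulr_ge0 ?q0// sumr_ge0.
have -> : \sum_(a < d) `|t ord0 a * q t| = (\sum_(a < d) `|t ord0 a|) * q t.
  by rewrite big_distrl; apply: eq_bigr => a _; rewrite normrM (ger0_norm (q0 Tt)).
rewrite -mulrDl ler_wpM2r ?q0//; apply: (le_trans (ler_normB _ _)); rewrite lerD2r.
apply: rV_norm_le => [|a]; first by rewrite sumr_ge0.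
by rewrite (bigD1 a)//= lerDl sumr_ge0.
Qed.

(** All error terms below vanish near theta0 and grow at most linearly away from
    it. *)
Lemma tail_bound (f : 'rV[R]_d -> R) (c : R) : 0 <= c ->
  leb.-integrable Theta (EFin \o f) ->
  (forall t, Theta t -> `|t - theta0| <= r / 4 -> f t = 0) ->
  (forall t, Theta t -> r / 4 < `|t - theta0| -> `|f t| <= c * `|t - theta0| * q t) ->
  `|(\int[leb]_(t in Theta) f t) / Z| <= c * tail_moment.
Proof.
move=> c0 fi fin fout; pose O := outside theta0 Theta (r / 4).
have mO : measurable O := measurable_outside.
have OT : O `<=` Theta by move=> t [].
have iO : leb.-integrable O (EFin \o (fun t => `|t - theta0| * q t)).
  exact: (integrableS mTheta mO OT integrable_weighted).
have tE : c * tail_moment = (c * \int[leb]_(t in O) (`|t - theta0| * q t)) / Z.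
  rewrite -mulrA /tail_moment; congr (c * _); rewrite -RintegralZr//.
  by apply: eq_Rintegral => t _; rewrite mulrA.
rewrite tE normrM (gtr0_norm (_ : 0 < Z^-1)) ?invr_gt0// ler_pM2r ?invr_gt0//.
apply: (le_trans (le_normr_Rintegral mTheta fi)).
rewrite -RintegralZl//.
have -> : \int[leb]_(t in Theta) `|f t| = \int[leb]_(t in O) `|f t|.
  rewrite Rintegral_mkcond [RHS]Rintegral_mkcond; apply: eq_Rintegral => t _.
  rewrite !patchE; case: ifPn => [/set_mem Tt|/negP nT].
    case: ifPn => // /negP nO; rewrite fin ?normr0// leNgt; apply/negP => h.
    by apply: nO; apply/mem_set.
  by case: ifPn => // /set_mem[Tt _]; exfalso; apply: nT; exact/mem_set.
apply: le_Rintegral => //.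
- have := integrableS mTheta mO OT fi => /integrable_norm; exact.
- have := integrableZl mO c iO; exact.
- by move=> t [Tt /= ht]; rewrite mulrA; exact: fout.
Qed.

(** Stein's identity for the localized posterior. What is left comes from the
    derivative of the cut-off, which lives where |t - theta0| > r/4, that is, where
    1 <= (4 / r) |t - theta0|. *)
Lemma stein_local a h (C H : R) : 0 <= C -> 0 <= H ->
  (forall t, `|partial a phi t| <= C) ->
  (forall t, `|t - theta0| < 2 * r -> differentiable h t) ->
  cont_on_ball (partial a h) ->
  (forall t, `|t - theta0| < 2 * r -> `|h t| <= H) ->
  `|loc (fun t => partial a h t + h t * partial a v t)| <= C * H * (4 / r) * tail_moment.
Proof.
move=> C0 H0 hC dh ch hH.
have chh : cont_on_ball h by move=> t ht; apply: differentiable_continuous; exact: dh.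
have c2 : cont_on_ball (fun t => partial a h t + h t * partial a v t).
  by apply: cont_on_ballD => //; apply: cont_on_ballM => // t ht; exact: cv.
have r4 : 0 <= 4 / r by rewrite divr_ge0// ltW.
have CH : 0 <= C * H by exact: mulr_ge0.
have := stein dh ch.
under eq_Rintegral do rewrite mulrDl.
rewrite RintegralD//; [|exact: integrable_dloc|exact: integrable_loc].
move=> /eqP; rewrite addrC addr_eq0 => /eqP E; rewrite /loc E mulNr normrN.
apply: tail_bound.
- exact: mulr_ge0 CH r4.
- exact: integrable_dloc.
- by move=> t _ ht; rewrite dphi_in// !mul0r.
move=> t Tt ht; rewrite normrM (ger0_norm (q0 Tt)) ler_wpM2r ?q0//.
have [hr|hr] := in_or_out t; last first.
  by rewrite dphi_out// mul0r normr0; apply: mulr_ge0 => //; exact: mulr_ge0 CH r4.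
rewrite normrM -mulrA -[leLHS]mulr1; apply: ler_pM => //.
  by apply: ler_pM => //; exact: hH.
by rewrite mulrAC ler_pdivlMr// mul1r mulrC -ler_pdivrMr// ltW.
Qed.

Let phi01 t : 0 <= 1 - phi t <= 1.
Proof. by rewrite subr_ge0 bump_le1//= lerBlDr lerDl bump_ge0. Qed.

Let phi_in t : `|t - theta0| <= r / 4 -> 1 - phi t = 0.
Proof. by move=> h; rewrite /phi bump1 ?subrr//; exact: le_trans h (ltW r42). Qed.

Lemma loc1_bound : 0 <= 1 - loc (fun=> 1) <= 4 / r * tail_moment.
Proof.
have i1 := integrable_loc (@cont_on_ball_cst 1).
have E : 1 - loc (fun=> 1) = (\int[leb]_(t in Theta) ((1 - phi t) * q t)) / Z.
  rewrite /loc -[X in X - _](@divff _ Z) ?gt_eqF// -mulrBl -RintegralB//.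
  by congr (_ / _); apply: eq_Rintegral => t _; rewrite mulr1 mulrBl mul1r.
have ii : leb.-integrable Theta (EFin \o (fun t => (1 - phi t) * q t)).
  have := integrableB mTheta iq i1.
  by apply: eq_integrable => // t _ /=; rewrite mulr1 mulrBl mul1r EFinB.
rewrite E; apply/andP; split.
  apply: divr_ge0; last exact: ltW.
  by apply: Rintegral_ge0 => t Tt; rewrite mulr_ge0 ?q0//; case/andP: (phi01 t).
apply: (le_trans (ler_norm _)); apply: tail_bound => //.
- by rewrite divr_ge0// ltW.
- by move=> t _ /phi_in ->; rewrite mul0r.
move=> t Tt ht; rewrite normrM (ger0_norm (q0 Tt)) ler_wpM2r ?q0//.
have /andP[p1 p2] := phi01 t; rewrite ger0_norm//; apply: (le_trans p2).
by rewrite mulrAC ler_pdivlMr// mul1r mulrC -ler_pdivrMr// ltW.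
Qed.

Lemma posterior_mean_loc (x : 'rV[R]_d) a : `|x - theta0| <= r / 4 ->
  `|(\int[leb]_(t in Theta) (t ord0 a * q t)) / Z - x ord0 a
    - loc (fun t => (t - x) ord0 a)| <= 2 * tail_moment.
Proof.
move=> xr.
have ch : cont_on_ball (fun t => (t - x) ord0 a).
  move=> t _; have -> : (fun t : 'rV[R]_d => (t - x) ord0 a) = (fun t => t ord0 a - x ord0 a).
    by apply/funext => s; rewrite !mxE.
  apply: differentiable_continuous; apply: differentiableB => //.
  exact: differentiable_coord.
have i1 := integrable_loc ch.
have ix : leb.-integrable Theta (EFin \o (fun t => x ord0 a * q t)).
  by have := integrableZl mTheta (x ord0 a) iq; exact.
have ib : leb.-integrable Theta (EFin \o (fun t : 'rV[R]_d => t ord0 a * q t - x ord0 a * q t)).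
  by have := integrableB mTheta (iq1 a) ix; exact.
have E : (\int[leb]_(t in Theta) (t ord0 a * q t)) / Z - x ord0 a
    - loc (fun t => (t - x) ord0 a) =
    (\int[leb]_(t in Theta) ((1 - phi t) * ((t ord0 a - x ord0 a) * q t))) / Z.
  rewrite /loc -[X in _ - X - _](@mulfK _ Z) ?gt_eqF// -!mulrBl -RintegralZl// -RintegralB//.
  rewrite -RintegralB//; congr (_ / _); apply: eq_Rintegral => t _; rewrite !mxE.
  by move: (phi t) (q t) (t ord0 a) (x ord0 a) => A B C D; ring.
have ii : leb.-integrable Theta (EFin \o (fun t : 'rV[R]_d => (1 - phi t) * ((t ord0 a - x ord0 a) * q t))).
  have := integrableB mTheta ib i1.
  apply: eq_integrable => // t _ /=; rewrite -EFinB !mxE; congr EFin.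
  by move: (phi t) (q t) (t ord0 a) (x ord0 a) => A B C D; ring.
rewrite E; apply: tail_bound => //.
  by move=> t _ /phi_in ->; rewrite mul0r.
move=> t Tt ht; rewrite !normrM (ger0_norm (q0 Tt)) mulrA ler_wpM2r ?q0//.
have /andP[p1 p2] := phi01 t; rewrite (ger0_norm p1).
have hx : `|t ord0 a - x ord0 a| <= 2 * `|t - theta0|.
  have := rV_coord_le_norm (t - x) a; rewrite !mxE => /le_trans; apply.
  have -> : t - x = (t - theta0) - (x - theta0) by rewrite opprB addrA subrK.
  apply: (le_trans (ler_normB _ _)); rewrite mulr_natl mulr2n lerD2l.
  by apply: (le_trans xr); exact: ltW.
by rewrite -[leRHS]mul1r; exact: ler_pM.
Qed.

End localized_posterior.

(** * Comparison of the two estimators for a fixed sample *)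

Section perturbed_inversion.
Context {R : realType} {d : nat}.
Variables (g G : 'M[R]_d) (K eta : R).
Hypotheses (gG : g *m G = 1%:M) (GK : forall a b, `|G a b| <= K) (K0 : 0 <= K) (eta0 : 0 <= eta).
Local Notation D := (d%:R : R).

(** Multiply by the inverse matrix. *)
Lemma inversion_bound (y : 'I_d -> R) (e : R) :
  (forall a, `|\sum_b y b * g b a| <= e) -> forall f, `|y f| <= D * (K * e).
Proof.
move=> ye f.
have -> : y f = \sum_a G a f * (\sum_b y b * g b a).
  under eq_bigr do rewrite big_distrr/=.
  rewrite exchange_big /=.
  under eq_bigr => b _.
    under eq_bigr do rewrite mulrCA.
    rewrite -big_distrr/=; have -> : \sum_a G a f * g b a = (g *m G) b f.
      by rewrite mxE; apply: eq_bigr => a _; rewrite mulrC.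
    rewrite gG mxE.
    over.
  rewrite (bigD1 f)//= eqxx mulr1 big1 ?addr0// => b bf.
  by rewrite (negbTE bf) mulr0.
exact: norm_sum_le.
Qed.

(** A linear system known up to an error proportional to the unknown can still be
    inverted when the proportionality constant is small: the error is absorbed into
    the left-hand side. *)
Lemma perturbed_inversion_bound (y : 'rV[R]_d) (e : R) : 0 <= e ->
  2 * (D * D * K * eta) <= 1 ->
  (forall a, `|\sum_b y ord0 b * g b a| <= e + D * (`|y| * eta)) ->
  `|y| <= 2 * (D * (K * e)).
Proof.
move=> e0 small ye.
have h : `|y| <= D * (K * (e + D * (`|y| * eta))).
  apply: rV_norm_le; last exact: (inversion_bound ye).
  by rewrite !mulr_ge0// addr_ge0// !mulr_ge0.
have y0 : 0 <= `|y| by [].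
move: (`|y|) h y0 => Y h Y0.
have h2 : 2 * (D * D * K * eta) * Y <= 1 * Y by rewrite ler_wpM2r.
have E1 : D * (K * (e + D * (Y * eta))) = D * (K * e) + (D * D * K * eta) * Y by ring.
rewrite E1 in h; move: h h2; rewrite -mulrA.
by move: (D * (K * e)) (D * D * K * eta * Y) => A B; lra.
Qed.

End perturbed_inversion.

(** Only the fact that it depends on nothing but d and the bound K matters. Its
    ingredients bound, in this order, N times the posterior second moment, the
    precision at which that moment is the inverse information, N times the distance
    between the two point estimates, and the errors in the equations for the
    posterior mean and for the MAP estimate. *)
Definition comparison_constant {R : realType} (D K : R) : R :=
  let T := 2 * (D * K + D * D * K * (2 + K)) in
  let F := D * (K * (2 + K + (D + K) * T)) in
  let Y := 2 * (D * (K * K)) in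
  let A1 := 2 + D * D * T + D * D * (K * F) + K in
  let A2 := 1 + D * D * K * Y ^+ 2 + D * D * Y ^+ 2 in
  1 + 2 * (D * (K * (A1 + A2 + 2))).

(** Throughout, N is the number of observations, x is the maximum likelihood estimate,
    z the MAP estimate, g and L are the limits of the normalized second (with a minus
    sign) and third derivatives of the log-likelihood [ell], and G is the inverse
    of g. The number eta measures all the discrepancies at once, and every conclusion
    is of the form constant * eta with constants depending on d and K only. *)
Section deterministic_comparison.
Context {R : realType} {d : nat}.
Variables (Theta : set 'rV[R]_d) (theta0 : 'rV[R]_d) (r C : R).
Variables (lik ell piPM piMAP : 'rV[R]_d -> R).
Variables (x z : 'rV[R]_d) (N K eta : R) (g G : 'M[R]_d) (L : 'I_d -> 'I_d -> 'I_d -> R).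
Local Notation D := (d%:R : R).
Local Notation leb := (lebesgue_rV d).
Let q t := lik t * piPM t.
Let lam t := ln (piPM t).
Let lam' t := ln (piMAP t).

Hypotheses (r0 : 0 < r) (mTheta : measurable Theta)
  (ballTheta : forall t, `|t - theta0| < 2 * r -> Theta t)
  (likE : forall t, `|t - theta0| < 2 * r -> lik t = expR (ell t))
  (dell : forall s t, (size s <= 2)%N -> `|t - theta0| < 2 * r -> differentiable (partials s ell) t)
  (pi_pos : forall t, `|t - theta0| < 2 * r -> 0 < piPM t)
  (dlam : forall t, `|t - theta0| < 2 * r -> differentiable lam t)
  (clam : forall a t, `|t - theta0| < 2 * r -> {for t, continuous (partial a lam)}).
Hypotheses (iq : leb.-integrable Theta (EFin \o q)) (q0 : forall t, Theta t -> 0 <= q t)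
  (iq1 : forall a : 'I_d, leb.-integrable Theta (EFin \o (fun t : 'rV[R]_d => t ord0 a * q t))).
Let Z := \int[leb]_(t in Theta) q t.
Hypothesis Z0 : 0 < Z.
Hypotheses (C0 : 0 <= C) (bumpC : forall a t, `|partial a (bump theta0 r) t| <= C).
Hypotheses (N0 : 0 < N) (K1 : 1 <= K) (eta0 : 0 < eta) (eta1 : eta <= 1)
  (N_large : 1 <= N * eta ^+ 2).
Hypotheses (gG : g *m G = 1%:M) (Gg : G *m g = 1%:M) (GK : forall a b, `|G a b| <= K)
  (LK : forall a b c, `|L a b c| <= K) (Lsym : forall a b c, L c b a = L a b c).
Hypotheses
  (ell2 : forall a b t, `|t - theta0| < 2 * r -> `|partials [:: b; a] ell t + N * g b a| <= N * eta)
  (ell3 : forall a b c t, `|t - theta0| < 2 * r ->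
     `|partials [:: c; b; a] ell t - N * L c b a| <= N * eta)
  (lamK : forall a t, `|t - theta0| < 2 * r -> `|partial a lam t| <= K)
  (lam_osc : forall a t s, `|t - theta0| < 2 * r -> `|s - theta0| < 2 * r ->
     `|partial a lam t - partial a lam s| <= eta)
  (lam'K : forall a t, `|t - theta0| < 2 * r -> `|partial a lam' t| <= K)
  (lam'_osc : forall a t s, `|t - theta0| < 2 * r -> `|s - theta0| < 2 * r ->
     `|partial a lam' t - partial a lam' s| <= eta).
Hypotheses (xr : `|x - theta0| <= r / 4) (x_crit : forall a, partial a ell x = 0)
  (zr : `|z - theta0| < 2 * r) (z_crit : forall a, partial a ell z + partial a lam' z = 0).
Hypothesis match_xz : forall a,
  `|partial a lam x - partial a lam' x + 2^-1 * \sum_b \sum_c G b c * L a b c| <= 2 * eta.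
Let W := tail_moment Theta theta0 r q.
Hypotheses (W0 : 0 <= W) (W1 : C * (3 * r + 1) * (4 / r) * W <= eta) (W2 : 4 / r * W <= eta)
  (W3 : N * (2 * W) <= eta).
Hypothesis small : 4 * (D * D * K * (D + K) + D * D * K) * eta <= 1.

Let Lc := loc Theta theta0 r q.
Let cb := cont_on_ball theta0 r.
Let h (b : 'I_d) (t : 'rV[R]_d) := (t - x) ord0 b.
Let m : 'rV[R]_d := \row_b Lc (h b).
Let S (b c : 'I_d) := Lc (fun t => h b t * h c t).
Let v t := ell t + lam t.
Let s2 := \sum_b S b b.

Let qE t : `|t - theta0| < 2 * r -> q t = expR (v t).
Proof.
by move=> tr; rewrite /q /v expRD likE// /lam lnK// posrE; exact: pi_pos.
Qed.

Let dl t : `|t - theta0| < 2 * r -> differentiable ell t.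
Proof. exact: (dell (s := [::])). Qed.

Let dv t : `|t - theta0| < 2 * r -> differentiable v t.
Proof. by move=> tr; apply: differentiableD; [exact: dl|exact: dlam]. Qed.

Let pv a t : `|t - theta0| < 2 * r -> partial a v t = partial a ell t + partial a lam t.
Proof. by move=> tr; rewrite /v partialD//; [exact: dl|exact: dlam]. Qed.

Let cl a : cb (partial a ell).
Proof. by move=> t tr; apply: differentiable_continuous; exact: (dell (s := [:: a])). Qed.

Let ch b : cb (h b).
Proof.
move=> t _; have -> : h b = (fun t => t ord0 b - x ord0 b) by apply/funext => s; rewrite /h !mxE.
apply: differentiable_continuous; apply: differentiableB => //; exact: differentiable_coord.
Qed.

Let cv a t : `|t - theta0| < 2 * r -> {for t, continuous (partial a v)}.
Proof.
move=> tr; have c : {for t, continuous (fun t => partial a ell t + partial a lam t)}.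
  exact: (cvgD (cl (t:=t) tr) (clam (a:=a) tr)).
have nE : \forall s \near t, partial a ell s + partial a lam s = partial a v s.
  by apply: filterS (near_in_ball tr) => s /(pv a).
rewrite /prop_for /continuous_at -(nbhs_singleton nE).
by move=> A /c; apply: (near_eq_cvg nE).
Qed.

Let LD f k : cb f -> cb k -> Lc (fun t => f t + k t) = Lc f + Lc k.
Proof. exact: (locD r0 mTheta qE dv). Qed.

Let LZ c f : cb f -> Lc (fun t => c * f t) = c * Lc f.
Proof. exact: (locZ r0 mTheta qE dv). Qed.

Let LS (f : 'I_d -> 'rV[R]_d -> R) : (forall i, cb (f i)) ->
  Lc (fun t => \sum_i f i t) = \sum_i Lc (f i).
Proof. exact: (loc_sum r0 mTheta qE dv). Qed.

Let LN f k : cb f -> cb k ->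
  (forall t, `|t - theta0| < r -> `|f t| <= k t) -> `|Lc f| <= Lc k.
Proof. exact: (loc_norm_le r0 mTheta qE dv q0 Z0). Qed.

Let ccst (c : R) : cb (fun=> c) := @cont_on_ball_cst _ _ _ _ c.

Let cM f k : cb f -> cb k -> cb (fun t => f t * k t).
Proof. exact: cont_on_ballM. Qed.

Let cD f k : cb f -> cb k -> cb (fun t => f t + k t).
Proof. exact: cont_on_ballD. Qed.

Let cZ c f : cb f -> cb (fun t => c * f t).
Proof. by move=> cf; apply: (@cont_on_ballM _ _ _ _ (fun=> c)) => //; exact: ccst. Qed.

(** Localized expectations are integrals against a nonnegative weight. *)
Let LB U V B : cb U -> cb V -> cb B ->
  (forall t, `|t - theta0| < r -> `|U t - V t| <= B t) -> `|Lc U - Lc V| <= Lc B.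
Proof.
move=> cU cV cB UV; have cV' : cb (fun t => -1 * V t) by exact: cZ.
have -> : Lc U - Lc V = Lc (fun t => U t + -1 * V t) by rewrite LD// LZ// mulN1r.
apply: LN => //; first exact: cD.
by move=> t /UV; rewrite mulN1r.
Qed.

Let e1 := Lc (fun=> 1).

Let e1_bound : 0 <= 1 - e1 <= eta.
Proof.
have /andP[h1 h2] := loc1_bound r0 mTheta qE dv iq q0 iq1 Z0.
by apply/andP; split => //; exact: le_trans h2 W2.
Qed.

Let e1_le1 : e1 <= 1.
Proof. by case/andP: e1_bound; rewrite subr_ge0. Qed.

Let cS b c : cb (fun t => h b t * h c t).
Proof. exact: cM. Qed.

Let Q (t : 'rV[R]_d) := \sum_b h b t * h b t.

Let cQ : cb Q.
Proof. by apply: cont_on_ball_sum => b; exact: cS. Qed.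

Let LQ : Lc Q = s2.
Proof. by rewrite /Q LS// => b; exact: cS. Qed.

Let normQ t : `|t - x| * `|t - x| <= Q t.
Proof.
have Q0 : 0 <= Q t by apply: sumr_ge0 => b _; rewrite -expr2 sqr_ge0.
rewrite -expr2 -(sqr_sqrtr Q0) ler_pXn2r ?nnegrE ?sqrtr_ge0//.
apply: rV_norm_le => [|b]; first exact: sqrtr_ge0.
rewrite -sqrtr_sqr ler_wsqrtr// /Q (bigD1 b)//= /h expr2 lerDl.
by apply: sumr_ge0 => c _; rewrite -expr2 sqr_ge0.
Qed.

(** Since N eta^2 >= 1, a first moment is bounded by eta plus eta N times a second
    moment; this avoids square roots of moments in the estimates. *)
Let normQ1 t : `|t - x| <= eta * (1 + N * Q t).
Proof.
have := normQ t; move: `|t - x| (normr_ge0 (t - x)) (Q t) => Y Y0 q' Yq.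
have [Ye|Ye] := leP Y eta.
  have : 0 <= eta * (N * q') by rewrite !mulr_ge0 ?(ltW eta0) ?(ltW N0) ?(le_trans _ Yq) ?mulr_ge0.
  by rewrite mulrDr mulr1 => e; apply: (le_trans Ye); rewrite lerDl.
apply: (@le_trans _ _ (eta * (N * q'))); last first.
  by rewrite ler_wpM2l ?(ltW eta0)// lerDr.
apply: (@le_trans _ _ (eta * (N * (Y * Y)))); last first.
  by rewrite ler_wpM2l ?(ltW eta0)// ler_wpM2l ?(ltW N0).
apply: (@le_trans _ _ (eta * (N * (eta * Y)))); last first.
  by rewrite ler_wpM2l ?(ltW eta0)// ler_wpM2l ?(ltW N0)// ler_wpM2r// ltW.
have -> : eta * (N * (eta * Y)) = (N * eta ^+ 2) * Y by ring.
by rewrite -[leLHS]mul1r ler_wpM2r.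
Qed.

Let K0 : 0 <= K. Proof. exact: le_trans K1. Qed.
Let Ne0 : 0 <= N * eta. Proof. by rewrite mulr_ge0// ltW. Qed.
Let rr : r < 2 * r. Proof. by rewrite mulr_natl mulr2n ltrDl. Qed.

Let x2 : `|x - theta0| < 2 * r.
Proof.
apply: (le_lt_trans xr); apply: lt_trans rr.
by rewrite ltr_pdivrMr// ltr_pMr// ltr1n.
Qed.


Let score1 a t : `|t - theta0| < 2 * r ->
  `|partial a ell t + N * \sum_c h c t * g c a| <= D * (`|t - x| * (N * eta)).
Proof.
move=> tr.
have -> : partial a ell t + N * \sum_c h c t * g c a =
    partial a ell t - partial a ell x - \sum_b (t - x) ord0 b * (- (N * g b a)).
  rewrite x_crit subr0; congr (_ + _); rewrite big_distrr -sumrN; apply: eq_bigr => b _.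
  by rewrite mulrN opprK mulrCA.
apply: (@partial_expansion1 _ _ _ _ theta0 (2 * r)) => //.
- by move=> u ur; exact: (dell (s := [:: a])).
- by move=> u b ur; rewrite opprK; exact: ell2.
Qed.

(** Stein's identity, with the exact score replaced by an expansion of it. *)
Let stein_approx a k V B : (forall t, `|t - theta0| < 2 * r -> differentiable k t) ->
  cb (partial a k) -> (forall t, `|t - theta0| < 2 * r -> `|k t| <= 3 * r + 1) ->
  cb V -> cb B ->
  (forall t, `|t - theta0| < r ->
     `|partial a k t + k t * (partial a ell t + partial a lam t) - V t| <= B t) ->
  `|Lc V| <= Lc B + eta.
Proof.
move=> dk ck kH cV cB UV.
have H0 : 0 <= 3 * r + 1 by rewrite addr_ge0// mulr_ge0// ltW.
have := stein_local r0 mTheta ballTheta qE dv (fun t a => @cv a t) iq q0 iq1 Z0 C0 H0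
  (bumpC a) dk ck kH.
rewrite -/Lc => SL.
have cU : cb (fun t => partial a k t + k t * partial a v t).
  apply: cD => //; apply: cM => [t tr|t tr]; last exact: cv.
  by apply: differentiable_continuous; exact: dk.
have := LB cU cV cB; rewrite -/Lc => UVB.
have {}UVB : `|Lc (fun t => partial a k t + k t * partial a v t) - Lc V| <= Lc B.
  by apply: UVB => t tr; rewrite pv ?(lt_trans tr)//; exact: UV.
move: (Lc V) (Lc (fun t => partial a k t + k t * partial a v t)) SL UVB => v1 u1 SL UVB.
have {}SL := le_trans SL W1.
rewrite -(subrK u1 v1); apply: (le_trans (ler_normD _ _)).
by rewrite distrC lerD.
Qed.

Let Q0 t : 0 <= Q t.
Proof. by apply: sumr_ge0 => b _; rewrite -expr2 sqr_ge0. Qed.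

Let s20 : 0 <= s2.
Proof.
rewrite -LQ; have -> : 0 = Lc (fun=> 0 * 1) by rewrite (LZ 0 (@ccst 1)) mul0r.
apply: (loc_le r0 mTheta qE dv q0 Z0) => [||t _]; [exact: ccst|exact: cQ|].
by rewrite mul0r.
Qed.

Let E := eta * (2 + K + (D + K) * (N * s2)).

(** Stein's identity for the coordinate function h_b, with the score linearized at x:
    N g times the matrix S of second moments is nearly the identity. *)
Let S_equation a b : `|\sum_c (N * S b c) * g c a - (b == a)%:R| <= E.
Proof.
(* V is the expression d_a h_b + h_b d_a v with the score replaced by - N g (t - x). *)
pose V t := (b == a)%:R * 1 + -1 * \sum_c (N * g c a) * (h b t * h c t).
pose B t := D * N * eta * Q t + (K * eta * 1 + K * eta * (N * Q t)).
have cgh c : cb (fun t => (N * g c a) * (h b t * h c t)) by exact/cZ/cS.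
have cs : cb (fun t => \sum_c (N * g c a) * (h b t * h c t)) by exact: cont_on_ball_sum cgh.
have cV1 : cb (fun t => (b == a)%:R * 1) by exact: ccst.
have cV2 : cb (fun t => -1 * \sum_c (N * g c a) * (h b t * h c t)).
  exact: cZ.
have cB1 : cb (fun t => D * N * eta * Q t) by exact: cZ.
have cB2 : cb (fun t => K * eta * 1) by exact: ccst.
have cNQ : cb (fun t => N * Q t) by exact: cZ.
have cB3 : cb (fun t => K * eta * (N * Q t)) by exact: cZ.
have dh t : differentiable (h b) t.
  have -> : h b = (fun t => t ord0 b - x ord0 b) by apply/funext => s; rewrite /h !mxE.
  by apply: differentiableB => //; exact: differentiable_coord.
have ph t : partial a (h b) t = (b == a)%:R.
  have -> : h b = (fun t => t ord0 b - x ord0 b) by apply/funext => s; rewrite /h !mxE.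
  rewrite partialB//; last exact: differentiable_coord.
  rewrite partial_coord (_ : partial a _ _ = 0) ?subr0//.
  by rewrite /partial derive_cst.
have H : `|Lc V| <= Lc B + eta.
  apply: (@stein_approx a (h b)) => //.
  - by move=> t tr; rewrite (_ : partial a (h b) = fun=> (b == a)%:R) ?(funext ph)//; exact: ccst.
  - move=> t tr; apply: (le_trans (rV_coord_le_norm _ _)).
    rewrite -(subrK theta0 t) -addrA; apply: (le_trans (ler_normD _ _)).
    rewrite (distrC theta0); have : `|x - theta0| <= r.
      by apply: (le_trans xr); rewrite ler_pdivrMr// ler_pMr// ler1n.
    by move: `|t - theta0| `|x - theta0| tr => A A' h1 h2; lra.
  - exact: cD cV1 cV2.
  - exact: cD cB1 (cD cB2 cB3).
  move=> t tr; have tr2 := lt_trans tr rr.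
  rewrite ph /V.
  have -> : (b == a)%:R + h b t * (partial a ell t + partial a lam t) -
      ((b == a)%:R * 1 + -1 * \sum_c N * g c a * (h b t * h c t)) =
      h b t * (partial a ell t + N * \sum_c h c t * g c a) + h b t * partial a lam t.
    have -> : \sum_c N * g c a * (h b t * h c t) = h b t * (N * \sum_c h c t * g c a).
      rewrite !big_distrr; apply: eq_bigr => c _ /=.
      by move: (g c a) (h b t) (h c t) => u1 u2 u3; ring.
    move: (h b t) (partial a ell t) (partial a lam t) (\sum_c _) => u1 u2 u3 u4; ring.
  apply: (le_trans (ler_normD _ _)); rewrite !normrM /B; apply: lerD.
    apply: (@le_trans _ _ (`|t - x| * (D * (`|t - x| * (N * eta))))).
      by apply: ler_pM => //; [exact: rV_coord_le_norm|exact: score1].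
    have -> : `|t - x| * (D * (`|t - x| * (N * eta))) = D * N * eta * (`|t - x| * `|t - x|).
      by move: `|t - x| => A; ring.
    by rewrite ler_wpM2l// -mulrA mulr_ge0.
  apply: (@le_trans _ _ (`|t - x| * K)).
    by apply: ler_pM => //; [exact: rV_coord_le_norm|exact: lamK].
  rewrite -mulrDr mulrC -mulrA ler_wpM2l//; exact: normQ1.
have LV : Lc V = (b == a)%:R * e1 - \sum_c (N * S b c) * g c a.
  rewrite LD// LZ// LZ// LS// mulN1r; congr (_ - _); apply: eq_bigr => c _.
  by rewrite LZ// -/(S b c) mulrAC.
have LBE : Lc B = D * N * eta * s2 + (K * eta * e1 + K * eta * (N * s2)).
  rewrite LD//; last exact: cD cB2 cB3.
  by rewrite LZ// LD// !LZ// LQ.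
rewrite LV LBE in H.
have := e1_bound; move: H; rewrite /E.
have -> : D * N * eta * s2 + (K * eta * e1 + K * eta * (N * s2)) =
    eta * ((D + K) * (N * s2)) + K * eta * e1 by ring.
have Ke : K * eta * e1 <= K * eta.
  by rewrite -[leRHS]mulr1 ler_wpM2l// mulr_ge0// ltW.
have -> : eta * (2 + K + (D + K) * (N * s2)) = eta * ((D + K) * (N * s2)) + 2 * eta + K * eta.
  by ring.
move: Ke; move: (eta * ((D + K) * (N * s2))) (\sum_c _) (K * eta * e1) => M s k1.
move: (K * eta) e1.
have bE : (b == a)%:R = 1 :> R \/ (b == a)%:R = 0 :> R by case: (b == a); [left|right].
move=> k2 e1' k12; move: bE eta0; move: eta => et.
by case=> ->; rewrite ?mul1r ?mul0r !ler_norml => et0 /andP[h1 h2] /andP[h3 h4];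
  apply/andP; split; lra.
Qed.

Let T := 2 * (D * K + D * D * K * (2 + K)).

Let S_inverse b c : `|N * S b c - G b c| <= D * (K * E).
Proof.
have := @inversion_bound R d g G K gG GK K0 (fun c => N * S b c - G b c) E.
apply => a; rewrite (_ : \sum_b0 _ = \sum_c (N * S b c) * g c a - (b == a)%:R) ?S_equation//.
have -> : (b == a)%:R = (G *m g) b a :> R by rewrite Gg mxE.
by rewrite mxE -sumrB; apply: eq_bigr => e _; rewrite mulrBl.
Qed.

Let D0 : 0 <= D. Proof. exact: ler0n. Qed.

(** The error in [S_equation] contains N s2 itself with a small factor, so that the
    bound on S yields a bound on N s2 a posteriori. *)
Let Ns2_le : N * s2 <= T.
Proof.
have h1 : N * s2 <= D * (K + D * (K * E)).
  rewrite /s2 big_distrr/=; apply: (le_trans (ler_norm _)).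
  apply: (le_trans (ler_norm_sum _ _ _)).
  apply: (@le_trans _ _ (\sum_(i < d) (K + D * (K * E)))).
    apply: ler_sum => b _; rewrite -[N * _](subrKC (G b b)).
    apply: (le_trans (ler_normD _ _)); apply: lerD => //.
  by rewrite sumr_const card_ord -[X in X <= _]mulr_natl.
have h2 : 4 * (D * D * K * (D + K) * eta) <= 1.
  apply: le_trans small; have : 0 <= D * D * K by rewrite !mulr_ge0.
  move: (D * D * K) (D * D * K * (D + K)) => B A B0.
  by rewrite -!mulrA ler_wpM2l// mulrDl lerDl mulr_ge0// ltW.
have Ns0 : 0 <= N * s2 by rewrite mulr_ge0// ltW.
move: h1 h2 Ns0; rewrite /E /T; move: (N * s2) => u.
have -> : D * (K + D * (K * (eta * (2 + K + (D + K) * u)))) =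
   D * K + D * D * K * (2 + K) * eta + D * D * K * (D + K) * eta * u by ring.
move=> h1 h2 u0.
have h3 : 4 * (D * D * K * (D + K) * eta) * u <= 1 * u by rewrite ler_wpM2r.
have h4 : D * D * K * (2 + K) * eta <= D * D * K * (2 + K).
  by rewrite -[leRHS]mulr1 ler_wpM2l// !mulr_ge0// addr_ge0.
have DK0 : 0 <= D * K by rewrite mulr_ge0.
rewrite -mulrA in h3; move: h1 h3.
move: (D * D * K * (2 + K)) (D * D * K * (2 + K) * eta) (D * D * K * (D + K) * eta * u)
  (D * K) h4 DK0 => x1 x2' x3 x4; lra.
Qed.

Let F := D * (K * (2 + K + (D + K) * T)).

Let T0 : 0 <= T.
Proof. by apply: le_trans Ns2_le; rewrite mulr_ge0// ltW. Qed.

Let S_inverse_le b c : `|N * S b c - G b c| <= eta * F.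
Proof.
apply: (le_trans (S_inverse b c)); rewrite /E /F.
have -> : D * (K * (eta * (2 + K + (D + K) * (N * s2)))) =
  eta * (D * (K * (2 + K + (D + K) * (N * s2)))) by ring.
rewrite ler_wpM2l ?(ltW eta0)// ler_wpM2l// ler_wpM2l// lerD2l ler_wpM2l ?Ns2_le//.
by rewrite addr_ge0.
Qed.

Let Pm (b a : 'I_d) := partials [:: b; a] ell x.
Let A1 := 2 + D * D * T + D * D * (K * F) + K.

Let cubic (a : 'I_d) := 2^-1 * \sum_b \sum_c G b c * L a b c.

(** Stein's identity for the constant function 1, with the score expanded to second
    order at x: the mean deviation m solves a linear system whose right-hand side
    collects the cubic term of the log-likelihood, averaged with the second moments
    N S close to G, and the gradient of the log-prior. *)
Let mean_equation a : `|\sum_b m ord0 b * Pm b a + cubic a + partial a lam x| <= eta * A1.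
Proof.
pose V t := \sum_b Pm b a * h b t +
  (2^-1 * \sum_b \sum_c (N * L c b a) * (h b t * h c t) + partial a lam x * 1).
pose B t := D * D * (N * eta) * Q t + eta * 1.
have c1 : cb (fun t => \sum_b Pm b a * h b t) by apply: cont_on_ball_sum => b; exact/cZ/ch.
have c2' b : cb (fun t => \sum_c (N * L c b a) * (h b t * h c t)).
  by apply: cont_on_ball_sum => c; exact/cZ/cS.
have c2 : cb (fun t => \sum_b \sum_c (N * L c b a) * (h b t * h c t)).
  exact: cont_on_ball_sum c2'.
have c3 : cb (fun t => 2^-1 * \sum_b \sum_c (N * L c b a) * (h b t * h c t)) by exact: cZ.
have c4 : cb (fun t => partial a lam x * 1) by exact: ccst.
have c5 : cb (fun t => D * D * (N * eta) * Q t) by exact: cZ.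
have c6 : cb (fun t => eta * 1) by exact: ccst.
have p1 t : partial a (fun=> 1) t = 0 :> R by rewrite /partial derive_cst.
have H : `|Lc V| <= Lc B + eta.
  apply: (@stein_approx a (fun=> 1)) => //.
  - by move=> t tr; rewrite (funext p1); exact: ccst.
  - by move=> t tr; rewrite normr1 lerDr mulr_ge0// ltW.
  - exact: cD c1 (cD c3 c4).
  - exact: cD c5 c6.
  move=> t tr; have tr2 := lt_trans tr rr.
  rewrite p1 add0r mul1r /V.
  have ex := @partial_expansion2 R d (partial a ell) (fun c b => N * L c b a) theta0 (2 * r)
    (N * eta) x t Ne0 (fun u => dell (s := [:: a]) (t := u) isT)
    (fun u b => dell (s := [:: b; a]) (t := u) isT) (fun u c b => @ell3 a b c u) x2 tr2.
  rewrite x_crit subr0 in ex.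
  have E1 : \sum_b Pm b a * h b t = \sum_b (t - x) ord0 b * partial b (partial a ell) x.
    by apply: eq_bigr => b _; rewrite mulrC.
  have E2 : \sum_b \sum_c (N * L c b a) * (h b t * h c t) =
      \sum_b (t - x) ord0 b * (\sum_c (t - x) ord0 c * (N * L c b a)).
    apply: eq_bigr => b _; rewrite big_distrr; apply: eq_bigr => c _ /=.
    by rewrite mulrC -mulrA.
  rewrite E1 E2; move: ex.
  move: (\sum_b _) (2^-1 * \sum_b _) => u1 u2 ex.
  have -> : partial a ell t + partial a lam t - (u1 + (u2 + partial a lam x * 1)) =
      (partial a ell t - u1 - u2) + (partial a lam t - partial a lam x).
    by move: (partial a ell t) (partial a lam t) (partial a lam x) => w1 w2 w3; ring.
  apply: (le_trans (ler_normD _ _)); apply: lerD; last by rewrite mulr1 lam_osc.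
  apply: (le_trans ex).
  have -> : D * (`|t - x| * (D * (`|t - x| * (N * eta)))) = D * D * (N * eta) * (`|t - x| * `|t - x|).
    by move: `|t - x| => A; ring.
  by rewrite ler_wpM2l ?normQ// mulr_ge0// mulr_ge0.
have LV : Lc V = \sum_b m ord0 b * Pm b a +
    (2^-1 * \sum_b \sum_c L c b a * (N * S b c) + partial a lam x * e1).
  rewrite LD//; last exact: cD c3 c4.
  rewrite LD// LZ// LZ//.
  congr (_ + (2^-1 * _ + _)).
    by rewrite LS => [|b]; [apply: eq_bigr => b _; rewrite LZ// mxE mulrC|exact/cZ/ch].
  rewrite LS//; apply: eq_bigr => b _; rewrite LS => [|c]; last exact/cZ/cS.
  by apply: eq_bigr => c _; rewrite LZ// -/(S b c) mulrA [L _ _ _ * _]mulrC.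
have LBE : Lc B = D * D * (N * eta) * s2 + eta * e1 by rewrite LD// !LZ// LQ.
rewrite LV LBE in H.
have cub : `|2^-1 * (\sum_b \sum_c L c b a * (N * S b c)) - cubic a| <= D * D * (K * F) * eta.
  have -> : 2^-1 * (\sum_b \sum_c L c b a * (N * S b c)) - cubic a =
      2^-1 * \sum_b 1 * \sum_c L c b a * (N * S b c - G b c).
    rewrite /cubic -mulrBr -sumrB; congr (_ * _); apply: eq_bigr => b _.
    rewrite mul1r -sumrB; apply: eq_bigr => c _.
    by rewrite Lsym mulrBr [G _ _ * _]mulrC.
  rewrite normrM gtr0_norm ?invr_gt0//.
  apply: (@le_trans _ _ (1 * (D * (1 * (D * (K * (eta * F))))))); last first.
    by rewrite !mul1r le_eqVlt; apply/orP; left; apply/eqP; ring.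
  apply: ler_pM => //; first by rewrite invf_le1// ler1n.
  apply: norm_sum_le => // [b|b]; first by rewrite normr1.
  by apply: norm_sum_le.
move: H cub e1_bound (lamK a x2).
rewrite /A1.
have -> : D * D * (N * eta) * s2 = D * D * eta * (N * s2) by ring.
have TB : D * D * eta * (N * s2) <= D * D * eta * T.
  by rewrite ler_wpM2l ?Ns2_le// !mulr_ge0// ltW.
have ee : eta * e1 <= eta by rewrite -[leRHS]mulr1 ler_wpM2l// ltW.
have -> : eta * (2 + D * D * T + D * D * (K * F) + K) =
   2 * eta + D * D * eta * T + D * D * (K * F) * eta + K * eta by ring.
move=> H cub /andP[b1 b2] lK.
have le1 : `|partial a lam x * (1 - e1)| <= K * eta.
  by rewrite normrM; apply: ler_pM => //; rewrite ger0_norm.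
rewrite mulrBr mulr1 in le1.
have := H; move: cub TB ee le1.
move: (\sum_b m ord0 b * Pm b a) (2^-1 * \sum_b _) (cubic a) (partial a lam x * e1)
  (partial a lam x) (D * D * (K * F) * eta) (K * eta) (D * D * eta * (N * s2)) (D * D * eta * T).
move: (eta * e1) eta.
move=> y1 et u1 u2 u3 u4 u5 u6 u7 u8 u9; rewrite !ler_norml.
by move=> /andP[i1 i2] i3 i4 /andP[i5 i6] /andP[i7 i8]; apply/andP; split; lra.
Qed.

Let Y := 2 * (D * (K * K)).
Let A2 := 1 + D * D * K * Y ^+ 2 + D * D * Y ^+ 2.

Let small2 : 2 * (D * D * K * eta) <= 1.
Proof.
have B0 : 0 <= D * D * K * eta by rewrite !mulr_ge0// ltW.
have C1 : 0 <= D * D * K * (D + K) * eta by rewrite !mulr_ge0 ?addr_ge0// ltW.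
move: small; have -> : 4 * (D * D * K * (D + K) + D * D * K) * eta =
  4 * (D * D * K * (D + K) * eta) + 4 * (D * D * K * eta) by ring.
move: (D * D * K * eta) (D * D * K * (D + K) * eta) B0 C1 => u1 u2; lra.
Qed.

Let Y0 : 0 <= Y. Proof. by rewrite !mulr_ge0. Qed.

(** First-order expansion of the equation satisfied by z at the critical point x. *)
Let map_deviation : N * `|z - x| <= Y.
Proof.
have -> : N * `|z - x| = `|N *: (z - x)| by rewrite normrZ gtr0_norm.
apply: (perturbed_inversion_bound gG GK K0 (ltW eta0)) => // a.
have ex : `|partial a ell z - partial a ell x - \sum_b (z - x) ord0 b * (- (N * g b a))|
    <= D * (`|z - x| * (N * eta)).
  apply: (@partial_expansion1 _ _ _ _ theta0 (2 * r)) => //.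
  - by move=> u ur; exact: (dell (s := [:: a])).
  - by move=> u b ur; rewrite opprK; exact: ell2.
have -> : \sum_b (N *: (z - x)) ord0 b * g b a =
    - \sum_b (z - x) ord0 b * (- (N * g b a)).
  rewrite -sumrN; apply: eq_bigr => b _; rewrite !mxE.
  by move: (z ord0 b) (x ord0 b) (g b a) => u1 u2 u3; ring.
rewrite x_crit subr0 in ex.
have -> : D * (`|N *: (z - x)| * eta) = D * (`|z - x| * (N * eta)).
  by rewrite normrZ gtr0_norm//; move: `|z - x| => w; ring.
have zE : partial a ell z = - partial a lam' z.
  by apply/eqP; rewrite -addr_eq0; apply/eqP; exact: z_crit.
have := lam'K a zr; rewrite zE in ex; move: ex.
move: (partial a lam' z) (\sum_b _) (D * _) => u1 u2 u3; rewrite !ler_norml.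
by move=> /andP[i1 i2] /andP[i3 i4]; apply/andP; split; lra.
Qed.

Let sq_deviation : N * (`|z - x| * `|z - x|) <= Y ^+ 2 * eta.
Proof.
have h1 : (N * `|z - x|) ^+ 2 <= Y ^+ 2 by rewrite ler_pXn2r// nnegrE// mulr_ge0// ltW.
apply: (@le_trans _ _ (Y ^+ 2 * eta ^+ 2)); last first.
  by rewrite ler_wpM2l ?exprn_ge0// expr2 -[leRHS]mulr1 ler_wpM2l// ltW.
apply: (@le_trans _ _ ((N * `|z - x|) ^+ 2 * eta ^+ 2)); last first.
  by rewrite ler_wpM2r// exprn_ge0// ltW.
have -> : (N * `|z - x|) ^+ 2 * eta ^+ 2 = N * (`|z - x| * `|z - x|) * (N * eta ^+ 2).
  by move: `|z - x| => w; ring.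
by rewrite -[leLHS]mulr1 ler_wpM2l// !mulr_ge0// ltW.
Qed.

(** Second-order expansion of the same equation. The cubic term is negligible here,
    being of order N |z - x|^2, whereas for the posterior mean it is averaged over
    deviations of order N^(-1/2): this is where the two estimators differ. *)
Let map_equation a :
  `|\sum_b (z - x) ord0 b * Pm b a + partial a lam' x| <= eta * A2.
Proof.
have ex := @partial_expansion2 R d (partial a ell) (fun c b => N * L c b a) theta0 (2 * r)
    (N * eta) x z Ne0 (fun u => dell (s := [:: a]) (t := u) isT)
    (fun u b => dell (s := [:: b; a]) (t := u) isT) (fun u c b => @ell3 a b c u) x2 zr.
rewrite x_crit subr0 in ex.
have zE : partial a ell z = - partial a lam' z.
  by apply/eqP; rewrite -addr_eq0; apply/eqP; exact: z_crit.
rewrite zE in ex.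
have E1 : D * (`|z - x| * (D * (`|z - x| * (N * eta)))) <= D * D * Y ^+ 2 * eta.
  have -> : D * (`|z - x| * (D * (`|z - x| * (N * eta)))) =
     D * D * ((N * (`|z - x| * `|z - x|)) * eta) by move: `|z - x| => w; ring.
  rewrite -[leRHS]mulrA ler_wpM2l ?mulr_ge0//.
  apply: le_trans sq_deviation; rewrite -[leRHS]mulr1 ler_wpM2l//.
  by apply: mulr_ge0; [exact: ltW|exact: mulr_ge0].
have E2 : `|2^-1 * \sum_b (z - x) ord0 b * (\sum_c (z - x) ord0 c * (N * L c b a))| <=
    D * D * K * Y ^+ 2 * eta.
  rewrite normrM gtr0_norm ?invr_gt0//.
  apply: (@le_trans _ _ (1 * (D * (`|z - x| * (D * (`|z - x| * (N * K))))))).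
    apply: ler_pM => //; first by rewrite invf_le1// ler1n.
    apply: norm_sum_le => // [b|b]; first exact: rV_coord_le_norm.
    apply: norm_sum_le => // [c|c]; first exact: rV_coord_le_norm.
    by rewrite normrM gtr0_norm// ler_wpM2l// ltW.
  have -> : 1 * (D * (`|z - x| * (D * (`|z - x| * (N * K))))) =
     D * D * K * (N * (`|z - x| * `|z - x|)) by move: `|z - x| => w; ring.
  by rewrite -[leRHS]mulrA ler_wpM2l ?sq_deviation// !mulr_ge0.
have osc := lam'_osc a x2 zr.
rewrite /A2.
have -> : eta * (1 + D * D * K * Y ^+ 2 + D * D * Y ^+ 2) =
   eta + D * D * K * Y ^+ 2 * eta + D * D * Y ^+ 2 * eta by ring.
have {}ex := le_trans ex E1.
have -> : \sum_b (z - x) ord0 b * Pm b a =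
  \sum_b (z - x) ord0 b * partial b (partial a ell) x by [].
move: ex E2 osc.
move: (\sum_b _) (2^-1 * _) (partial a lam' x) (partial a lam' z) (D * D * K * Y ^+ 2 * eta)
  (D * D * Y ^+ 2 * eta) eta => u1 u2 u3 u4 u5 u6 et.
rewrite !ler_norml => /andP[i1 i2] /andP[i3 i4] /andP[i5 i6]; apply/andP; split; lra.
Qed.

(** The two linear systems have the same matrix, and by the matching condition nearly
    the same right-hand side. *)
Let mean_map : N * `|m - (z - x)| <= 2 * (D * (K * (eta * (A1 + A2 + 2)))).
Proof.
have -> : N * `|m - (z - x)| = `|N *: (m - (z - x))| by rewrite normrZ gtr0_norm.
have F0 : 0 <= F.
  do 2 apply: mulr_ge0 => //.
  by apply: addr_ge0; [exact: addr_ge0|exact: mulr_ge0 (addr_ge0 D0 K0) T0].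
have DD0 : 0 <= D * D := mulr_ge0 D0 D0.
have A10 : 0 <= A1.
  apply: addr_ge0 => //; apply: addr_ge0; last exact: mulr_ge0 DD0 (mulr_ge0 K0 F0).
  by apply: addr_ge0 => //; exact: mulr_ge0 DD0 T0.
have A20 : 0 <= A2.
  apply: addr_ge0; last exact: mulr_ge0 DD0 (exprn_ge0 2 Y0).
  by apply: addr_ge0 => //; exact: mulr_ge0 (mulr_ge0 DD0 K0) (exprn_ge0 2 Y0).
have e0 : 0 <= eta * (A1 + A2 + 2) := mulr_ge0 (ltW eta0) (addr_ge0 (addr_ge0 A10 A20) (ler0n _ 2)).
apply: (perturbed_inversion_bound gG GK K0 (ltW eta0)) => // a.
pose dm b := (m - (z - x)) ord0 b.
have h1 : `|\sum_b dm b * Pm b a| <= eta * (A1 + A2 + 2).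
  have -> : \sum_b dm b * Pm b a = \sum_b m ord0 b * Pm b a - \sum_b (z - x) ord0 b * Pm b a.
    by rewrite -sumrB; apply: eq_bigr => b _; rewrite -mulrBl /dm !mxE.
  have := mean_equation a; have := map_equation a; have := match_xz a; rewrite -/(cubic a).
  have -> : eta * (A1 + A2 + 2) = eta * A1 + eta * A2 + 2 * eta by ring.
  move: (\sum_b m ord0 b * Pm b a) (\sum_b _ * _) (cubic a) (partial a lam x) (partial a lam' x)
    (eta * A1) (eta * A2) (2 * eta) => u1 u2 u3 u4 u5 u6 u7 u8.
  by rewrite !ler_norml => /andP[i1 i2] /andP[i3 i4] /andP[i5 i6]; apply/andP; split; lra.
have h2 : `|\sum_b dm b * (Pm b a + N * g b a)| <= D * (`|m - (z - x)| * (N * eta)).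
  by apply: norm_sum_le => // b; [exact: rV_coord_le_norm|exact: ell2].
have -> : \sum_b (N *: (m - (z - x))) ord0 b * g b a =
    \sum_b dm b * (Pm b a + N * g b a) - \sum_b dm b * Pm b a.
  rewrite -sumrB; apply: eq_bigr => b _; rewrite -mulrBr addrAC subrr add0r mxE /dm.
  by rewrite mulrCA mulrA.
have -> : D * (`|N *: (m - (z - x))| * eta) = D * (`|m - (z - x)| * (N * eta)).
  by rewrite normrZ gtr0_norm//; move: `|_| => w; ring.
by apply: (le_trans (ler_normB _ _)); rewrite (addrC (eta * _)); exact: lerD.
Qed.

(** The posterior mean differs from x + m by a tail term, and m from z - x by the
    comparison of the two linear systems. *)
Lemma posterior_mean_map_bound a :
  `|N * ((\int[leb]_(t in Theta) (t ord0 a * q t)) / Z - z ord0 a)| <=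
  comparison_constant D K * eta.
Proof.
have pm := @posterior_mean_loc _ _ _ _ _ _ _ r0 mTheta qE dv iq q0 iq1 Z0 x a xr.
move: pm; rewrite -/Z -/W -/Lc.
have -> : Lc (fun t => (t - x) ord0 a) = m ord0 a by rewrite mxE.
move: (_ / Z) => pmv pm.
have -> : N * (pmv - z ord0 a) = N * (pmv - x ord0 a - m ord0 a) + N * (m - (z - x)) ord0 a.
  rewrite -mulrDr; congr (_ * _); rewrite !mxE.
  by move: (Lc _) (x ord0 a) (z ord0 a) => u1 u2 u3; ring.
apply: (le_trans (ler_normD _ _)); rewrite !normrM gtr0_norm//.
have i1 : N * `|pmv - x ord0 a - m ord0 a| <= eta.
  by apply: le_trans W3; rewrite ler_wpM2l// ltW.
have i2 : N * `|(m - (z - x)) ord0 a| <= 2 * (D * (K * (eta * (A1 + A2 + 2)))).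
  by apply: le_trans mean_map; rewrite ler_wpM2l ?(ltW N0)// rV_coord_le_norm.
apply: (le_trans (lerD i1 i2)).
rewrite /comparison_constant -/T -/F -/Y -/A1 -/A2 le_eqVlt.
apply/orP; left; apply/eqP; move: (A1 + A2 + 2) => w; ring.
Qed.

End deterministic_comparison.

(** * Local bounds on the cut-off and on the priors *)

Section local_controls.
Context {R : realType} {d : nat}.
Variable theta0 : 'rV[R]_d.

(** Continuity and compact support. *)
Lemma bounded_partial_bump (r : R) : 0 < r ->
  exists2 C : R, 0 <= C & forall a t, `|partial a (bump theta0 r) t| <= C.
Proof.
move=> r0.
have h a : exists C : R, 0 <= C /\ forall t, `|partial a (bump theta0 r) t| <= C.
  have [|v Kv|C C0 hC] := @bounded_compact_support_rV R d (partial a (bump theta0 r))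
      (`|theta0| + r).
  - exact: continuous_partial_bump.
  - have out : r < `|v - theta0|.
      rewrite -(ltrD2l `|theta0|); apply: (lt_le_trans Kv).
      by rewrite -[in leLHS](subrKC theta0 v) ler_normD.
    rewrite (@near_eq_partial _ _ _ (cst 0)); first exact: derive_cst.
    have e0 : 0 < `|v - theta0| - r by rewrite subr_gt0.
    apply: (ball_near e0) => s sv; apply: bump0 => //.
    have := ler_normD (s - theta0) (v - s); rewrite addrC subrKA (distrC v s).
    by move: `|s - v| `|v - theta0| `|s - theta0| sv => u1 u2 u3; lra.
  by exists C.
have [C hC] := choice h; exists (\sum_a C a).
  by apply: sumr_ge0 => a _; have [] := hC a.
move=> a t; apply: (le_trans ((hC a).2 t)); rewrite (bigD1 a)//= lerDl.
by apply: sumr_ge0 => b _; have [] := hC b.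
Qed.

Lemma log_prior_regular (pi : 'rV[R]_d -> R) : prior_differentiable theta0 pi ->
  \forall t \near theta0, [/\ 0 < pi t, differentiable (fun t => ln (pi t)) t &
    forall a, {for t, continuous (partial a (fun t => ln (pi t)))}].
Proof.
move=> h; have := near_join h; apply: filterS => t ht.
have [pt dpt] := nbhs_singleton ht.
have dp : differentiable pi t by exact: (dpt [::]).
split => //; first exact: differentiable_ln.
move=> a; have c1 : {for t, continuous (fun s => partial a pi s / pi s)}.
  have ca : {for t, continuous (partial a pi)}.
    by apply: differentiable_continuous; exact: (dpt [:: a]).
  have ci : {for t, continuous (fun s => (pi s)^-1)}.
    exact: (cvgV (lt0r_neq0 pt) (differentiable_continuous dp)).
  exact: (cvgM ca ci).
have nE : \forall s \near t, partial a pi s / pi s = partial a (fun t => ln (pi t)) s.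
  apply: filterS ht => s [ps ds]; rewrite partial_ln//; exact: (ds [::]).
rewrite /prop_for /continuous_at -(nbhs_singleton nE).
by move=> A /c1; apply: (near_eq_cvg nE).
Qed.

Lemma near_oscillation (f : 'I_d -> 'rV[R]_d -> R) (eta : R) : 0 < eta ->
  (forall a, {for theta0, continuous (f a)}) ->
  \forall t \near theta0, forall a, `|f a t - f a theta0| <= eta.
Proof.
move=> eta0 cf; apply: (@filter_forall 'rV[R]_d 'I_d
  (fun a t => `|f a t - f a theta0| <= eta) (nbhs theta0)) => a.
have := cf a; move/cvgrPdist_le => /(_ eta eta0).
by apply: filterS => t; rewrite distrC.
Qed.

End local_controls.

(** * Oscillation of the derivatives of a smooth function *)

(** The difference vanishes near x, so that 0 is its differential by definition. *)
Lemma near_eq_differentiable {R : realType} {d : nat} (f g : 'rV[R]_d -> R) x :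
  (\forall z \near x, f z = g z) -> differentiable f x -> differentiable g x.
Proof.
move=> fg df; pose h := (fun z => g z - f z).
have [r r0 h0] : exists2 r : R, 0 < r & forall z, `|z - x| < r -> h z = 0.
  by apply: near_ballP; apply: filterS fg => z fz; rewrite /h fz subrr.
have hE : h \o shift x = cst (h x) + (\0 : 'rV[R]_d -> R) +o_ 0 id.
  apply/eqaddoP => e e0; apply: (ball_near r0) => z; rewrite subr0 => zr.
  have -> : (h \o shift x - (cst (h x) + (\0 : 'rV[R]_d -> R))) z = h (z + x) - (h x + 0) by [].
  rewrite !h0 ?addrK ?subrr ?normr0//.
  by rewrite !addr0 subrr normr0 mulr_ge0// ltW.
have dh : 'd h x = (\0 : 'rV[R]_d -> R) :> ('rV[R]_d -> R).
  exact: (@diff_unique R 'rV[R]_d R h (\0 : {linear 'rV[R]_d -> R}) x (@cst_continuous _ _ 0) hE).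
have dfh : differentiable h x.
  by apply/diff_locallyP; split; rewrite dh//; exact: cst_continuous.
have -> : g = (fun z => f z + h z) by apply/funext => z; rewrite /h addrC subrK.
exact: differentiableD.
Qed.

Section smooth_on_ball.
Context {R : realType} {d : nat}.
Variables (theta0 : 'rV[R]_d) (rho : R).
Local Notation D := (d%:R : R).

Definition smooth_on_ball k (f : 'rV[R]_d -> R) : Prop :=
  forall t, `|t - theta0| < rho -> times_differentiable k f t.

Lemma partials_bigsum k (n : nat) (f : 'I_n -> 'rV[R]_d -> R) (I : seq 'I_d) :
  (forall i, smooth_on_ball k (f i)) -> (size I <= k)%N ->
  forall t, `|t - theta0| < rho ->
    partials I (fun t => \sum_i f i t) t = \sum_i partials I (f i) t.
Proof.
move=> sf; elim: I => [//|a I IH] Ik t tr /=.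
rewrite -partial_bigsum => [|i]; last exact: sf.
apply: near_eq_partial; apply: filterS (near_in_ball tr) => s sr.
by apply: IH => //; exact: ltnW.
Qed.

Lemma smooth_bigsum k (n : nat) (f : 'I_n -> 'rV[R]_d -> R) :
  (forall i, smooth_on_ball k (f i)) -> smooth_on_ball k (fun t => \sum_i f i t).
Proof.
move=> sf t tr I Ik.
have d1 : differentiable (fun t => \sum_i partials I (f i) t) t.
  by apply: differentiable_bigsum => i; exact: sf.
have nE : \forall s \near t, \sum_i partials I (f i) s = partials I (fun t => \sum_i f i t) s.
  by apply: filterS (near_in_ball tr) => s sr; rewrite (partials_bigsum sf)// ltnW.
exact: near_eq_differentiable nE d1.
Qed.

Lemma partial_swap k (f : 'rV[R]_d -> R) (I : seq 'I_d) a b : smooth_on_ball k f ->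
  (size I + 2 < k)%N -> forall t, `|t - theta0| < rho ->
  partials [:: a, b & I] f t = partials [:: b, a & I] f t.
Proof.
rewrite addn2 => sf Ik t tr; apply: partialC.
- apply: filterS (near_in_ball tr) => s sr; split.
  + by apply: sf => //; do 2 apply: ltnW.
  + by apply: (sf s sr (a :: I)); exact: ltnW.
  + by apply: (sf s sr (b :: I)); exact: ltnW.
- by apply: differentiable_continuous; exact: (sf t tr [:: a, b & I]).
- by apply: differentiable_continuous; exact: (sf t tr [:: b, a & I]).
Qed.

(** Three transpositions of neighbours reverse the order of three derivatives. *)
Lemma third_partials_rev (f : 'rV[R]_d -> R) a b c : smooth_on_ball 5 f ->
  forall t, `|t - theta0| < rho -> partials [:: c; b; a] f t = partials [:: a; b; c] f t.
Proof.
move=> sf t tr.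
apply: (etrans (@partial_swap 5 f [:: a] c b sf isT t tr)).
have h : partials [:: b; c; a] f t = partials [:: b; a; c] f t.
  apply: near_eq_partial; apply: filterS (near_in_ball tr) => s sr.
  exact: (@partial_swap 5 f [::] c a sf isT s sr).
exact: (etrans h (@partial_swap 5 f [:: c] b a sf isT t tr)).
Qed.

Lemma gradient_bound_oscillation (f : 'rV[R]_d -> R) B :
  (forall t, `|t - theta0| < rho -> differentiable f t) ->
  (forall t b, `|t - theta0| < rho -> `|partial b f t| <= B) ->
  forall t, `|t - theta0| < rho -> `|f t - f theta0| <= D * (`|t - theta0| * B).
Proof.
move=> df fB t tr; have c0 : `|theta0 - theta0| < rho.
  by rewrite subrr normr0 (le_lt_trans _ tr).
have := @partial_expansion1 _ _ f (fun=> 0) theta0 rho B theta0 t df _ c0 tr.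
rewrite big1 ?subr0 => [|b _]; last by rewrite mulr0.
by apply=> s b sr; rewrite subr0; exact: fB.
Qed.

(** It involves derivatives at the single point theta0, whose moments are finite, and a
    bound [S5] on the squares of the fifth derivatives. Squares appear instead of
    absolute values because the moment conditions are about polynomials in the
    derivatives. *)
Definition derivative_envelope (f : 'rV[R]_d -> R) (S5 : 5.-tuple 'I_d -> R) : R :=
  1 + \sum_(I : 3.-tuple 'I_d) partials I f theta0 ^+ 2
    + \sum_(I : 4.-tuple 'I_d) partials I f theta0 ^+ 2 + \sum_I S5 I.

(** Integrate back from the fifth derivatives to the second ones: each step uses the
    value at theta0 and a bound on the next derivatives on a ball of radius at
    most 1. *)
Lemma envelope_oscillation (f : 'rV[R]_d -> R) S5 : rho <= 1 -> smooth_on_ball 5 f ->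
  (forall (I : 5.-tuple 'I_d) t, `|t - theta0| < rho -> partials I f t ^+ 2 <= S5 I) ->
  forall (I : seq 'I_d) t, (2 <= size I <= 3)%N -> `|t - theta0| < rho ->
  `|partials I f t - partials I f theta0| <=
    `|t - theta0| * ((1 + D) ^+ 3 * derivative_envelope f S5).
Proof.
move=> rho1 sf fS I t I23 tr.
have rho0 : 0 < rho by rewrite (le_lt_trans _ tr).
have S50 J : 0 <= S5 J.
  by apply: le_trans (fS J theta0 _); rewrite ?sqr_ge0// subrr normr0.
set H := derivative_envelope f S5.
have D0 : 0 <= D by [].
have H1 : 1 <= H.
  rewrite /H /derivative_envelope -!addrA lerDl !addr_ge0// sumr_ge0// => J _; exact: sqr_ge0.
have H0 : 0 <= H by exact: le_trans H1.
have sq (u : R) : `|u| <= 1 + u ^+ 2.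
  by have := ler_norm_mul_sqr 1 u; rewrite mul1r expr1n.
have sum3 : 0 <= \sum_(J : 3.-tuple 'I_d) partials J f theta0 ^+ 2.
  by apply: sumr_ge0 => J _; exact: sqr_ge0.
have sum4 : 0 <= \sum_(J : 4.-tuple 'I_d) partials J f theta0 ^+ 2.
  by apply: sumr_ge0 => J _; exact: sqr_ge0.
have sum5 : 0 <= \sum_J S5 J by apply: sumr_ge0.
have center J : (3 <= size J <= 4)%N -> `|partials J f theta0| <= H.
  move=> J34; apply: (le_trans (sq _)); rewrite /H /derivative_envelope.
  have [J3|J4] : size J = 3 \/ size J = 4.
  - by case/andP: J34 => h1; rewrite leq_eqVlt ltnS => /orP[/eqP|h2];
      [right|left; apply/eqP; rewrite eqn_leq h1 h2].
  - have JE : J = tcast J3 (in_tuple J) :> seq _ by rewrite val_tcast.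
    rewrite JE (bigD1 (tcast J3 (in_tuple J)))//= -!addrA !lerD2l lerDl.
    by rewrite !addr_ge0// sumr_ge0// => J' _; exact: sqr_ge0.
  - have JE : J = tcast J4 (in_tuple J) :> seq _ by rewrite val_tcast.
    rewrite JE [X in _ + X + _](bigD1 (tcast J4 (in_tuple J)))//= -!addrA lerD2l.
    rewrite addrCA lerDl.
    by rewrite !addr_ge0// sumr_ge0// => J' _; exact: sqr_ge0.
have b5 J s : size J = 5 -> `|s - theta0| < rho -> `|partials J f s| <= H.
  move=> J5 sr; have JE : J = tcast J5 (in_tuple J) :> seq _ by rewrite val_tcast.
  apply: (le_trans (sq _)); rewrite JE.
  apply: (@le_trans _ _ (1 + S5 (tcast J5 (in_tuple J)))); first by rewrite lerD2l fS.
  rewrite /H /derivative_envelope [X in _ <= _ + X](bigD1 (tcast J5 (in_tuple J)))//=.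
  rewrite -!addrA lerD2l addrA addrA -[leLHS]addr0 -addrA addrCA lerD2l.
  by rewrite !addr_ge0// sumr_ge0.
have osc J B s : (size J < 5)%N -> 0 <= B ->
    (forall u b, `|u - theta0| < rho -> `|partials (b :: J) f u| <= B) ->
    `|s - theta0| < rho -> `|partials J f s - partials J f theta0| <= `|s - theta0| * (D * B).
  move=> J5 B0 hB sr; rewrite mulrCA; apply: gradient_bound_oscillation => // u ur.
  exact: sf.
have osc' J B s : (size J < 5)%N -> 0 <= B ->
    (forall u b, `|u - theta0| < rho -> `|partials (b :: J) f u| <= B) ->
    `|s - theta0| < rho -> `|partials J f s - partials J f theta0| <= D * B.
  move=> J5 B0 hB sr; apply: (le_trans (osc _ _ _ J5 B0 hB sr)).
  by rewrite ler_piMl ?mulr_ge0// ltW// (lt_le_trans sr).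
have b4 J s : size J = 4 -> `|s - theta0| < rho -> `|partials J f s| <= H + D * H.
  move=> J4 sr; rewrite -(subrKC (partials J f theta0) (partials J f s)).
  apply: (le_trans (ler_normD _ _)); apply: lerD; first by rewrite center// J4.
  by apply: osc' => // [|u b ur]; [rewrite J4|apply: b5 => //=; rewrite J4].
have b3 J s : size J = 3 -> `|s - theta0| < rho -> `|partials J f s| <= H + D * (H + D * H).
  move=> J3 sr; rewrite -(subrKC (partials J f theta0) (partials J f s)).
  apply: (le_trans (ler_normD _ _)); apply: lerD; first by rewrite center// J3.
  apply: osc' => // [||u b ur]; [by rewrite J3|by rewrite addr_ge0// mulr_ge0|].
  by apply: b4 => //=; rewrite J3.
(* Each integration costs a factor 1 + D at most, three of them for second derivatives. *)
have E3 : (1 + D) ^+ 3 * H = D * (H + D * (H + D * H)) + (H + 2 * D * H + 2 * D ^+ 2 * H) by ring.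
have E2 : (1 + D) ^+ 3 * H = D * (H + D * H) + (H + 2 * D * H + 2 * D ^+ 2 * H + D ^+ 3 * H) by ring.
have pD k : 0 <= D ^+ k by rewrite exprn_ge0.
have [I2|I3] : size I = 2 \/ size I = 3.
- by case/andP: I23 => h1; rewrite leq_eqVlt ltnS => /orP[/eqP|h2];
      [right|left; apply/eqP; rewrite eqn_leq h1 h2].
- apply: (@le_trans _ _ (`|t - theta0| * (D * (H + D * (H + D * H))))).
    apply: osc => // [||u b ur]; [by rewrite I2| |].
      by rewrite !addr_ge0// !mulr_ge0// addr_ge0// mulr_ge0.
    by apply: b3 => //=; rewrite I2.
  by rewrite ler_wpM2l// E3 lerDl !addr_ge0// !mulr_ge0.
- apply: (@le_trans _ _ (`|t - theta0| * (D * (H + D * H)))).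
    apply: osc => // [||u b ur]; [by rewrite I3|by rewrite addr_ge0// mulr_ge0|].
    by apply: b4 => //=; rewrite I3.
  by rewrite ler_wpM2l// E2 lerDl !addr_ge0// !mulr_ge0.
Qed.

End smooth_on_ball.

(** * Sample means of the derivatives of the log-density *)

Section sample_means.
Context {R : realType} {d : nat} {dY : measure_display} {Y : measurableType dY}.
Variables (mu : {sigma_finite_measure set Y -> \bar R}) (p : Y -> 'rV[R]_d -> R)
  (Theta : set 'rV[R]_d) (theta0 : 'rV[R]_d).
Context {dO : measure_display} {Omega : measurableType dO}.
Variables (P : probability Omega R) (y : nat -> {RV P >-> Y}).
Hypotheses (Theta_theta0 : nbhs theta0 Theta) (p_density : density_family mu p Theta)
  (p_diff : log_density_differentiable p theta0)
  (p_moments : moments_of_derivatives mu p theta0)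
  (y_iid : iid_sample mu p theta0 y).
Local Notation E := (expect mu p theta0).

Lemma measurable_true_density : measurable_fun setT (p ^~ theta0).
Proof. by have [] := p_density (nbhs_singleton Theta_theta0). Qed.

Lemma true_density_gt0 z : 0 < p z theta0.
Proof. by have [] := nbhs_singleton p_diff z. Qed.

Let mp := measurable_true_density.
Let p0 := true_density_gt0.

Let mpV : measurable_fun setT (fun z => (p z theta0)^-1).
Proof.
have := measurableT_comp (@measurable_powR R (-1)) mp.
by apply: eq_measurable_fun => z _ /=; rewrite powR_inv1// ltW.
Qed.

(** Only p times the monomial is known to be integrable, hence measurable; divide
    by p. *)
Lemma measurable_score_monomial s : all (fun I : seq 'I_d => 0 < size I <= 4)%N s ->
  measurable_fun setT (score_monomial p s theta0).
Proof.
move=> hs; have [/integrableP[/measurable_EFinP m _] _] := nbhs_singleton (p_moments hs).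
have := measurable_funM mpV m.
by apply: eq_measurable_fun => z _ /=; rewrite mulKf// gt_eqF.
Qed.

(** The square of a monomial is a monomial, so that the law of large numbers with
    second moments applies to every monomial. *)
Lemma score_monomial_mean_cvg s e : 0 < e -> all (fun I : seq 'I_d => 0 < size I <= 4)%N s ->
  prob_vanishes P (fun n => [set w |
    e < `|n%:R^-1 * \sum_(i < n) score_monomial p s theta0 (y i w) - E (score_monomial p s theta0)|]).
Proof.
move=> e0 hs; apply: (sample_mean_cvg mp p0 y_iid e0); first exact: measurable_score_monomial.
have hss : all (fun I : seq 'I_d => 0 < size I <= 4)%N (s ++ s) by rewrite all_cat hs.
have [+ _] := nbhs_singleton (p_moments hss); apply: eq_integrable => // z _ /=.
by rewrite expr2 /score_monomial big_cat.
Qed.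

Lemma partials_mean_cvg (I : seq 'I_d) e : 0 < e -> (0 < size I <= 4)%N ->
  prob_vanishes P (fun n => [set w |
    e < `|n%:R^-1 * \sum_(i < n) partials I (logp p (y i w)) theta0
          - E (fun z => partials I (logp p z) theta0)|]).
Proof.
move=> e0 hI; have := @score_monomial_mean_cvg [:: I] e e0.
have -> : score_monomial p [:: I] theta0 = (fun z => partials I (logp p z) theta0).
  by apply/funext => z; rewrite /score_monomial big_seq1.
by apply; rewrite /= hI.
Qed.

Lemma fisher_positive_definite :
  positive_definite (sample_information p theta0 y 1) -> positive_definite (fisher mu p theta0).
Proof.
have sE a b : (fun z => partial a (logp p z) theta0 * partial b (logp p z) theta0) =
    score_monomial p [:: [:: a]; [:: b]] theta0.
  by apply/funext => z; rewrite /score_monomial big_cons big_seq1.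
have hs (a b : 'I_d) : all (fun I : seq 'I_d => 0 < size I <= 4)%N [:: [:: a]; [:: b]] by [].
apply: (fisher_posdef mp p0 y_iid) => a b.
- by rewrite sE; exact: measurable_score_monomial.
- have [+ _] := nbhs_singleton (p_moments (hs a b)); apply: eq_integrable => // z _ /=.
  by rewrite -sE.
Qed.

Definition bounded_mean (f : Y -> R) : Prop :=
  exists M : R, prob_vanishes P (fun n => [set w | M < n%:R^-1 * \sum_(i < n) f (y i w)]).

Lemma bounded_meanD f g : bounded_mean f -> bounded_mean g -> bounded_mean (fun z => f z + g z).
Proof.
move=> [M1 h1] [M2 h2]; exists (M1 + M2).
apply: prob_vanishes_sub (prob_vanishesU h1 h2); apply: nearW => n w /=.
rewrite big_split mulrDr => h; apply: contrapT => /not_orP[/negP + /negP].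
by rewrite -!leNgt => h3 h4; move: h; rewrite ltNge lerD.
Qed.

Lemma bounded_mean_cst c : 0 <= c -> bounded_mean (fun=> c).
Proof.
move=> c0; exists c; apply: (@prob_vanishes_le _ _ _ P _ (cst 0)); last exact: cvg_cst.
apply: nearW => n; rewrite [X in mu_ext P X](_ : _ = set0) ?mu_ext0//.
apply/seteqP; split => // w /=; rewrite sumr_const card_ord ltNge => /negP; apply.
rewrite -[c *+ n]mulr_natl; have [->|n0] := eqVneq n 0; first by rewrite mulrA mulr0 mul0r.
by rewrite mulKf// pnatr_eq0.
Qed.

Lemma bounded_mean_sum (I : finType) (f : I -> Y -> R) :
  (forall i, bounded_mean (f i)) -> bounded_mean (fun z => \sum_i f i z).
Proof.
move=> hf; suff h (s : seq I) : bounded_mean (fun z => \sum_(i <- s) f i z).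
  exact: h (index_enum I).
elim: s => [|i s IH].
  have -> : (fun z => \sum_(i <- [::]) f i z) = fun=> 0 by apply/funext => z; rewrite big_nil.
  exact: bounded_mean_cst.
have -> : (fun z => \sum_(j <- i :: s) f j z) = (fun z => f i z + \sum_(j <- s) f j z).
  by apply/funext => z; rewrite big_cons.
exact: bounded_meanD.
Qed.

Lemma bounded_mean_of_cvg f :
  prob_vanishes P (fun n => [set w | 1 < `|n%:R^-1 * \sum_(i < n) f (y i w) - E f|]) ->
  bounded_mean f.
Proof.
move=> h; exists (E f + 1); apply: prob_vanishes_sub h; apply: nearW => n w /=.
by rewrite addrC -ltrBrDr => h; apply: (lt_le_trans h); exact: ler_norm.
Qed.

Lemma bounded_mean_partials_sqr (I : seq 'I_d) : (0 < size I <= 4)%N ->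
  bounded_mean (fun z => partials I (logp p z) theta0 ^+ 2).
Proof.
move=> hI; apply: bounded_mean_of_cvg.
have := @score_monomial_mean_cvg [:: I; I] 1 ltr01.
have -> : score_monomial p [:: I; I] theta0 = (fun z => partials I (logp p z) theta0 ^+ 2).
  by apply/funext => z; rewrite /score_monomial big_cons big_seq1 expr2.
by apply; rewrite /= hI.
Qed.

Section fifth_derivatives.
Variables (U : set 'rV[R]_d) (I : seq 'I_d).
Hypothesis U0 : nbhs theta0 U.
Hypothesis moments5 : forall k, mu.-integrable setT
  (fun z => (p z theta0)%:E * sup_square_derivative p U I z ^+ k)%E.
Local Notation S := (sup_square_derivative p U I).

Lemma sup_square_ge0 z : (0 <= S z)%E.
Proof.
apply: ereal_sup_ge; exists ((partials I (logp p z) theta0 ^+ 2)%:E).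
  by exists theta0 => //; exact: nbhs_singleton U0.
by rewrite lee_fin sqr_ge0.
Qed.

Lemma measurable_sup_square : measurable_fun setT S.
Proof.
have /integrableP[m _] := moments5 1.
have mV : measurable_fun setT (fun z => ((p z theta0)^-1)%:E) by exact/measurable_EFinP.
have := emeasurable_funM mV m.
apply: eq_measurable_fun => z _ /=; rewrite muleA -EFinM mulVf ?mul1e// gt_eqF//.
Qed.

(** The supremum is integrable against the density, which is positive; hence it is
    infinite on a null set only, and no observation falls there. *)
Lemma sup_square_lt_pinfty : prob_vanishes P
  (fun n => [set w | exists i : 'I_n, S (y i w) = +oo%E]).
Proof.
have mS := measurable_sup_square.
pose A := S @^-1` [set +oo%E].
have mA : measurable A by rewrite -[A]setTI; exact: mS.
have muA : mu A = 0%E.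
  have /integrable_ae [] := moments5 1 => [//|N [mN N0 sub]].
  apply/eqP; rewrite -measure_le0 -N0; apply: le_measure; rewrite ?inE//.
  move=> z Az; apply: sub => /=; apply/not_implyP; split => //.
  by rewrite Az gt0_muley// lte_fin.
have PA i : P (y i @^-1` A) = 0%E.
  rewrite (y_iid.1 i A mA); apply: null_set_integral => //.
  exact/measurable_EFinP/measurable_funTS.
have hQ : eventually_almost_surely y (fun n s => forall i : 'I_n, S (tnth s i) != +oo%E).
  apply: nearW => n; apply: (@filter_forall Omega 'I_n
    (fun i w => S (tnth (sample y n w) i) != +oo%E) (almost_everywhere P)) => i.
  exists (y i @^-1` A); split => //.
    by rewrite -[X in measurable X]setTI; exact: (measurable_funPT (y i)).
  by move=> w /=; rewrite tnth_mktuple => /negP; rewrite negbK => /eqP.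
apply: prob_vanishes_sub (prob_vanishes_ae hQ); apply: nearW => n w /= [i Si] hn.
by have := hn i; rewrite tnth_mktuple Si eqxx.
Qed.

(** The law of large numbers for the real part of the supremum, whose square is
    integrable by the second moment condition. *)
Lemma bounded_mean_sup_square : bounded_mean (fun z => fine (S z)).
Proof.
have mS := measurable_sup_square; have S0 := sup_square_ge0.
have mf : measurable_fun setT (fun z => fine (S z)).
  by apply: (@measurableT_comp _ _ _ _ _ _ fine) => //.
apply: bounded_mean_of_cvg; apply: (sample_mean_cvg mp p0 y_iid) => //.
apply: (le_integrable _ _ _ (moments5 2)) => //.
  apply/measurable_EFinP; apply: measurable_funM => //; exact: measurable_funX.
move=> z _ /=; have pz := ltW (p0 z).
have f0 : 0 <= p z theta0 * fine (S z) ^+ 2 by rewrite mulr_ge0// sqr_ge0.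
have e0 : (0 <= (p z theta0)%:E * (S z * S z))%E by rewrite !mule_ge0.
rewrite ger0_norm// gee0_abs//.
rewrite EFinM lee_pmul2l// ?lte_fin//.
by case: (S z) (S0 z) => [s _|_|//] /=; rewrite ?mulyy ?leey// -EFinM expr2.
Qed.

End fifth_derivatives.

End sample_means.

(** * Log-likelihood of a sample *)

Section with_high_probability.
Context {R : realType} {dO : measure_display} {Omega : measurableType dO}.
Variable P : probability Omega R.
Implicit Types Q : nat -> Omega -> Prop.

(** Conjunctions of properties are easier to manage than unions of exceptional
    events. *)
Definition whp Q : Prop := prob_vanishes P (fun n => [set w | ~ Q n w]).

Lemma whp_and Q Q' : whp Q -> whp Q' -> whp (fun n w => Q n w /\ Q' n w).
Proof.
move=> h h'; apply: prob_vanishes_sub (prob_vanishesU h h'); apply: nearW => n w /=.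
by move=> nQ; have [q|] := pselect (Q n w); [right => q'; exact: nQ|left].
Qed.

Lemma whp_forall (I : finType) (Q : I -> nat -> Omega -> Prop) :
  (forall i, whp (Q i)) -> whp (fun n w => forall i, Q i n w).
Proof.
move=> h; apply: prob_vanishes_sub (prob_vanishes_ex h); apply: nearW => n w /=.
by move=> /existsNP.
Qed.

Lemma whp_le (f g : nat -> Omega -> R) :
  prob_vanishes P (fun n => [set w | f n w < g n w]) -> whp (fun n w => g n w <= f n w).
Proof.
by apply: prob_vanishes_sub; apply: nearW => n w /= /negP; rewrite -ltNge.
Qed.

End with_high_probability.

Lemma exists_small {R : realType} (A B eps : R) : 0 < eps ->
  exists eta : R, [/\ 0 < eta, eta <= 1, A * eta <= 1 & B * eta < eps].
Proof.
(* The reciprocal of a sum dominates all the constraints at once. *)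
move=> e0; pose M := `|A| + 1 + (`|B| + 1) / eps.
have A1 : 0 < `|A| + 1 by rewrite ltr_wpDl.
have B1 : 0 < (`|B| + 1) / eps by rewrite divr_gt0// ltr_wpDl.
have M1 : 1 <= M by rewrite /M -addrA addrCA lerDl addr_ge0// ltW.
have M0 : 0 < M by exact: lt_le_trans M1.
exists M^-1; split; first by rewrite invr_gt0.
- by rewrite invf_le1.
- rewrite ler_pdivrMr// mul1r; apply: (le_trans (ler_norm A)).
  by rewrite /M -addrA lerDl addr_ge0// ltW.
- rewrite ltr_pdivrMr//; apply: (le_lt_trans (ler_norm B)).
  rewrite /M mulrDr (mulrC eps (_ / eps)) divfK ?gt_eqF//.
  apply: (@lt_le_trans _ _ (`|B| + 1)); first by rewrite ltrDl.
  by rewrite lerDr mulr_ge0// ltW.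
Qed.

(** A maximizer on Theta is a local maximizer once it is close to theta0, which is an
    interior point of Theta. *)
Lemma maximizer_critical {R : realType} {d : nat} (Theta : set 'rV[R]_d) (theta0 : 'rV[R]_d)
    (rho : R) (f u : 'rV[R]_d -> R) (x : 'rV[R]_d) a :
  (forall t, `|t - theta0| < rho -> Theta t) ->
  (forall t, `|t - theta0| < rho -> f t = expR (u t)) ->
  (forall t, `|t - theta0| < rho -> differentiable u t) ->
  `|x - theta0| < rho -> maximizes Theta f x -> partial a u x = 0.
Proof.
move=> hT hf du xr [_ mx]; apply: partial_local_max.
  by apply: filterS (near_in_ball xr) => t; exact: du.
apply: filterS (near_in_ball xr) => t tr.
by have := mx t (hT t tr); rewrite !hf// ler_expR.
Qed.

Section log_likelihood.
Context {R : realType} {d : nat} {dY : measure_display} {Y : measurableType dY}.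
Variables (p : Y -> 'rV[R]_d -> R) (theta0 : 'rV[R]_d) (rho : R).
Hypotheses (rho0 : 0 < rho) (rho1 : rho <= 1)
  (p_pos : forall z t, `|t - theta0| < rho -> 0 < p z t)
  (l_smooth : forall z, smooth_on_ball theta0 rho 5 (logp p z)).
Local Notation D := (d%:R : R).

Definition log_likelihood n (s : 'I_n -> Y) (t : 'rV[R]_d) : R := \sum_i logp p (s i) t.

Lemma exp_log_likelihood n (s : 'I_n -> Y) t : `|t - theta0| < rho ->
  \prod_i p (s i) t = expR (log_likelihood s t).
Proof.
move=> tr; rewrite /log_likelihood.
apply: (big_ind2 (fun a b => a = expR b)); first by rewrite expR0.
  by move=> a1 b1 a2 b2 -> ->; rewrite expRD.
by move=> i _; rewrite /logp lnK// posrE p_pos.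
Qed.

Lemma smooth_log_likelihood n (s : 'I_n -> Y) : smooth_on_ball theta0 rho 5 (log_likelihood s).
Proof. exact: smooth_bigsum. Qed.

Variable S5 : 5.-tuple 'I_d -> Y -> R.

(** The law of large numbers is needed at theta0 only; it extends to a ball because the
    oscillation on the ball is at most its radius times the sample mean of an
    envelope, which is bounded. *)
Lemma log_likelihood_derivatives n (s : 'I_n -> Y) (I : seq 'I_d) (e M eta c : R) :
  (0 < n)%N -> (2 <= size I <= 3)%N -> 0 < c -> c <= rho ->
  (forall i (J : 5.-tuple 'I_d) t, `|t - theta0| < rho ->
     partials J (logp p (s i)) t ^+ 2 <= S5 J (s i)) ->
  `|n%:R^-1 * \sum_i partials I (logp p (s i)) theta0 - e| <= eta / 2 ->
  n%:R^-1 * \sum_i derivative_envelope theta0 (logp p (s i)) (S5 ^~ (s i)) <= M ->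
  c * ((1 + D) ^+ 3 * M) <= eta / 2 ->
  forall t, `|t - theta0| < c ->
  `|partials I (log_likelihood s) t - n%:R * e| <= n%:R * eta.
Proof.
move=> n0 I23 c0 crho hS he hM hc t tc; have tr := lt_le_trans tc crho.
have N0 : 0 < n%:R :> R by rewrite ltr0n.
have I5 : (size I <= 5)%N by case/andP: I23 => _ h; exact: leq_trans h _.
rewrite (partials_bigsum (k := 5) (fun i => l_smooth (s i)))//.
set A := \sum_i partials I (logp p (s i)) t.
pose A0 := \sum_i partials I (logp p (s i)) theta0.
pose F := \sum_i derivative_envelope theta0 (logp p (s i)) (S5 ^~ (s i)).
have h1 : `|A - A0| <= `|t - theta0| * ((1 + D) ^+ 3 * F).
  rewrite /A /A0 -sumrB /F !mulr_sumr; apply: (le_trans (ler_norm_sum _ _ _)).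
  by apply: ler_sum => i _; apply: (envelope_oscillation rho1 (l_smooth (s i)) (hS i)).
have F0 : 0 <= F.
  apply: sumr_ge0 => i _; rewrite /derivative_envelope !addr_ge0// sumr_ge0// => J _.
  - exact: sqr_ge0.
  - exact: sqr_ge0.
  - by apply: le_trans (hS i J theta0 _); rewrite ?sqr_ge0// subrr normr0.
have FM : F <= n%:R * M.
  by move: hM; rewrite -/F mulrC ler_pdivrMr// mulrC.
have D30 : 0 <= (1 + D) ^+ 3 by rewrite exprn_ge0// addr_ge0.
have h2 : `|A - A0| <= n%:R * (eta / 2).
  apply: (le_trans h1); apply: (@le_trans _ _ (c * ((1 + D) ^+ 3 * (n%:R * M)))).
    by rewrite ler_pM ?mulr_ge0 ?ler_wpM2l// ltW.
  have -> : c * ((1 + D) ^+ 3 * (n%:R * M)) = n%:R * (c * ((1 + D) ^+ 3 * M)) by ring.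
  by rewrite ler_wpM2l// ltW.
have h3 : `|A0 - n%:R * e| <= n%:R * (eta / 2).
  have -> : A0 - n%:R * e = n%:R * (n%:R^-1 * A0 - e) by rewrite mulrBr mulVKf// gt_eqF.
  by rewrite normrM gtr0_norm// ler_wpM2l// ltW.
have -> : A - n%:R * e = (A - A0) + (A0 - n%:R * e) by rewrite addrA subrK.
apply: (le_trans (ler_normD _ _)); apply: (le_trans (lerD h2 h3)).
by rewrite -mulrDr -splitr.
Qed.

End log_likelihood.

(** * Samples on which the comparison applies *)

Section comparison.
Context {R : realType} {d : nat} {dY : measure_display} {Y : measurableType dY}.
Variables (mu : {sigma_finite_measure set Y -> \bar R}) (Theta : set 'rV[R]_d)
  (p : Y -> 'rV[R]_d -> R) (theta0 : 'rV[R]_d).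
Context {dO : measure_display} {Omega : measurableType dO}.
Variables (P : probability Omega R) (y : nat -> {RV P >-> Y}) (piPM piMAP : 'rV[R]_d -> R)
  (thMLE thMAP : forall n : nat, n.-tuple Y -> 'rV[R]_d).
Hypotheses (mTheta : measurable Theta) (Theta_theta0 : nbhs theta0 Theta)
  (p_density : density_family mu p Theta) (y_iid : iid_sample mu p theta0 y)
  (p_diff : log_density_differentiable p theta0)
  (p_moments : moments_of_derivatives mu p theta0)
  (p_moments5 : moments_of_fifth_derivatives mu p theta0)
  (p_info : positive_definite (sample_information p theta0 y 1))
  (piPM_density : prior_density Theta piPM)
  (piPM_diff : prior_differentiable theta0 piPM)
  (piMAP_diff : prior_differentiable theta0 piMAP).
Local Notation l := (logp p).
Local Notation D := (d%:R : R).
Let g := fisher mu p theta0.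
Let G := invmx g.
Let L c b a := mean_third mu p c b a theta0.
Let lam t := ln (piPM t).
Let lam' t := ln (piMAP t).
Let sigma a := - (2^-1 * \sum_b \sum_c G b c * L a b c).

Let g_pd : positive_definite g.
Proof. exact: (fisher_positive_definite Theta_theta0 p_density p_diff p_moments y_iid). Qed.

Let g_unit : g \in unitmx.
Proof. by rewrite unitmxE unitfE gt_eqF// positive_definite_det_gt0. Qed.

Let L_sym a b c : L c b a = L a b c.
Proof.
have [rho rho0 h] := near_ballP p_diff.
have h3 : (fun z => partials [:: c; b; a] (l z) theta0) =
    (fun z => partials [:: a; b; c] (l z) theta0).
  apply/funext => z; apply: (@third_partials_rev _ _ theta0 rho (l z) a b c).
    by move=> t tr; have [_] := h t tr z.
  by rewrite subrr normr0.
exact: (congr1 (expect mu p theta0) h3).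
Qed.

(** The analytic facts that hold at all points of some neighbourhood of theta0. *)
Definition regular_point (U : set 'rV[R]_d) (t : 'rV[R]_d) : Prop :=
  [/\ Theta t, forall z, 0 < p z t /\ times_differentiable 5 (l z) t,
    [/\ 0 < piPM t, differentiable lam t & forall a, {for t, continuous (partial a lam)}],
    [/\ 0 < piMAP t, differentiable lam' t & forall a, {for t, continuous (partial a lam')}] & U t].

Lemma near_regular (U : set 'rV[R]_d) (eta : R) : nbhs theta0 U -> 0 < eta ->
  \forall t \near theta0, regular_point U t /\
    [/\ forall a, `|partial a lam t - partial a lam theta0| <= eta / 2,
        forall a, `|partial a lam' t - partial a lam' theta0| <= eta / 2 &
        forall a, `|matching_field mu p a t - sigma a| <= eta].
Proof.
move=> U0 eta0; have e2 : 0 < eta / 2 by rewrite divr_gt0.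
have rPM := log_prior_regular piPM_diff; have rMAP := log_prior_regular piMAP_diff.
have [_ _ cPM] := nbhs_singleton rPM; have [_ _ cMAP] := nbhs_singleton rMAP.
have oPM := near_oscillation e2 cPM; have oMAP := near_oscillation e2 cMAP.
have mf : \forall t \near theta0, forall a, `|matching_field mu p a t - sigma a| <= eta.
  apply: (@filter_forall 'rV[R]_d 'I_d
    (fun a t => `|matching_field mu p a t - sigma a| <= eta) (nbhs theta0)) => a.
  have := @matching_field_cvg _ _ _ _ _ _ _ _ Theta_theta0 p_density p_diff p_moments g_pd a.
  by move/cvgrPdist_le => /(_ eta eta0); apply: filterS => t; rewrite distrC.
near=> t; split; first by split; near: t.
by split; near: t.
Unshelve. all: by end_near. Qed.

Lemma mean_second_partials a b :
  expect mu p theta0 (fun z => partials [:: b; a] (l z) theta0) = - g b a.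
Proof.
have := nbhs_singleton (fisher_second Theta_theta0 p_density p_diff p_moments b a).
by rewrite -/g => ->; rewrite opprK.
Qed.

(** The deterministic comparison, for a sample on which finitely many sample means are
    close to their limits, the estimates are close to theta0, and the tail of the
    posterior is small. *)
Lemma good_sample_bound (n : nat) (s : n.-tuple Y) (U : set 'rV[R]_d) (M K eta rho r C tau : R)
    (x z : 'rV[R]_d) (a : 'I_d) :
  0 < eta -> eta <= 1 -> (0 < n)%N -> 1 <= n%:R * eta ^+ 2 ->
  (forall t, `|t - theta0| < rho -> regular_point U t /\
    [/\ forall b, `|partial b lam t - partial b lam theta0| <= eta / 2,
        forall b, `|partial b lam' t - partial b lam' theta0| <= eta / 2 &
        forall b, `|matching_field mu p b t - sigma b| <= eta]) ->
  0 < r -> 2 * r <= rho -> rho <= 1 -> 2 * r * ((1 + D) ^+ 3 * M) <= eta / 2 ->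
  1 <= K -> (forall b c, `|G b c| <= K) -> (forall b c e, `|L b c e| <= K) ->
  (forall b, `|partial b lam theta0| + 1 <= K) -> (forall b, `|partial b lam' theta0| + 1 <= K) ->
  4 * (D * D * K * (D + K) + D * D * K) * eta <= 1 ->
  0 <= C -> (forall b t, `|partial b (bump theta0 r) t| <= C) ->
  C * (3 * r + 1) * (4 / r) * tau <= eta -> 4 / r * tau <= eta -> 2 * tau <= eta ->
  `|tail_moment Theta theta0 r (fun t => likelihood p s t * piPM t)| <= tau * n%:R^-1 ->
  (forall i (J : 5.-tuple 'I_d), sup_square_derivative p U J (tnth s i) != +oo%E) ->
  (forall b c, `|n%:R^-1 * (\sum_i partials [:: c; b] (l (tnth s i)) theta0) - - g c b| <= eta / 2) ->
  (forall b c e, `|n%:R^-1 * (\sum_i partials [:: e; c; b] (l (tnth s i)) theta0) - L e c b|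
     <= eta / 2) ->
  n%:R^-1 * (\sum_i derivative_envelope theta0 (l (tnth s i))
    (fun J => fine (sup_square_derivative p U J (tnth s i)))) <= M ->
  has_posterior_mean p Theta piPM s ->
  maximizes Theta (likelihood p s) x ->
  maximizes Theta (fun t => likelihood p s t * piMAP t) z ->
  `|x - theta0| <= r / 4 -> `|z - theta0| <= r ->
  (forall b, `|partial b (fun t => ln (piPM t / piMAP t)) x - matching_field mu p b x| <= eta) ->
  `|n%:R * (posterior_mean p Theta piPM s ord0 a - z ord0 a)| <= comparison_constant D K * eta.
Proof.
move=> eta0 eta1 n0 nL reg r0 rrho rho1 rM K1 GK LK lamK lamK' small C0 bC t1 t2 t3.
move=> tail S5 avg2 avg3 avgF pm mx mz xr zr mat.
have rho0 : 0 < rho by apply: lt_le_trans rrho; rewrite mulr_gt0.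
have N0 : 0 < n%:R :> R by rewrite ltr0n.
have inrho t : `|t - theta0| < 2 * r -> `|t - theta0| < rho by move=> h; exact: lt_le_trans rrho.
have r4 : 0 <= 4 / r by rewrite divr_ge0// ltW.
have r2r : r < 2 * r by rewrite mulr_natl mulr2n ltrDl.
have l_smooth w : smooth_on_ball theta0 rho 5 (l w).
  by move=> t /reg[[_ + _ _ _] _] => /(_ w)[].
have p_pos w t : `|t - theta0| < rho -> 0 < p w t.
  by move=> /reg[[_ + _ _ _] _] => /(_ w)[].
pose ell := log_likelihood p (tnth s).
have ell_smooth : smooth_on_ball theta0 rho 5 ell by exact: smooth_log_likelihood.
have likE t : `|t - theta0| < rho -> likelihood p s t = expR (ell t).
  exact: (exp_log_likelihood p_pos).
have supb i (J : 5.-tuple 'I_d) t : `|t - theta0| < rho ->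
    partials J (l (tnth s i)) t ^+ 2 <= fine (sup_square_derivative p U J (tnth s i)).
  move=> /reg[[_ _ _ _ Ut] _].
  have ub : ((partials J (l (tnth s i)) t ^+ 2)%:E <= sup_square_derivative p U J (tnth s i))%E.
    by apply: ereal_sup_ubound; exists t.
  rewrite -lee_fin fineK//; have := S5 i J; move: ub.
  by case: (sup_square_derivative _ _ _ _).
have r20 : 0 < 2 * r by rewrite mulr_gt0.
have der I e : (2 <= size I <= 3)%N ->
    `|n%:R^-1 * \sum_i partials I (l (tnth s i)) theta0 - e| <= eta / 2 ->
    forall t, `|t - theta0| < 2 * r -> `|partials I ell t - n%:R * e| <= n%:R * eta.
  move=> I23 he t tr.
  exact: (log_likelihood_derivatives
    (S5 := fun (J : 5.-tuple 'I_d) w => fine (sup_square_derivative p U J w))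
    rho0 rho1 l_smooth n0 I23 r20 rrho supb he avgF rM tr).
have [[iq Z0] iq1] := pm.
have N1 : 1 <= n%:R :> R by rewrite ler1n.
have tn : tau * n%:R^-1 <= tau.
  have tau0 : 0 <= tau by have := le_trans (normr_ge0 _) tail; rewrite pmulr_lge0// invr_gt0.
  by rewrite -[leRHS]mulr1 ler_wpM2l// invf_le1.
set W := tail_moment _ _ _ _ in tail.
have Wtau : W <= tau by exact: le_trans (ler_norm _) (le_trans tail tn).
have K0 : 0 <= K by exact: le_trans K1.
have lamosc t u b : `|t - theta0| < 2 * r -> `|u - theta0| < 2 * r ->
    `|partial b lam t - partial b lam u| <= eta.
  move=> /inrho/reg[_ [+ _ _]] /inrho/reg[_ [+ _ _]] => /(_ b) h1 /(_ b) h2.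
  rewrite [leRHS]splitr -(subrK (partial b lam theta0) (partial b lam t)) -addrA.
  by apply: (le_trans (ler_normD _ _)); rewrite lerD// distrC.
have lamosc' t u b : `|t - theta0| < 2 * r -> `|u - theta0| < 2 * r ->
    `|partial b lam' t - partial b lam' u| <= eta.
  move=> /inrho/reg[_ [_ + _]] /inrho/reg[_ [_ + _]] => /(_ b) h1 /(_ b) h2.
  rewrite [leRHS]splitr -(subrK (partial b lam' theta0) (partial b lam' t)) -addrA.
  by apply: (le_trans (ler_normD _ _)); rewrite lerD// distrC.
have c0 : `|theta0 - theta0| < 2 * r by rewrite subrr normr0.
have lamb b t : `|t - theta0| < 2 * r -> `|partial b lam t| <= K.
  move=> tr; rewrite -(subrKC (partial b lam theta0) (partial b lam t)).
  apply: (le_trans (ler_normD _ _)); apply: le_trans (lamK b); rewrite lerD2l.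
  exact: le_trans (lamosc _ _ b tr c0) eta1.
have lamb' b t : `|t - theta0| < 2 * r -> `|partial b lam' t| <= K.
  move=> tr; rewrite -(subrKC (partial b lam' theta0) (partial b lam' t)).
  apply: (le_trans (ler_normD _ _)); apply: le_trans (lamK' b); rewrite lerD2l.
  exact: le_trans (lamosc' _ _ b tr c0) eta1.
have dell t : `|t - theta0| < rho -> differentiable ell t by move=> tr; exact: (ell_smooth t tr [::]).
have xrho : `|x - theta0| < rho.
  apply: (le_lt_trans xr); apply: lt_le_trans rrho; apply: lt_trans r2r.
  by rewrite ltr_pdivrMr// ltr_pMr// ltr1n.
have zrho : `|z - theta0| < 2 * r by exact: le_lt_trans zr r2r.
have hT t : `|t - theta0| < rho -> Theta t by move=> /reg[[]].
have x_crit b : partial b ell x = 0 by exact: (maximizer_critical b hT likE dell xrho mx).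
have z_crit b : partial b ell z + partial b lam' z = 0.
  have [[_ _ _ [_ dz _] _] _] := reg z (inrho z zrho).
  rewrite -partialD//; last exact/dell/inrho.
  apply: (maximizer_critical b hT _ _ (inrho z zrho) mz) => t tr.
  - have [[_ _ _ [pt _ _] _] _] := reg t tr.
    by rewrite expRD -likE// /lam' lnK// posrE.
  - by have [[_ _ _ [_ dt _] _] _] := reg t tr; apply: differentiableD => //; exact: dell.
have match_xz b :
    `|partial b lam x - partial b lam' x + 2^-1 * \sum_c \sum_e G c e * L b c e| <= 2 * eta.
  have [[_ _ [px dx _] [px' dx' _] _] [_ _ /(_ b) m1]] := reg x xrho.
  have lnE : partial b (fun t => ln (piPM t / piMAP t)) x = partial b lam x - partial b lam' x.
    rewrite -partialB//; apply: near_eq_partial; apply: filterS (near_in_ball xrho) => t.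
    by move=> /reg[[_ _ [pt _ _] [pt' _ _] _] _]; rewrite ln_div// posrE.
  have := mat b; rewrite lnE; move: m1; rewrite /sigma.
  move: (matching_field mu p b x) (partial b lam x - partial b lam' x) (2^-1 * _) => u1 u2 u3.
  rewrite mulr_natl mulr2n => h1 h2.
  have -> : u2 + u3 = (u2 - u1) + (u1 - - u3) by rewrite opprK addrA subrK.
  by apply: (le_trans (ler_normD _ _)); exact: lerD.
have q0 t : Theta t -> 0 <= likelihood p s t * piPM t.
  move=> Tt; apply: mulr_ge0; last exact: piPM_density.2.
  by apply: prodr_ge0 => i _; have [_ + _] := p_density Tt; exact.
have res := @posterior_mean_map_bound R d Theta theta0 r C (likelihood p s) ell piPM piMAP x z n%:R
  K eta g G L r0 mTheta (fun t tr => hT t (inrho t tr)) (fun t tr => likE t (inrho t tr)).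
rewrite mxE; apply: res => //.
- by move=> I t I2 tr; apply: ell_smooth; [exact: inrho|rewrite ltnS; exact: leq_trans I2 _].
- by move=> t /inrho/reg[[_ _ [] ]].
- by move=> t /inrho/reg[[_ _ [] ]].
- by move=> b t /inrho/reg[[_ _ [_ _ h] _ _] _]; exact: h.
- exact: mulmxV.
- exact: mulVmx.
- move=> b c t tr; have := der [:: c; b] (- g c b) isT (avg2 b c) t tr.
  by rewrite mulrN opprK.
- by move=> b c e t tr; exact: der [:: e; c; b] (L e c b) isT (avg3 b c e) t tr.
- by move=> b t u tr ur; exact: lamosc.
- by move=> b t u tr ur; exact: lamosc'.
- by apply: le_trans t1; rewrite ler_wpM2l// mulr_ge0// mulr_ge0// addr_ge0// mulr_ge0// ltW.
- by apply: le_trans t2; rewrite ler_wpM2l.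
- apply: le_trans t3; rewrite mulrCA ler_wpM2l//.
  by move: (le_trans (ler_norm _) tail); rewrite ler_pdivlMr// mulrC.
Qed.

End comparison.

(** * The theorem *)

Section small_outer_probability.
Context {R : realType} {dO : measure_display} {Omega : measurableType dO}.
Variable P : probability Omega R.

Lemma prob_small_o_n2_vanishes (E : nat -> set Omega) :
  prob_small_o_n2 P E -> prob_vanishes P E.
Proof.
move=> h; have hE : \forall n \near \oo,
    (cst 0%E n <= mu_ext P (E n) <= (n%:R ^+ 2)%:E * mu_ext P (E n))%E.
  near=> n; apply/andP; split; first exact: mu_ext_ge0.
  rewrite -[leLHS]mul1e lee_wpmul2r ?mu_ext_ge0// lee_fin exprn_ege1// ler1n.
  by near: n; exists 1%N.
exact: (squeeze_cvge hE (cvg_cst _) h).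
Unshelve. all: by end_near. Qed.

End small_outer_probability.

(** All terms of the envelope are squares of derivatives at theta0, or suprema of such
    squares. *)
Lemma bounded_mean_envelope (R : realType) (d : nat) (dY : measure_display)
    (Y : measurableType dY) (mu : {sigma_finite_measure set Y -> \bar R}) (Theta : set 'rV[R]_d)
    (p : Y -> 'rV[R]_d -> R) (theta0 : 'rV[R]_d) (dO : measure_display)
    (Omega : measurableType dO) (P : probability Omega R) (y : nat -> {RV P >-> Y})
    (U : set 'rV[R]_d) :
  nbhs theta0 Theta -> density_family mu p Theta -> log_density_differentiable p theta0 ->
  moments_of_derivatives mu p theta0 -> iid_sample mu p theta0 y -> nbhs theta0 U ->
  (forall (J : 5.-tuple 'I_d) k, mu.-integrable setT
    (fun z => (p z theta0)%:E * sup_square_derivative p U J z ^+ k)%E) ->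
  bounded_mean y (fun z => derivative_envelope theta0 (logp p z)
    (fun J => fine (sup_square_derivative p U J z))).
Proof.
move=> nT pd pdiff pm iid U0 m5.
have sq k : (0 < k <= 4)%N -> bounded_mean y
    (fun z => \sum_(J : k.-tuple 'I_d) partials J (logp p z) theta0 ^+ 2).
  move=> hk; apply: bounded_mean_sum => J.
  by apply: (bounded_mean_partials_sqr nT pd pdiff pm iid); rewrite size_tuple.
apply: bounded_meanD; last first.
  by apply: bounded_mean_sum => J; exact: (bounded_mean_sup_square nT pd pdiff iid U0 (m5 J)).
apply: bounded_meanD; last exact: (sq 4).
apply: bounded_meanD; last exact: (sq 3).
exact: bounded_mean_cst.
Qed.

Theorem theorem2p1 (R : realType) (d : nat)
  (dY : measure_display) (Y : measurableType dY)
  (mu : {sigma_finite_measure set Y -> \bar R})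
  (Theta : set 'rV[R]_d) (p : Y -> 'rV[R]_d -> R) (theta0 : 'rV[R]_d)
  (dO : measure_display) (Omega : measurableType dO) (P : probability Omega R)
  (y : nat -> {RV P >-> Y})
  (piPM piMAP : 'rV[R]_d -> R)
  (thMLE thMAP : forall n : nat, n.-tuple Y -> 'rV[R]_d)
  (mTheta : measurable Theta) (Theta_theta0 : nbhs theta0 Theta)
  (p_density : density_family mu p Theta)
  (y_iid : iid_sample mu p theta0 y)
  (p_diff : log_density_differentiable p theta0)
  (p_moments : moments_of_derivatives mu p theta0)
  (p_moments5 : moments_of_fifth_derivatives mu p theta0)
  (p_info : forall n : nat, (0 < n)%N ->
     positive_definite (sample_information p theta0 y n))
  (p_bartlett : bartlett_identities mu p theta0)
  (p_kl : kl_identifiable mu p theta0 Theta)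
  (piPM_density : prior_density Theta piPM)
  (piMAP_density : prior_density Theta piMAP)
  (piPM_diff : prior_differentiable theta0 piPM)
  (piMAP_diff : prior_differentiable theta0 piMAP)
  (piPM_tail : posterior_tail_condition p theta0 Theta y piPM)
  (piMAP_tail : posterior_tail_condition p theta0 Theta y piMAP)
  (mleP : eventually_almost_surely y
     (fun n s => maximizes Theta (likelihood p s) (thMLE n s)))
  (mapP : eventually_almost_surely y
     (fun n s => maximizes Theta
        (fun theta => likelihood p s theta * piMAP theta) (thMAP n s)))
  (pmP : eventually_almost_surely y
     (fun n s => has_posterior_mean p Theta piPM s))
  (mle_consistent : consistent_o_n2 theta0 y thMLE)
  (map_consistent : consistent theta0 y thMAP)
  (pm_tail : posterior_mean_tail_condition p theta0 Theta y piPM)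
  (matching : forall a : 'I_d,
     small_op P
       (fun n w => let that := thMLE n (sample y n w) in
          partial a (fun theta => ln (piPM theta / piMAP theta)) that
          - matching_field mu p a that)
       (fun n => n%:R^-1)) :
  forall a : 'I_d,
    small_op P
      (fun n w => posterior_mean p Theta piPM (sample y n w) ord0 a
                  - thMAP n (sample y n w) ord0 a)
      (fun n => n%:R^-1).
Proof.
move=> a eps eps0.
have [U U0 m5] := p_moments5.
have m5' (J : 5.-tuple 'I_d) k : mu.-integrable setT
    (fun z => (p z theta0)%:E * sup_square_derivative p U J z ^+ k)%E.
  exact: (nbhs_singleton (m5 J k (size_tuple J))).1.
have info1 := p_info 1 isT.
have [M hM] := bounded_mean_envelope Theta_theta0 p_density p_diff p_moments y_iid U0 m5'.
pose g := fisher mu p theta0; pose G := invmx g.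
pose L c b a := mean_third mu p c b a theta0.
pose lam t := ln (piPM t); pose lam' t := ln (piMAP t).
pose SG := \sum_b \sum_c `|G b c|; pose SL := \sum_b \sum_c \sum_e `|L b c e|.
pose Sl := \sum_b `|partial b lam theta0|; pose Sl' := \sum_b `|partial b lam' theta0|.
have SG0 : 0 <= SG by rewrite sumr_ge0// => b _; rewrite sumr_ge0.
have SL0 : 0 <= SL by rewrite sumr_ge0// => b _; rewrite sumr_ge0// => c _; rewrite sumr_ge0.
have Sl0 : 0 <= Sl by rewrite sumr_ge0.
have Sl'0 : 0 <= Sl' by rewrite sumr_ge0.
have [K [K1 KSG KSL KSl KSl']] :
    exists K, [/\ 1 <= K, SG <= K, SL <= K, Sl + 1 <= K & Sl' + 1 <= K].
  exists (1 + SG + SL + Sl + Sl'); move: SG SL Sl Sl' SG0 SL0 Sl0 Sl'0 => u1 u2 u3 u4 *.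
  by split; lra.
have le_sum (F : 'I_d -> R) b : (forall c, 0 <= F c) -> F b <= \sum_c F c.
  by move=> F0; rewrite (bigD1 b)//= lerDl sumr_ge0.
have GK b c : `|G b c| <= K.
  apply: le_trans KSG.
    apply: le_trans (le_sum (fun b => \sum_c `|G b c|) b _) => [|b']; last exact: sumr_ge0.
    exact: (le_sum (fun c => `|G b c|) c).
have LK b c e : `|L b c e| <= K.
  apply: le_trans KSL.
    apply: le_trans (le_sum (fun b => \sum_c \sum_e `|L b c e|) b _) => [|b'].
      apply: le_trans (le_sum (fun c => \sum_e `|L b c e|) c _) => [|c']; last exact: sumr_ge0.
      exact: (le_sum (fun e => `|L b c e|) e).
    by rewrite sumr_ge0// => c' _; exact: sumr_ge0.
have lamK b : `|partial b lam theta0| + 1 <= K.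
  by apply: le_trans KSl; rewrite lerD2r; exact: (le_sum (fun b => `|partial b lam theta0|) b).
have lamK' b : `|partial b lam' theta0| + 1 <= K.
  by apply: le_trans KSl'; rewrite lerD2r; exact: (le_sum (fun b => `|partial b lam' theta0|) b).
have [eta [eta0 eta1 small cst_eta]] := @exists_small R
  (4 * (d%:R * d%:R * K * (d%:R + K) + d%:R * d%:R * K)) (comparison_constant d%:R K) eps eps0.
have e20 : 0 < eta / 2 by rewrite divr_gt0.
have [rho' rho'0 reg'] := near_ballP (near_regular Theta_theta0 p_density y_iid p_diff p_moments
  info1 piPM_diff piMAP_diff U0 eta0).
pose rho := Num.min rho' 1.
have rho0 : 0 < rho by rewrite lt_min rho'0 ltr01.
have rho1 : rho <= 1 by rewrite ge_min lexx orbT.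
have rho_le : rho <= rho' by rewrite ge_min lexx.
have reg t (h : `|t - theta0| < rho) := reg' t (lt_le_trans h rho_le).
(* The radius r is chosen before n: it makes the oscillation of the normalized derivatives
   at most eta / 2. The constants C and tau depend on it. *)
pose B : R := (1 + d%:R) ^+ 3 * (`|M| + 1).
have B0 : 0 < B by rewrite mulr_gt0 ?exprn_gt0// ltr_wpDl.
pose r := Num.min rho (eta / 2 / B) / 2.
have r0 : 0 < r by rewrite divr_gt0// lt_min rho0 divr_gt0.
have r2 : 2 * r = Num.min rho (eta / 2 / B) by rewrite /r mulrC divfK.
have rrho : 2 * r <= rho by rewrite r2 ge_min lexx.
have rM : 2 * r * ((1 + d%:R) ^+ 3 * M) <= eta / 2.
  apply: (@le_trans _ _ (2 * r * B)).
    apply: ler_wpM2l; first by rewrite mulr_ge0// ltW.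
    apply: ler_wpM2l; first by rewrite exprn_ge0// addr_ge0.
    by rewrite (le_trans (ler_norm M))// lerDl.
  by rewrite -ler_pdivlMr// r2 ge_min lexx orbT.
have [C C0 bC] := bounded_partial_bump theta0 r0.
have c20 : 0 <= 4 / r by rewrite divr_ge0// ltW.
have c10 : 0 <= C * (3 * r + 1) * (4 / r).
  apply: mulr_ge0 c20; apply: mulr_ge0 => //; apply: addr_ge0 => //.
  by apply: mulr_ge0 => //; exact: ltW.
pose S := C * (3 * r + 1) * (4 / r) + 4 / r + 2.
have S0 : 0 < S by apply: ltr_wpDl => //; exact: addr_ge0.
(* The three tail terms of the comparison have coefficients c / n with c <= S. *)
pose tau := eta / S.
have tau0 : 0 < tau by rewrite divr_gt0.
have cS c : 0 <= c -> c <= S -> c * tau <= eta.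
  by move=> c0 cS; rewrite /tau mulrCA ler_piMr ?(ltW eta0)// ler_pdivrMr// mul1r.
have t1 : C * (3 * r + 1) * (4 / r) * tau <= eta.
  by apply: cS => //; rewrite /S -addrA lerDl; apply: addr_ge0.
have t2 : 4 / r * tau <= eta.
  by apply: cS => //; rewrite /S addrAC lerDr; apply: addr_ge0.
have t3 : 2 * tau <= eta.
  by apply: cS => //; rewrite /S lerDr; apply: addr_ge0.
(* The events that make up a good sample. *)
have w1 : whp P (fun n w => `|thMLE n (sample y n w) - theta0| <= r / 4).
  by apply: whp_le; apply: prob_small_o_n2_vanishes; apply: mle_consistent; rewrite divr_gt0.
have w2 : whp P (fun n w => `|thMAP n (sample y n w) - theta0| <= r).
  by apply: whp_le; exact: map_consistent.
have w3 : whp P (fun n w => `|tail_moment Theta theta0 r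
    (fun t => likelihood p (sample y n w) t * piPM t)| <= tau * n%:R^-1).
  by apply: whp_le; apply: (pm_tail (r / 4)) => //; rewrite divr_gt0.
have w4 : whp P (fun n w => forall b, `|partial b (fun t => ln (piPM t / piMAP t))
    (thMLE n (sample y n w)) - matching_field mu p b (thMLE n (sample y n w))| <= eta * n%:R^-1).
  by apply: whp_forall => b; apply: whp_le; exact: matching.
have w5 := prob_vanishes_ae mleP.
have w6 := prob_vanishes_ae mapP.
have w7 := prob_vanishes_ae pmP.
have w8 : whp P (fun n w => forall b c, `|n%:R^-1 * (\sum_(i < n)
    partials [:: c; b] (logp p (y i w)) theta0) - - g c b| <= eta / 2).
  apply: whp_forall => b; apply: whp_forall => c; apply: whp_le.
  rewrite -(mean_second_partials Theta_theta0 p_density p_diff p_moments).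
  exact: (partials_mean_cvg Theta_theta0 p_density p_diff p_moments y_iid).
have w9 : whp P (fun n w => forall b c e, `|n%:R^-1 * (\sum_(i < n)
    partials [:: e; c; b] (logp p (y i w)) theta0) - L e c b| <= eta / 2).
  apply: whp_forall => b; apply: whp_forall => c; apply: whp_forall => e; apply: whp_le.
  exact: (partials_mean_cvg Theta_theta0 p_density p_diff p_moments y_iid).
have w10 := whp_le hM.
have w11 : whp P (fun n w => forall (J : 5.-tuple 'I_d), ~ exists i : 'I_n,
    sup_square_derivative p U J (y i w) = +oo%E).
  apply: whp_forall => J.
  have := sup_square_lt_pinfty Theta_theta0 p_density p_diff y_iid (m5' J).
  by apply: prob_vanishes_sub; apply: nearW => n w /= /contrapT.
have nlarge : \forall n \near \oo, (0 < n)%N /\ 1 <= n%:R * eta ^+ 2.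
  have n1 : \forall n \near \oo, eta ^- 2 <= n%:R := nbhs_infty_ger _.
  near=> n; split; first by near: n; exists 1%N.
  by rewrite -ler_pdivrMr ?exprn_gt0// div1r; near: n.
have w := whp_and w1 (whp_and w2 (whp_and w3 (whp_and w4 (whp_and w5 (whp_and w6
  (whp_and w7 (whp_and w8 (whp_and w9 (whp_and w10 w11))))))))).
apply: prob_vanishes_sub w; apply: filterS nlarge => n [n0 nL] w /= bad good.
move: bad; apply/negP; rewrite -leNgt.
move: good => [x1 [x2 [x3 [x4 [x5 [x6 [x7 [x8 [x9 [x10 x11]]]]]]]]]].
set s := sample y n w in x1 x2 x3 x4 x5 x6 x7 *.
have sE (f : Y -> R) : \sum_(i < n) f (tnth s i) = \sum_(i < n) f (y i w).
  by apply: eq_bigr => i _; rewrite tnth_mktuple.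
have N0 : 0 < n%:R :> R by rewrite ltr0n.
have mat b : `|partial b (fun t => ln (piPM t / piMAP t)) (thMLE n s)
    - matching_field mu p b (thMLE n s)| <= eta.
  apply: (le_trans (x4 b)); rewrite -[leRHS]mulr1 ler_wpM2l ?(ltW eta0)// invf_le1//.
  by rewrite ler1n.
have sup_fin i (J : 5.-tuple 'I_d) : sup_square_derivative p U J (tnth s i) != +oo%E.
  by apply/eqP => Si; apply: (x11 J); exists i; rewrite tnth_mktuple in Si.
have avg2 b c : `|n%:R^-1 * (\sum_i partials [:: c; b] (logp p (tnth s i)) theta0) - - g c b|
    <= eta / 2.
  by rewrite (sE (fun z => partials [:: c; b] (logp p z) theta0)); exact: x8.
have avg3 b c e : `|n%:R^-1 * (\sum_i partials [:: e; c; b] (logp p (tnth s i)) theta0) - L e c b|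
    <= eta / 2.
  by rewrite (sE (fun z => partials [:: e; c; b] (logp p z) theta0)); exact: x9.
have avgF : n%:R^-1 * (\sum_i derivative_envelope theta0 (logp p (tnth s i))
    (fun J => fine (sup_square_derivative p U J (tnth s i)))) <= M.
  rewrite (sE (fun z => derivative_envelope theta0 (logp p z)
    (fun J => fine (sup_square_derivative p U J z)))); exact: x10.
have := good_sample_bound mTheta Theta_theta0 p_density y_iid p_diff p_moments info1 piPM_density
  a eta0 eta1 n0 nL reg r0 rrho rho1 rM K1 GK LK lamK lamK' small C0 bC t1 t2 t3 x3 sup_fin
  avg2 avg3 avgF x7 x5 x6 x1 x2 mat.
rewrite normrM gtr0_norm// => h.
rewrite ler_pdivlMr// mulrC; apply: (le_trans h); exact: ltW.
Unshelve. all: by end_near. Qed.
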